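(* Let $N$ be square-free such that $X_N=\overline{\Gamma_0(N)^+}\backslash\mathbb{H}$ has genus zero, with normalized Hauptmodul $j_N$. Then there exist an integer $n_N\ge1$ and polynomials $P_N,Q_N$ of degrees $n_N$ and $n_N+2$ respectively such that $$\frac{S(j_N)(z)}{(j_N'(z))^2}=-\frac{P_N(j_N(z))}{Q_N(j_N(z))}=-R_N(j_N(z)).$$ Moreover, one may take $Q_N(y)=2\prod_{e\in\mathcal{E}_N}(y-j_N(e))^2$, where $\mathcal{E}_N$ is the set of inequivalent elliptic points of $X_N$; with this choice the leading coefficient of $P_N$ equals one and $n_N\le 2\bigl(|\mathcal{E}_N|-1\bigr)$.
   Context: $\Gamma_0(N)^+=\{e^{-1/2}\begin{pmatrix} a&b\\ c&d\end{pmatrix}\in \mathrm{SL}(2,\mathbb{R}): ad-bc=e,\ a,b,c,d,e\in\mathbb{Z},\ e\mid N,\ e\mid a,\ e\mid d,\ N\mid c\}$, acting on $\mathbb{H}$. When $X_N$ has genus zero it has one cusp at $i\infty$ of width one, and the normalized Hauptmodul $j_N$ is the $\Gamma_0(N)^+$-invariant holomorphic function generating the function field of $X_N$ with $q$-expansion $q^{-1}+\sum_{k\ge1}a_N(k)q^k$, $q=e^{2\pi iz}$. Elliptic points are fixed points in $\mathbb{H}$ of elliptic elements of $\Gamma_0(N)^+$, taken up to equivalence. The Schwarzian derivative is $S(f)=(f''/f')'-\tfrac12(f''/f')^2$. *)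

(* Defs.v *)
From HB Require Import structures.
From mathcomp Require Import all_boot all_order all_algebra.
From mathcomp Require Import complex.
From mathcomp Require Import all_classical all_reals all_analysis.

Set Implicit Arguments.
Unset Strict Implicit.
Unset Printing Implicit Defensive.

Import Order.TTheory GRing.Theory Num.Theory.
Import numFieldNormedType.Exports.

Local Open Scope ring_scope.
Local Open Scope complex_scope.
Local Open Scope classical_set_scope.

(* R[i] seen as a numFieldType, so that it carries the topology of a normed
   module over itself: derivatives below are complex derivatives. *)
Definition Cplx (R : realType) : numFieldType := R[i].

(* The condition excludes N = 0. *)
Definition squarefree (N : nat) : Prop :=
  forall d : nat, (d ^ 2 %| N)%N -> d = 1%N.

Section Defs.
Variable R : realType.
Local Notation C := (Cplx R).

Definition uhp : set C := [set z | 0 < complex.Im z].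

Definition Gamma0plus (N : nat) : set 'M[R]_2 :=
  [set g | exists (e : nat) (a b c d : int),
    [/\ (e %| N)%N, (e%:Z %| a)%Z, (e%:Z %| d)%Z & (N%:Z %| c)%Z] /\
    a * d - b * c = e%:Z /\
    g = (Num.sqrt e%:R)^-1 *:
        \matrix_(i < 2, k < 2)
          (if i == 0 then (if k == 0 then a else b)
           else (if k == 0 then c else d))%:~R].

Definition cocycle (g : 'M[R]_2) (z : C) : C :=
  (g 1 0)%:C * z + (g 1 1)%:C.

Definition mobius (g : 'M[R]_2) (z : C) : C :=
  ((g 0 0)%:C * z + (g 0 1)%:C) / cocycle g z.

Definition equivalent (N : nat) (z w : C) : Prop :=
  exists2 g, Gamma0plus N g & mobius g z = w.

Definition elliptic_point (N : nat) (z : C) : Prop :=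
  uhp z /\ exists g, [/\ Gamma0plus N g, `|\tr g| < 2 & mobius g z = z].

(* E lists every class of elliptic points exactly once. *)
Definition elliptic_representatives (N : nat) (E : seq C) : Prop :=
  [/\ forall e, e \in E -> elliptic_point N e,
      forall z, elliptic_point N z -> exists2 e, e \in E & equivalent N z e,
      uniq E
    & forall e e', e \in E -> e' \in E -> equivalent N e e' -> e = e'].

Definition holomorphic_uhp (f : C -> C) : Prop :=
  forall z, uhp z -> derivable f z 1.

(* q = exp(2 pi i z) *)
Definition nome (z : C) : C :=
  (expR (- (2 * pi * complex.Im z)))%:C *
  (cos (2 * pi * complex.Re z) +i* sin (2 * pi * complex.Re z)).

(* The holomorphic differentials f dz on the compactification of X_N.  For
   square-free N the only cusp is the one at i oo, where dz = dq / (2 pi i q),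
   so that regularity there means that f tends to 0.  At elliptic points
   holomorphy upstairs is equivalent to holomorphy of the differential on the
   quotient. *)
Definition holomorphic_differential (N : nat) (f : C -> C) : Prop :=
  [/\ holomorphic_uhp f,
      forall g z, Gamma0plus N g -> uhp z ->
        f (mobius g z) = cocycle g z ^+ 2 * f z
    & forall eps : C, 0 < eps -> exists Y : R,
        forall z, uhp z -> Y < complex.Im z -> `|f z| < eps].

(* The genus is the dimension of the space of holomorphic differentials;
   functions are compared on the upper half-plane only. *)
Definition has_genus (N g : nat) : Prop :=
  exists b : 'I_g -> C -> C,
    (forall i, holomorphic_differential N (b i)) /\
    forall f, holomorphic_differential N f ->
      exists! c : 'rV[C]_g,
        forall z, uhp z -> f z = \sum_(i < g) c 0 i * b i z.

(* A meromorphic function is represented by a total function whose values at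
   an isolated set of points are irrelevant. *)
Definition meromorphic_uhp (f : C -> C) : Prop :=
  forall z0, uhp z0 -> exists (m : nat) (h : C -> C),
    (\forall w \near z0, derivable h w 1) /\
    (\forall w \near z0^', (w - z0) ^+ m * f w = h w).

(* The function field of X_N: invariant meromorphic functions on the upper
   half-plane which are meromorphic at the cusp i oo (the only one for
   square-free N), that is, O(q^-m) there for some m. *)
Definition modular_function (N : nat) (f : C -> C) : Prop :=
  [/\ meromorphic_uhp f,
      forall g z0, Gamma0plus N g -> uhp z0 ->
        \forall w \near z0^', f (mobius g w) = f w
    & exists (m : nat) (Y : R) (M : C),
        forall z, uhp z -> Y < complex.Im z -> `|f z| <= M * `|nome z| ^- m].

Definition normalized_hauptmodul (N : nat) (j : C -> C) : Prop :=
  [/\ holomorphic_uhp j,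
      forall g z, Gamma0plus N g -> uhp z -> j (mobius g z) = j z,
      exists a : nat -> C, forall z, uhp z ->
        (fun n : nat => (nome z)^-1 + \sum_(1 <= k < n) a k * nome z ^+ k)
          @ \oo --> j z
    & forall f, modular_function N f ->
        exists A B : {poly C}, B != 0 /\
          forall z0, uhp z0 ->
            \forall w \near z0^', f w = A.[j w] / B.[j w]].

Definition schwarzian (f : C -> C) (z : C) : C :=
  let u := fun w => derive1n 2 f w / derive1 f w in
  derive1 u z - 2^-1 * u z ^+ 2.

(* The points where j' vanishes are the poles of the left-hand side. *)
Definition schwarzian_equation (j : C -> C) (P Q : {poly C}) : Prop :=
  forall z, uhp z -> derive1 j z != 0 ->
    Q.[j z] != 0 /\
    schwarzian j z / derive1 j z ^+ 2 = - (P.[j z] / Q.[j z]).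

Definition elliptic_poly (j : C -> C) (E : seq C) : {poly C} :=
  2 *: \prod_(e <- E) ('X - (j e)%:P) ^+ 2.

End Defs.

(* Main.v *)
Require Import Defs.
From HB Require Import structures.
From mathcomp Require Import all_boot all_order all_algebra.
From mathcomp Require Import complex.
From mathcomp Require Import all_classical all_reals all_analysis.
From mathcomp Require Import ring lra zify.

Set Implicit Arguments.
Unset Strict Implicit.
Unset Printing Implicit Defensive.

Import Order.TTheory GRing.Theory Num.Theory.
Import numFieldNormedType.Exports.
Local Open Scope ring_scope.
Local Open Scope complex_scope.
Local Open Scope classical_set_scope.

(* By the definition of a Hauptmodul, f = S(j)/(j')^2 is a rational function
   of j, because it is invariant under Gamma_0(N)^+, meromorphic, and tends to
   0 at the cusp. To locate its poles, two global facts are needed. First, j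
   maps the upper half-plane onto C: |j - y| attains its minimum on a truncated
   strip meeting every orbit, and the minimum is 0 because j is nowhere locally
   constant. Second, j separates orbits: the set of values taken at two
   inequivalent points is open, bounded, and closed away from the finitely many
   critical values, hence empty. Consequently j' vanishes exactly at the
   elliptic points, and f has no poles elsewhere. Near an elliptic point e where
   j has order m, f (j - j e)^2 tends to (1 - m^2)/(2 m^2), so f * Q_N(j) stays
   bounded everywhere and is a polynomial p in j. At the cusp f j^2 tends to
   -1/2, so p has degree 2|E_N| - 2 and leading coefficient -1, and P_N = -p.
   Finally |E_N| = 1 is impossible: p = -1 would give (1 - m^2)/m^2 = -1. *)

(** * Topology and derivatives on the complex field *)

(** All local analysis takes place in q = [nome z], where j is 1/q plus a power series on the unit
    disc, so that derivatives and orders of zeros come from coefficient estimates. An expansion j w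
    - j z ~ l (w - z)^m with l nonzero and m > 0 at every point is all that the minimum principle
    and openness require. The constants are Schwarzians of powers. For u = s^m one has S(u) = (1 -
    m^2)/(2 s^2), hence S(u) u^2/(u')^2 = (1 - m^2)/(2 m^2). At the cusp j ~ 1/q, and 1/q has
    Schwarzian 0 in the variable q; what remains is the Schwarzian -tau^2/2 of q = exp(tau z), and
    division by (j')^2 ~ tau^2 q^-2 gives -q^2/2. Injectivity on orbits is what makes a critical
    point elliptic: an order m > 1 produces distinct nearby points with equal values, hence a group
    element that almost fixes the point, and proper discontinuity makes it fix the point exactly.
    Critical values are set apart in the connectedness argument because closedness rests on local
    injectivity of j. *)

Section Modulus.
Variable R : realType.
Local Notation C := (Cplx R).

(** The norm of [C] takes its values in [C]; this real-valued copy gives access to the order of [R]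
    and to [lra] and [nra]. *)
Definition nm (z : C) : R := complex.Re `|z|.

Lemma nmE (z : C) : `|z| = (nm z)%:C :> C.
Proof. by rewrite /nm RRe_real // normr_real. Qed.

Lemma nm_sqrt (z : C) :
  nm z = Num.sqrt (complex.Re z ^+ 2 + complex.Im z ^+ 2).
Proof. by rewrite /nm (@normc_def R z). Qed.

Lemma nm_ge0 (z : C) : 0 <= nm z.
Proof. by rewrite nm_sqrt sqrtr_ge0. Qed.

Lemma nm0 : nm 0 = 0.
Proof. by rewrite /nm normr0. Qed.

Lemma nm1 : nm 1 = 1.
Proof. by rewrite /nm normr1. Qed.

Lemma nm_eq0 (z : C) : (nm z == 0) = (z == 0).
Proof. by rewrite -[RHS]normr_eq0 nmE -(inj_eq (@complexI R)). Qed.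

Lemma nm_gt0 (z : C) : (0 < nm z) = (z != 0).
Proof. by rewrite lt_neqAle nm_ge0 andbT eq_sym nm_eq0. Qed.

Lemma nmM (x y : C) : nm (x * y) = nm x * nm y.
Proof. by apply: (@complexI R); rewrite rmorphM /= -!nmE normrM. Qed.

Lemma nmX (x : C) n : nm (x ^+ n) = nm x ^+ n.
Proof. by elim: n => [|n IH]; rewrite ?expr0 ?nm1 // !exprS nmM IH. Qed.

Lemma nmV (x : C) : nm x^-1 = (nm x)^-1.
Proof.
have [->|x0] := eqVneq x 0; first by rewrite invr0 nm0 invr0.
have nx0 : nm x != 0 by rewrite nm_eq0.
by apply: (mulfI nx0); rewrite -nmM !divff // nm1.
Qed.

Lemma nmN (x : C) : nm (- x) = nm x.
Proof. by rewrite /nm normrN. Qed.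

Lemma nmBC (x y : C) : nm (x - y) = nm (y - x).
Proof. by rewrite -opprB nmN. Qed.

Lemma ler_nmD (x y : C) : nm (x + y) <= nm x + nm y.
Proof.
have := ler_normD x y.
by rewrite !nmE -rmorphD /= lecR.
Qed.

Lemma ler_nmB (x y : C) : nm (x - y) <= nm x + nm y.
Proof. by rewrite -(nmN y); exact: ler_nmD. Qed.

Lemma ler_nm_dist (x y : C) : nm x - nm y <= nm (x - y).
Proof. by rewrite lerBlDr -{1}(subrK y x); exact: ler_nmD. Qed.

Lemma ler_nm_distD (x y z : C) : nm (x - y) <= nm (x - z) + nm (z - y).
Proof. by rewrite -{1}(subrK z x) -addrA; exact: ler_nmD. Qed.

Lemma nm_real (r : R) : nm (r%:C : C) = `|r|.
Proof. by rewrite nm_sqrt /= expr0n /= addr0 sqrtr_sqr. Qed.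

Lemma nm_nat (n : nat) : nm (n%:R : C) = n%:R.
Proof. by rewrite -(rmorph_nat (real_complex R)) nm_real ger0_norm. Qed.

Lemma ler_Re_nm (z : C) : `|complex.Re z| <= nm z.
Proof. by rewrite nm_sqrt -sqrtr_sqr ler_wsqrtr// lerDl sqr_ge0. Qed.

Lemma ler_Im_nm (z : C) : `|complex.Im z| <= nm z.
Proof. by rewrite nm_sqrt -sqrtr_sqr ler_wsqrtr// lerDr sqr_ge0. Qed.

Lemma nm_sqr (z : C) : nm z ^+ 2 = complex.Re z ^+ 2 + complex.Im z ^+ 2.
Proof. by rewrite nm_sqrt sqr_sqrtr// addr_ge0 ?sqr_ge0. Qed.

Lemma ler_nm_ReIm (z : C) : nm z <= `|complex.Re z| + `|complex.Im z|.
Proof.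
rewrite -(@ler_pXn2r _ 2)// ?nnegrE ?nm_ge0 ?addr_ge0//.
rewrite nm_sqr -(real_normK (num_real (complex.Re z))).
rewrite -(real_normK (num_real (complex.Im z))).
have := normr_ge0 (complex.Re z); have := normr_ge0 (complex.Im z); nra.
Qed.

Lemma ler_nm_sum (I : Type) (r : seq I) (P : pred I) (F : I -> C) :
  nm (\sum_(i <- r | P i) F i) <= \sum_(i <- r | P i) nm (F i).
Proof.
elim/big_rec2: _ => [|i y x _ le]; first by rewrite nm0.
exact: (le_trans (ler_nmD _ _) (lerD (lexx _) le)).
Qed.

Lemma Re_sub (x y : C) : complex.Re (x - y) = complex.Re x - complex.Re y.
Proof. exact: (raddfB (@complex.Re R)). Qed.

Lemma Im_sub (x y : C) : complex.Im (x - y) = complex.Im x - complex.Im y.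
Proof. exact: (raddfB (@complex.Im R)). Qed.

#[global] Instance Cplx_nbhs_filter (z : C) : ProperFilter (nbhs z).
Proof. exact: nbhs_pfilter. Qed.

#[global] Instance Cplx_dnbhs_filter (z : C) : ProperFilter (z^').
Proof. exact: Proper_dnbhs_numFieldType. Qed.

Lemma cvg_nmP (T : Type) (F : set_system T) (FF : Filter F) (f : T -> C) (l : C) :
  f @ F --> l <-> forall e : R, 0 < e -> \forall w \near F, nm (f w - l) < e.
Proof.
split.
  move=> /cvgrPdist_lt h e e0.
  have := h e%:C; rewrite ltcR => /(_ e0).
  by apply: filterS => w; rewrite nmE ltcR nmBC.
move=> h; apply/cvgrPdist_lt => e e0.
have eE : e = (complex.Re e)%:C by rewrite RRe_real// gtr0_real.
have : 0 < complex.Re e by rewrite -ltcR -eE.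
by move=> /h; apply: filterS => w; rewrite nmE eE ltcR nmBC.
Qed.

Lemma near_nmP (a : C) (P : C -> Prop) :
  (\forall w \near a, P w) <->
  exists2 e : R, 0 < e & forall w, nm (w - a) < e -> P w.
Proof.
split.
  move=> /nbhs_ballP[e /= e0 h].
  have eE : e = (complex.Re e)%:C by rewrite RRe_real// gtr0_real.
  exists (complex.Re e); first by rewrite -ltcR -eE.
  by move=> w hw; apply: h; rewrite /ball /= eE nmE ltcR nmBC.
move=> [e e0 h]; apply/nbhs_ballP; exists e%:C; first by rewrite /= ltcR.
by move=> w; rewrite /ball /= nmE ltcR nmBC; exact: h.
Qed.

Lemma near_dnmP (a : C) (P : C -> Prop) :
  (\forall w \near a^', P w) <->
  exists2 e : R, 0 < e & forall w, w != a -> nm (w - a) < e -> P w.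
Proof.
rewrite /dnbhs near_withinE; split.
  by move=> /near_nmP[e e0 h]; exists e => // w wa we; exact: h.
by move=> [e e0 h]; apply/near_nmP; exists e => // w we wa; exact: h.
Qed.

End Modulus.

Section Topology.
Variable R : realType.
Local Notation C := (Cplx R).

Lemma continuous_nm (z : C) : nm w @[w --> z] --> nm z.
Proof.
apply/(@cvgrPdist_lt R R) => e e0; near=> w; have we : nm (w - z) < e by near: w; apply/near_nmP; exists e.
apply: le_lt_trans we; rewrite ler_norml lerNl opprB.
by rewrite ler_nm_dist nmBC ler_nm_dist.
Unshelve. all: by end_near. Qed.

Lemma cvg_nm (T : Type) (F : set_system T) (FF : Filter F) (f : T -> C) (l : C) :
  f @ F --> l -> nm (f x) @[x --> F] --> nm l.
Proof. by move=> fl; exact: (cvg_comp _ _ fl (@continuous_nm l)). Qed.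

Lemma compact_rect (a b c d : R) :
  compact [set z : C | a <= complex.Re z <= b /\ c <= complex.Im z <= d].
Proof.
pose f (p : R * R) : C := p.1 +i* p.2.
have fc : continuous f.
  move=> p; apply/cvg_nmP => e e0.
  have e2 : 0 < e / 2 by rewrite divr_gt0.
  near=> w; apply: le_lt_trans (ler_nm_ReIm _) _.
  rewrite Re_sub Im_sub /= [e]splitr ltrD//.
    by near: w; apply: cvgr_distC_lt => //; exact: cvg_fst.
  near: w; apply: cvgr_distC_lt => //; exact: cvg_snd.
have := continuous_compact (continuous_subspaceT fc)
  (compact_setX (segment_compact (a:=a) (b:=b)) (segment_compact (a:=c) (b:=d))).
suff <- : f @` (`[a, b] `*` `[c, d]) =
  [set z : C | a <= complex.Re z <= b /\ c <= complex.Im z <= d] by [].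
 apply/seteqP; split => [z [[x y]]|] /=.
  by rewrite !in_itv /= => -[hx hy] <-.
move=> z [h1 h2]; exists (complex.Re z, complex.Im z) => /=.
  by rewrite !in_itv.
by rewrite /f /=; case: z {h1 h2}.
Unshelve. all: by end_near. Qed.

Lemma compact_nm_min (A : set C) (f : C -> C) (y : C) :
  compact A -> A !=set0 -> (forall z, A z -> f @ z --> f z) ->
  exists2 c, A c & forall t, A t -> nm (f c - y) <= nm (f t - y).
Proof.
move=> cA A0 fA.
have [|c cA' h] := @compact_EVT_min C R (fun z => nm (f z - y)) A A0 cA.
  apply: continuous_in_subspaceT => z /set_mem Az.
  by apply: cvg_nm; apply: cvgB; [exact: fA|exact: cvg_cst].
by exists c; [exact: set_mem|move=> t At; apply: h; exact: mem_set].
Qed.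

Lemma closed_nm_le (a : C) (r : R) : closed [set z : C | nm (z - a) <= r].
Proof.
have -> : [set z : C | nm (z - a) <= r] = (fun z => nm (z - a)) @^-1` [set x | x <= r].
  by [].
apply: closed_comp; last exact: closed_le.
by move=> z _; apply: cvg_nm; apply: cvgB; [exact: cvg_id|exact: cvg_cst].
Qed.

Lemma compact_disc (a : C) (r : R) : compact [set z : C | nm (z - a) <= r].
Proof.
apply: (subclosed_compact (@closed_nm_le a r) (@compact_rect
  (complex.Re a - r) (complex.Re a + r) (complex.Im a - r) (complex.Im a + r))).
move=> z /= h.
have := le_trans (ler_Re_nm _) h; have := le_trans (ler_Im_nm _) h.
rewrite Re_sub Im_sub !ler_norml => /andP[h1 h2] /andP[h3 h4].
by split; apply/andP; split; lra.
Qed.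

Lemma cvg_nm_le (T : Type) (F : set_system T) (FF : ProperFilter F)
    (u : T -> C) (l : C) (B : R) :
  u @ F --> l -> (\forall n \near F, nm (u n) <= B) -> nm l <= B.
Proof.
move=> /cvg_nm ul h; have <- := cvg_lim (@Rhausdorff R) ul.
by apply: limr_le; [apply: cvgP ul|].
Qed.

Lemma cvg_Re_Im (T : Type) (F : set_system T) (FF : Filter F) (u : T -> C)
    (l : C) :
  complex.Re (u x) @[x --> F] --> complex.Re l ->
  complex.Im (u x) @[x --> F] --> complex.Im l -> u @ F --> l.
Proof.
move=> hr hi; apply/cvg_nmP => e e0.
have e2 : 0 < e / 2 by rewrite divr_gt0.
near=> x; apply: le_lt_trans (ler_nm_ReIm _) _.
rewrite Re_sub Im_sub [e]splitr ltrD//; near: x.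
  by apply: (@cvgr_distC_lt R R).
by apply: (@cvgr_distC_lt R R).
Unshelve. all: by end_near. Qed.

Lemma Re_series (c : nat -> C) n :
  complex.Re (series c n) = series (fun k => complex.Re (c k)) n.
Proof. by rewrite /series /= (raddf_sum (@complex.Re R)). Qed.

Lemma Im_series (c : nat -> C) n :
  complex.Im (series c n) = series (fun k => complex.Im (c k)) n.
Proof. by rewrite /series /= (raddf_sum (@complex.Im R)). Qed.

Lemma geometric_partial_le (th : R) (n : nat) :
  0 <= th < 1 -> \sum_(0 <= k < n) th ^+ k <= (1 - th)^-1.
Proof.
move=> /andP[th0 th1]; have h : 0 < 1 - th by rewrite subr_gt0.
rewrite -(ler_pM2l h) divff ?gt_eqF// big_mkord.
by rewrite -opprB mulNr -subrX1 opprB gerBl exprn_ge0.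
Qed.

(** Real and imaginary parts are real series dominated by a geometric one, hence absolutely
    convergent; the bound on the limit is inherited from the partial sums. *)
Lemma geometric_dominated_cvg (c : nat -> C) (M th : R) :
  0 <= th < 1 -> (forall n, nm (c n) <= M * th ^+ n) ->
  exists2 s : C, series c @ \oo --> s & nm s <= M / (1 - th).
Proof.
move=> th01 h; case/andP: (th01) => th0 th1.
have M0 : 0 <= M by have := h 0%N; rewrite expr0 mulr1; apply: le_trans (nm_ge0 _).
have key (p : C -> R) : (forall z, `|p z| <= nm z) ->
    cvgn (series (fun k => p (c k))).
  move=> hp; apply: (@normed_cvg R R^o).
  apply: (@series_le_cvg _ _ (geometric M th)).
  - by move=> n /=.
  - by move=> n; rewrite /geometric /= mulr_ge0// exprn_ge0.
  - by move=> n; apply: le_trans (hp _) (h _).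
  - by apply: is_cvg_geometric_series; rewrite ger0_norm.
have /cvg_ex[/= x hx] := key _ (@ler_Re_nm R).
have /cvg_ex[/= y hy] := key _ (@ler_Im_nm R).
pose s : C := x +i* y.
have hs : series c @ \oo --> s.
  apply: cvg_Re_Im.
    by under eq_fun do rewrite Re_series.
  by under eq_fun do rewrite Im_series.
exists s; first exact: hs.
apply: (@cvg_nm_le nat \oo _ (series c) s _ hs); near=> n.
apply: le_trans (ler_nm_sum _ _ _) _.
apply: (@le_trans _ _ (\sum_(0 <= k < n) M * th ^+ k)).
  by apply: ler_sum => k _; exact: h.
by rewrite -mulr_sumr ler_wpM2l// geometric_partial_le.
Unshelve. all: by end_near. Qed.

End Topology.

Section Derivative.
Variable R : realType.
Local Notation C := (Cplx R).

(** The division-free form holds at [w = a] too, so error terms can be composed and summed without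
    excluding the centre. *)
Lemma is_derive_nmP (f : C -> C) (a l : C) :
  is_derive a (1 : C) f l <->
  forall e : R, 0 < e -> exists2 d : R, 0 < d &
    forall w, nm (w - a) < d -> nm (f w - f a - l * (w - a)) <= e * nm (w - a).
Proof.
suff E : ((fun h => h^-1 *: ((f \o shift a) (h *: (1 : C)) - f a)) @ 0^' --> l) <->
  forall e : R, 0 < e -> exists2 d : R, 0 < d &
    forall w, nm (w - a) < d -> nm (f w - f a - l * (w - a)) <= e * nm (w - a).
  split.
    by case=> h hl; apply/E; rewrite -hl; exact: h.
  move=> /E h; split; first exact: cvgP h.
  exact: (cvg_lim (@norm_hausdorff _ _) h).
rewrite cvg_nmP; split=> h e e0.
  have /near_dnmP[d d0 hd] := h _ e0; exists d => // w wd.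
  have [->|wa] := eqVneq w a; first by rewrite !subrr mulr0 subrr nm0 mulr0.
  have wa' : w - a != 0 by rewrite subr_eq0.
  have := hd (w - a) wa'; rewrite subr0 => /(_ wd) /= /ltW.
  rewrite /GRing.scale /= mulr1 subrK.
  have -> : f w - f a - l * (w - a) = ((w - a)^-1 * (f w - f a) - l) * (w - a).
    by rewrite mulrBl mulrAC mulVf// mul1r.
  by rewrite nmM => ?; rewrite ler_wpM2r// nm_ge0.
have [|d d0 hd] := h (e / 2); first by rewrite divr_gt0.
apply/near_dnmP; exists d => // w w0; rewrite subr0 => wd.
have := hd (w + a); rewrite addrK => /(_ wd).
rewrite /= /GRing.scale /= mulr1.
have -> : f (w + a) - f a - l * w = (w^-1 * (f (w + a) - f a) - l) * w.
  by rewrite mulrBl mulrAC mulVf// mul1r.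
rewrite nmM ler_pM2r ?nm_gt0// => /le_lt_trans; apply.
by rewrite ltr_pdivrMr// ltr_pMr// ltr1n.
Qed.

Lemma is_derive_continuous (f : C -> C) (a l : C) :
  is_derive a (1 : C) f l -> f @ a --> f a.
Proof.
by move=> [h _]; apply: differentiable_continuous; exact/derivable1_diffP.
Qed.

Lemma is_derive1_chain (f g : C -> C) (a l m : C) :
  is_derive a (1 : C) g m -> is_derive (g a) (1 : C) f l ->
  is_derive a (1 : C) (f \o g) (l * m).
Proof.
move=> hg hf; have gc := is_derive_continuous hg.
move: hg hf => /is_derive_nmP hg /is_derive_nmP hf; apply/is_derive_nmP => e e0.
have K0 : 0 < nm l + nm m + 1 by rewrite ltr_wpDl// addr_ge0// nm_ge0.
pose e1 := Num.min 1 (e / (2 * (nm l + nm m + 1))).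
have e10 : 0 < e1 by rewrite lt_min ltr01 divr_gt0// mulr_gt0.
have [d1 d10 h1] := hg _ e10; have [d2 d20 h2] := hf _ e10.
have /near_nmP[d3 d30 h3] : \forall w \near a, nm (g w - g a) < d2.
  by move/cvg_nmP: gc; apply.
exists (Num.min d1 d3); first by rewrite lt_min d10.
move=> w; rewrite lt_min => /andP[/h1 w1 /h3/h2 w2] /=.
have -> : f (g w) - f (g a) - l * m * (w - a) =
  (f (g w) - f (g a) - l * (g w - g a)) + l * (g w - g a - m * (w - a)) by ring.
apply: le_trans (ler_nmD _ _) _; rewrite nmM.
have gw : nm (g w - g a) <= (nm m + 1) * nm (w - a).
  rewrite -[g w - g a](subrK (m * (w - a))).
  apply: le_trans (ler_nmD _ _) _; rewrite nmM mulrDl mul1r addrC lerD2l.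
  by apply: le_trans w1 _; rewrite ler_piMl ?nm_ge0// ge_min lexx.
have e1l : e1 * (2 * (nm l + nm m + 1)) <= e.
  by rewrite -ler_pdivlMr ?mulr_gt0// ge_min lexx orbT.
have nl := nm_ge0 l; have nmm := nm_ge0 m; have nw := nm_ge0 (w - a).
have n1 : nm (f (g w) - f (g a) - l * (g w - g a)) <= e1 * (nm m + 1) * nm (w - a).
  by apply: le_trans w2 _; rewrite -mulrA ler_wpM2l// ltW.
have n2 : nm l * nm (g w - g a - m * (w - a)) <= e1 * nm l * nm (w - a).
  by rewrite [e1 * _]mulrC -mulrA ler_wpM2l.
apply: le_trans (lerD n1 n2) _; rewrite -mulrDl ler_wpM2r//.
apply: le_trans e1l; rewrite -mulrDr ler_wpM2l ?ltW//; lra.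
Qed.

End Derivative.

#[global] Opaque nm.

Section DerivativeRules.
Variable R : realType.
Local Notation C := (Cplx R).
Implicit Types (f g : C -> C) (a l m : C).

Lemma is_derive_cast f a l m : is_derive a (1 : C) f l -> l = m ->
  is_derive a (1 : C) f m.
Proof. by move=> h <-. Qed.

Lemma cderiv_cst a (k : C) : is_derive a (1 : C) (fun=> k) 0.
Proof. exact: is_derive_cst. Qed.

Lemma cderiv_id a : is_derive a (1 : C) (fun w => w) 1.
Proof. exact: is_derive_id. Qed.

Lemma cderivD f g a l m : is_derive a (1 : C) f l -> is_derive a (1 : C) g m ->
  is_derive a (1 : C) (fun w => f w + g w) (l + m).
Proof. by move=> hf hg; exact: is_deriveD. Qed.

Lemma cderivB f g a l m : is_derive a (1 : C) f l -> is_derive a (1 : C) g m ->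
  is_derive a (1 : C) (fun w => f w - g w) (l - m).
Proof. by move=> hf hg; exact: is_deriveB. Qed.

Lemma cderivM f g a l m : is_derive a (1 : C) f l -> is_derive a (1 : C) g m ->
  is_derive a (1 : C) (fun w => f w * g w) (l * g a + f a * m).
Proof.
move=> hf hg; apply: (is_derive_cast (is_deriveM hf hg)).
by rewrite /GRing.scale /= addrC [g a * l]mulrC.
Qed.

Lemma cderivMl (k : C) f a l : is_derive a (1 : C) f l ->
  is_derive a (1 : C) (fun w => k * f w) (k * l).
Proof.
move=> hf; apply: (is_derive_cast (cderivM (cderiv_cst a k) hf)).
by rewrite mul0r add0r.
Qed.

Lemma cderivX f a l n : is_derive a (1 : C) f l ->
  is_derive a (1 : C) (fun w => f w ^+ n) (n%:R * f a ^+ n.-1 * l).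
Proof.
move=> hf; elim: n => [|n IH].
  by rewrite !mul0r; apply: is_derive_cast (cderiv_cst a 1) _.
rewrite (_ : (fun w => f w ^+ n.+1) = (fun w => f w * f w ^+ n)); last first.
  by apply/funext => w; rewrite exprS.
apply: (is_derive_cast (cderivM hf IH)); case: n {IH} => [|n] /=.
  by rewrite !expr0; ring.
by rewrite !exprS -!natr1; ring.
Qed.

Lemma cderivV f a l : f a != 0 -> is_derive a (1 : C) f l ->
  is_derive a (1 : C) (fun w => (f w)^-1) (- l / f a ^+ 2).
Proof.
move=> fa [h1 h2]; split; first exact: derivableV.
by rewrite deriveV// h2 /GRing.scale /= mulrC mulrN mulNr.
Qed.

Lemma derive1_val f a l : is_derive a (1 : C) f l -> derive1 f a = l.
Proof. by move=> h; rewrite derive1E; exact: derive_val. Qed.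

Lemma cderiv_near f g a l : (\forall w \near a, f w = g w) ->
  is_derive a (1 : C) f l -> is_derive a (1 : C) g l.
Proof. exact: near_eq_is_derive. Qed.

Lemma cderiv_unique f a l m : is_derive a (1 : C) f l ->
  is_derive a (1 : C) f m -> l = m.
Proof. by move=> /derive1_val <- /derive1_val <-. Qed.

End DerivativeRules.

(** * Power series *)

Section PowerSeries.
Variable R : realType.
Local Notation C := (Cplx R).
Implicit Types (b c : nat -> C) (q z : C).

Lemma ger0_pow_small (x K e : R) : 0 <= x < 1 -> 0 < e ->
  exists m, K * x ^+ m < e.
Proof.
move=> /andP[x0 x1] e0.
have h : geometric K x @ \oo --> (0 : R) by apply: cvg_geometric; rewrite ger0_norm.
have /cvgrPdist_lt/(_ _ e0) [m _ hm] := h.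
exists m; have := hm m (leqnn m); rewrite sub0r normrN /=; exact: le_lt_trans (ler_norm _).
Qed.

(* The radius of convergence is at least 1. *)
Definition pscoef c := forall rho : R, 0 <= rho < 1 ->
  exists M : R, forall n, nm (c n) * rho ^+ n <= M.

Definition ps c q : C := lim (series (fun n => c n * q ^+ n) @ \oo).

Lemma ps_dominated c q (rho M : R) : nm q < rho ->
  (forall n, nm (c n) * rho ^+ n <= M) ->
  (series (fun n => c n * q ^+ n) @ \oo --> ps c q) /\
  nm (ps c q) <= M / (1 - nm q / rho).
Proof.
move=> qr h; have r0 : 0 < rho by apply: le_lt_trans qr; exact: nm_ge0.
have th01 : 0 <= nm q / rho < 1.
  by rewrite divr_ge0 ?nm_ge0 ?ltW//= ltr_pdivrMr// mul1r.
have [|s hs bs] := @geometric_dominated_cvg R (fun n => c n * q ^+ n) M _ th01.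
  move=> n; rewrite nmM nmX expr_div_n mulrA ler_pdivlMr ?exprn_gt0//.
  by rewrite mulrAC ler_wpM2r ?exprn_ge0 ?nm_ge0.
by rewrite /ps (cvg_lim (@norm_hausdorff _ _) hs).
Qed.

Lemma mid_lt1 (x : R) : x < 1 -> x < (1 + x) / 2 < 1.
Proof. by move=> x1; apply/andP; split; lra. Qed.

Lemma ps_cvg c q : pscoef c -> nm q < 1 ->
  series (fun n => c n * q ^+ n) @ \oo --> ps c q.
Proof.
move=> hc /mid_lt1/andP[h1 h2].
have [|M hM] := hc ((1 + nm q) / 2).
  by rewrite h2 andbT divr_ge0// addr_ge0// nm_ge0.
by have [] := ps_dominated h1 hM.
Qed.

Lemma ps_lim c q l : series (fun n => c n * q ^+ n) @ \oo --> l -> ps c q = l.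
Proof. exact: (cvg_lim (@norm_hausdorff _ _)). Qed.

Lemma pscoef_shift c : pscoef c -> pscoef (fun n => c n.+1).
Proof.
move=> hc rho /andP[r0 r1]; have [e|rp] := eqVneq rho 0.
  exists (nm (c 1%N)) => n; rewrite e expr0n; case: n => [|n] /=.
    by rewrite mulr1.
  by rewrite mulr0 nm_ge0.
have [|M hM] := hc rho; first by rewrite r0.
have rpos : 0 < rho by rewrite lt_neqAle eq_sym rp.
by exists (M / rho) => n; rewrite ler_pdivlMr// -mulrA -exprSr.
Qed.

(** Choose r between rho and 1 and set t = rho / r. Since t^k >= t^n for k < n, n t^n is at most 1 +
    t + ... + t^(n-1), hence at most 1/(1 - t). *)
Lemma pscoef_nat c : pscoef c -> pscoef (fun n => n%:R * c n).
Proof.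
move=> hc rho /andP[r0 r1]; have /andP[h1 h2] := mid_lt1 r1.
set r := (1 + rho) / 2 in h1 h2.
have rpos : 0 < r by apply: le_lt_trans h1.
have [|M hM] := hc r; first by rewrite ltW.
have th : 0 <= rho / r < 1.
  by rewrite divr_ge0 ?(ltW rpos)//= ltr_pdivrMr// mul1r.
exists (M * (1 - rho / r)^-1) => n.
have M0 : 0 <= M by apply: le_trans (hM 0%N); rewrite mulr_ge0 ?nm_ge0 ?exprn_ge0 ?(ltW rpos).
have hn : n%:R * (rho / r) ^+ n <= (1 - rho / r)^-1.
  apply: le_trans (geometric_partial_le n th).
  rewrite mulr_natl.
  have -> : (rho / r) ^+ n *+ n = \sum_(0 <= k < n) (rho / r) ^+ n.
    by rewrite sumr_const_nat subn0.
  rewrite !big_seq; apply: ler_sum => i; rewrite mem_index_iota => /andP[_ ilt].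
  case/andP: th => t0 t1.
  by apply: ler_wiXn2l => //; [exact: ltW|exact: ltnW].
rewrite nmM nm_nat mulrAC.
have -> : n%:R * rho ^+ n * nm (c n) = (n%:R * (rho / r) ^+ n) * (nm (c n) * r ^+ n).
  by rewrite expr_div_n mulrACA [n%:R * _]mulrC; field; rewrite expf_neq0// gt_eqF.
rewrite [M * _]mulrC; apply: ler_pM => //.
  by rewrite mulr_ge0// exprn_ge0; case/andP: th.
by rewrite mulr_ge0 ?nm_ge0// exprn_ge0 ?ltW.
Qed.

Lemma ps_shift c q : pscoef c -> nm q < 1 ->
  ps c q = c 0%N + q * ps (fun n => c n.+1) q.
Proof.
move=> hc q1; apply: ps_lim; rewrite -cvg_shiftS.
have -> : [sequence series (fun n => c n * q ^+ n) n.+1]_n =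
  (fun n => c 0%N + q * series (fun n => c n.+1 * q ^+ n) n).
  apply/funext => n; rewrite /series /= big_nat_recl// expr0 mulr1; congr (_ + _).
  by rewrite mulr_sumr; apply: eq_bigr => i _; rewrite exprS; ring.
apply: cvgD; first exact: cvg_cst.
by apply: cvgM; [exact: cvg_cst|apply: ps_cvg => //; exact: pscoef_shift].
Qed.

Lemma ps0 c : pscoef c -> ps c 0 = c 0%N.
Proof. by move=> hc; rewrite ps_shift ?nm0 ?ltr01// mul0r addr0. Qed.

(** Synthetic division: the quotient has coefficients b_k = sum of c_(n+k+1) q0^n, so that c_(k+1) =
    b_k - q0 b_(k+1). The last clause keeps the radius rho unchanged, which allows the division to
    be iterated with a controlled constant. *)
Lemma ps_divide c q0 : pscoef c -> nm q0 < 1 -> ps c q0 = 0 ->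
  exists b, [/\ pscoef b,
    forall q, nm q < 1 -> ps c q = (q - q0) * ps b q &
    forall rho M, nm q0 < rho -> (forall n, nm (c n) * rho ^+ n <= M) ->
      forall n, nm (b n) * rho ^+ n <= M / (rho - nm q0)].
Proof.
move=> hc q01 c0; pose t k n := c (n + k)%N.
have ht k : pscoef (t k).
  elim: k => [|k IH]; first by move=> r /hc[M hM]; exists M => n; rewrite /t addn0.
  move=> r /(pscoef_shift IH)[M hM]; exists M => n; have := hM n.
  by rewrite /t addSnnS.
pose b k := ps (t k.+1) q0.
have bS k : b k = c k.+1 + q0 * b k.+1.
  rewrite /b (ps_shift (ht k.+1) q01); congr (c _ + q0 * ps _ _).
  by apply/funext => n; rewrite /t addSnnS.
have b0 : 0 = c 0%N + q0 * b 0%N.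
  by rewrite -c0 (ps_shift hc q01); congr (_ + q0 * ps _ _); apply/funext=> n; rewrite /t addn1.
have quant (rho M : R) : nm q0 < rho -> (forall n, nm (c n) * rho ^+ n <= M) ->
      forall n, nm (b n) * rho ^+ n <= M / (rho - nm q0).
  move=> qr hM n; have r0 : 0 < rho by apply: le_lt_trans qr; exact: nm_ge0.
  have [|_] := @ps_dominated (t n.+1) q0 rho (M / rho ^+ n.+1) qr.
    move=> k; rewrite ler_pdivlMr ?exprn_gt0// -mulrA -exprD; exact: hM.
  move=> h; rewrite -ler_pdivlMr ?exprn_gt0//; apply: le_trans h _.
  rewrite le_eqVlt; apply/orP; left; apply/eqP.
  rewrite exprS; field; rewrite !gt_eqF ?exprn_gt0 ?subr_gt0//.
have hb : pscoef b.
  move=> rho /andP[r0 r1].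
  pose r := Num.max rho ((1 + nm q0) / 2).
  have /andP[h1 h2] := mid_lt1 q01.
  have r1' : r < 1 by rewrite gt_max r1.
  have q0r : nm q0 < r by rewrite lt_max h1 orbT.
  have [|M hM] := hc r; first by rewrite r1' le_max r0.
  exists (M / (r - nm q0)) => n; apply: le_trans (quant _ _ q0r hM n).
  by rewrite ler_wpM2l ?nm_ge0// lerXn2r ?nnegrE ?le_max ?r0 ?lexx.
exists b; split => // q q1.
apply: ps_lim; rewrite -cvg_shiftS.
have -> : [sequence series (fun n => c n * q ^+ n) n.+1]_n =
  (fun n => q * series (fun n => b n * q ^+ n) n -
            q0 * series (fun n => b n * q ^+ n) n.+1).
  apply/funext; elim=> [|n IH].
    rewrite /series /= !big_nat1 big_nil expr0 mulr1 mulr0 sub0r mulr1.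
    by apply/eqP; rewrite -addr_eq0 -b0.
  rewrite /= !seriesSr /= in IH *; rewrite IH.
  have -> : c n.+1 = b n - q0 * b n.+1 by rewrite [b n]bS addrK.
  by rewrite !exprS; ring.
rewrite mulrBl; apply: cvgB.
  by apply: cvgM; [exact: cvg_cst|exact: ps_cvg].
by apply: cvgM; [exact: cvg_cst|rewrite cvg_shiftS; exact: ps_cvg].
Qed.

Definition dcoef c : nat -> C := fun n => n.+1%:R * c n.+1.

Lemma pscoef_dcoef c : pscoef c -> pscoef (dcoef c).
Proof. by move=> hc; apply: (@pscoef_shift (fun n => n%:R * c n)); exact: pscoef_nat. Qed.

Definition taylor2 (n : nat) (q z : C) : C :=
  q ^+ n - z ^+ n - n%:R * z ^+ n.-1 * (q - z).

(** Induction through T_(n+1) = q T_n + n z^(n-1) (q - z)^2 for the Taylor remainder T_n. The factor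
    rho^2 on the left avoids the exponent n - 2. *)
Lemma taylor2_le (n : nat) (q z : C) (rho : R) : nm q <= rho -> nm z <= rho ->
  nm (taylor2 n q z) * rho ^+ 2 <= n%:R ^+ 2 * rho ^+ n * nm (q - z) ^+ 2.
Proof.
move=> qr zr; have r0 : 0 <= rho by apply: le_trans qr; exact: nm_ge0.
elim: n => [|n IH].
  by rewrite /taylor2 !expr0 subrr !mul0r subrr nm0 !mul0r expr0n !mul0r.
have E : taylor2 n.+1 q z = q * taylor2 n q z + n%:R * z ^+ n.-1 * (q - z) ^+ 2.
  rewrite /taylor2 /=; case: n {IH} => [|n] /=.
    by rewrite !expr0 !expr1; ring.
  by rewrite !exprS -!natr1; ring.
rewrite E; apply: (@le_trans _ _ (rho * (nm (taylor2 n q z) * rho ^+ 2) +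
   n%:R * rho ^+ n.+1 * nm (q - z) ^+ 2)).
  have h2 : nm (n%:R * z ^+ n.-1 * (q - z) ^+ 2) * rho ^+ 2 <=
     n%:R * rho ^+ n.+1 * nm (q - z) ^+ 2.
    rewrite !nmM !nmX nm_nat; case: n {IH E} => [|n] /=; first by rewrite !mul0r.
    rewrite mulrAC ler_wpM2r ?sqr_ge0//.
    rewrite -mulrA ler_wpM2l ?ler0n// -[n.+2]addn2 exprD ler_wpM2r ?sqr_ge0//.
    by rewrite lerXn2r// nnegrE nm_ge0.
  apply: le_trans (ler_wpM2r (sqr_ge0 _) (ler_nmD _ _)) _.
  rewrite mulrDl lerD// nmM -mulrA ler_wpM2r// mulr_ge0 ?nm_ge0 ?sqr_ge0//.
apply: le_trans (lerD (ler_wpM2l r0 IH) (lexx _)) _.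
rewrite [rho ^+ n.+1]exprS -[n.+1%:R]natr1.
have : 0 <= rho * rho ^+ n * nm (q - z) ^+ 2 by rewrite !mulr_ge0 ?exprn_ge0 ?nm_ge0.
have := ler0n R n; move: (n%:R : R) => N N0.
set A := rho * rho ^+ n * nm (q - z) ^+ 2; move=> A0.
have -> : rho * (N ^+ 2 * rho ^+ n * nm (q - z) ^+ 2) +
  N * (rho * rho ^+ n) * nm (q - z) ^+ 2 = (N ^+ 2 + N) * A by rewrite /A; ring.
have -> : (N + 1) ^+ 2 * (rho * rho ^+ n) * nm (q - z) ^+ 2 = (N + 1) ^+ 2 * A.
  by rewrite /A; ring.
by rewrite ler_wpM2r//; nra.
Qed.

(** The termwise bound carries a factor n^2, which is absorbed by applying [pscoef_nat] twice; the
    remaining powers of r / rho form a geometric series. *)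
Lemma ps_taylor2 c (r : R) : pscoef c -> 0 < r < 1 ->
  exists2 K : R, 0 < K & forall q z, nm q <= r -> nm z <= r ->
    nm (ps c q - ps c z - ps (dcoef c) z * (q - z)) <= K * nm (q - z) ^+ 2.
Proof.
move=> hc /andP[r0 r1]; have /andP[h1 h2] := mid_lt1 r1.
set rho := (1 + r) / 2 in h1 h2.
have rho0 : 0 < rho by exact: lt_trans h1.
have [|M hM] := pscoef_nat (pscoef_nat hc) (rho := rho); first by rewrite ltW.
have M0 : 0 <= M by apply: le_trans (hM 0%N); rewrite mulr_ge0 ?nm_ge0 ?exprn_ge0 ?(ltW rho0).
have th : 0 <= r / rho < 1.
  by rewrite divr_ge0 ?(ltW rho0) ?ltW//= ltr_pdivrMr// mul1r.
have th1 : 0 < 1 - r / rho by rewrite subr_gt0; case/andP: th.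
exists (M / (1 - r / rho) / r ^+ 2 + 1).
  by rewrite ltr_wpDl// divr_ge0 ?sqr_ge0// divr_ge0// ltW.
move=> q z qr zr.
have q1 : nm q < 1 by exact: le_lt_trans r1.
have z1 : nm z < 1 by exact: le_lt_trans r1.
have L : series (fun n => c n * taylor2 n q z) @ \oo -->
    (ps c q - ps c z - ps (dcoef c) z * (q - z)).
  rewrite -cvg_shiftS.
  have -> : [sequence series (fun n => c n * taylor2 n q z) n.+1]_n = (fun n =>
     series (fun n => c n * q ^+ n) n.+1 - series (fun n => c n * z ^+ n) n.+1 -
     series (fun n => dcoef c n * z ^+ n) n * (q - z)).
    apply/funext; elim=> [|n IH].
      by rewrite /series /= !big_nat1 big_nil /taylor2 !expr0; ring.
    rewrite /= !seriesSr /= in IH *; rewrite IH /taylor2 /dcoef /=; ring.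
  apply: cvgB; [apply: cvgB|apply: cvgM; last exact: cvg_cst].
  - by rewrite cvg_shiftS; exact: ps_cvg.
  - by rewrite cvg_shiftS; exact: ps_cvg.
  - by apply: ps_cvg => //; exact: pscoef_dcoef.
apply: (@cvg_nm_le R nat \oo _ _ _ _ L); near=> n.
apply: le_trans (ler_nm_sum _ _ _) _.
apply: (@le_trans _ _ (\sum_(0 <= k < n) (M / r ^+ 2 * nm (q - z) ^+ 2) * (r / rho) ^+ k)).
  apply: ler_sum => k _; have := taylor2_le k qr zr; have := hM k.
  rewrite !nmM nm_nat => a1 a2.
  have rk : 0 < rho ^+ k by rewrite exprn_gt0.
  rewrite -(@ler_pM2r _ (r ^+ 2)) ?exprn_gt0//.
  rewrite -[X in X <= _]mulrA.
  apply: le_trans (ler_wpM2l (nm_ge0 _) a2) _.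
  rewrite -(@ler_pM2r _ (rho ^+ k))//.
  have -> : nm (c k) * (k%:R ^+ 2 * r ^+ k * nm (q - z) ^+ 2) * rho ^+ k =
     (k%:R * (k%:R * nm (c k)) * rho ^+ k) * (r ^+ k * nm (q - z) ^+ 2) by ring.
  have -> : M / r ^+ 2 * nm (q - z) ^+ 2 * (r / rho) ^+ k * r ^+ 2 * rho ^+ k =
    M * (r ^+ k * nm (q - z) ^+ 2).
    by rewrite expr_div_n; field; rewrite !gt_eqF.
  by rewrite ler_wpM2r// mulr_ge0 ?sqr_ge0// exprn_ge0 ?ltW.
rewrite -mulr_sumr.
apply: le_trans (ler_wpM2l _ (geometric_partial_le n th)) _.
  by rewrite mulr_ge0 ?sqr_ge0// divr_ge0// sqr_ge0.
have -> : M / r ^+ 2 * nm (q - z) ^+ 2 / (1 - r / rho) =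
  M / (1 - r / rho) / r ^+ 2 * nm (q - z) ^+ 2.
  by move: (1 - r / rho)^-1 (r ^+ 2)^-1 => X Y; ring.
by rewrite ler_wpM2r ?sqr_ge0// lerDl.
Unshelve. all: by end_near. Qed.

Lemma ps_is_derive c q : pscoef c -> nm q < 1 ->
  is_derive q (1 : C) (ps c) (ps (dcoef c) q).
Proof.
move=> hc q1; have /andP[h1 h2] := mid_lt1 q1.
set r := (1 + nm q) / 2 in h1 h2.
have r0 : 0 < r by apply: le_lt_trans h1; exact: nm_ge0.
have [|K K0 hK] := @ps_taylor2 c r hc; first by rewrite r0.
apply/is_derive_nmP => e e0; exists (Num.min (r - nm q) (e / K)).
  by rewrite lt_min subr_gt0 h1 divr_gt0.
move=> w; rewrite lt_min => /andP[w1 w2].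
have wr : nm w <= r.
  by rewrite -[w](subrK q); apply: le_trans (ler_nmD _ _) _; rewrite -lerBrDr ltW.
apply: le_trans (hK _ _ wr (ltW h1)) _.
rewrite expr2 mulrA ler_wpM2r ?nm_ge0// mulrC -ler_pdivlMr// ltW//.
Qed.

End PowerSeries.

#[global] Opaque ps.

(** * Orders of zeros of power series *)

Section FiniteOrder.
Variable R : realType.
Local Notation C := (Cplx R).
Implicit Types (b c : nat -> C) (q z : C).

Definition finite_order c q0 := exists m b,
  [/\ pscoef b, ps b q0 != 0 & forall q, nm q < 1 -> ps c q = (q - q0) ^+ m * ps b q].

(* Dividing by q - q0 indefinitely bounds ps c q by
   (|q - q0| / (rho - |q0|))^m times a constant, for every m. *)
Lemma ps_zero_ball c q0 (rho : R) : pscoef c -> nm q0 < rho < 1 ->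
  ~ finite_order c q0 -> forall q, nm (q - q0) < rho - nm q0 -> ps c q = 0.
Proof.
move=> hc /andP[q0r r1] nf q hq.
have r0 : 0 < rho by apply: le_lt_trans q0r; exact: nm_ge0.
have d0 : 0 < rho - nm q0 by rewrite subr_gt0.
have qr : nm q < rho.
  rewrite -[q](subrK q0); apply: le_lt_trans (ler_nmD _ _) _; lra.
have q1 : nm q < 1 by exact: lt_trans r1.
have [|M hM] := hc rho; first by rewrite r1 ltW.
have chain m : exists b, [/\ pscoef b,
    forall q, nm q < 1 -> ps c q = (q - q0) ^+ m * ps b q &
    forall n, nm (b n) * rho ^+ n <= M / (rho - nm q0) ^+ m].
  elim: m => [|m [b [hb bE bM]]].
    by exists c; split => // [w _|n]; rewrite expr0 ?mul1r ?divr1.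
  have b0 : ps b q0 = 0.
    by apply: contrapT => /eqP h; apply: nf; exists m, b.
  have [|b' [hb' b'E b'M]] := ps_divide hb _ b0; first exact: lt_trans r1.
  exists b'; split => //.
    by move=> w w1; rewrite bE// b'E// exprSr mulrA.
  by move=> n; rewrite exprSr invfM mulrA; exact: b'M.
apply/eqP; rewrite -nm_eq0 eq_le nm_ge0 andbT leNgt; apply/negP => cq.
have [|m hm] := @ger0_pow_small R (nm (q - q0) / (rho - nm q0)) (M / (1 - nm q / rho)) _ _ cq.
  by rewrite divr_ge0 ?nm_ge0 ?ltW//= ltr_pdivrMr// mul1r.
have [b [hb bE bM]] := chain m.
have [_ le] := ps_dominated qr bM.
move: hm; rewrite ltNge => /negP; apply.
rewrite bE// nmM nmX; apply: le_trans (ler_wpM2l _ le) _.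
  by rewrite exprn_ge0// nm_ge0.
rewrite expr_div_n; move: (1 - nm q / rho)^-1 ((rho - nm q0) ^+ m)^-1 => X Y.
by rewrite le_eqVlt; apply/orP; left; apply/eqP; ring.
Qed.

Lemma ps_continuous c q : pscoef c -> nm q < 1 -> ps c @ q --> ps c q.
Proof. by move=> hc q1; exact: is_derive_continuous (ps_is_derive hc q1). Qed.

(** Near q0 the cofactor [ps b] is nonzero by continuity, and (q - q0)^m is nonzero off q0, so there
    are nonzero values arbitrarily close to q0. *)
Lemma finite_order_nonzero c q0 (d : R) : pscoef c -> nm q0 < 1 -> 0 < d ->
  (forall q, nm (q - q0) < d -> ps c q = 0) -> ~ finite_order c q0.
Proof.
move=> hc q01 d0 hz [m [b [hb b0 bE]]].
have nb : \forall q \near q0, nm (ps b q - ps b q0) < nm (ps b q0).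
  by have /cvg_nmP := ps_continuous hb q01; apply; rewrite nm_gt0.
have nd : \forall q \near q0, nm (q - q0) < d by apply/near_nmP; exists d.
have n1 : \forall q \near q0, nm q < 1.
  apply/near_nmP; exists (1 - nm q0); first by rewrite subr_gt0.
  move=> w; rewrite ltrBrDr; apply: le_lt_trans.
  by rewrite -{1}(subrK q0 w) ler_nmD.
have [q [[[h1 h2] h3] /eqP qq0]] : exists q, ((nm (ps b q - ps b q0) < nm (ps b q0) /\
    nm (q - q0) < d) /\ nm q < 1) /\ q <> q0.
  apply: (@filter_ex _ (q0^')).
  have [e e0 he] := (near_nmP _ _).1 (filterI (filterI nb nd) n1).
  apply/near_dnmP; exists e => // w w0 we.
  by split; [exact: he|exact/eqP].
have := hz _ h2; rewrite bE// => /eqP; rewrite mulf_eq0 expf_eq0 subr_eq0 (negbTE qq0) andbF /=.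
by move/eqP => e; move: h1; rewrite e sub0r nmN ltxx.
Qed.

(* Otherwise ps c vanishes on a disc of fixed radius around q0; approaching the
   origin by small steps, it would also vanish at 0. *)
Lemma ps_finite_order c q0 : pscoef c -> c 0%N != 0 -> nm q0 < 1 -> finite_order c q0.
Proof.
move=> hc c0 q01; apply: contrapT => nf.
have /andP[h1 h2] := mid_lt1 q01.
set r := (1 + nm q0) / 2 in h1 h2; pose d := (r - nm q0) / 2.
have d0 : 0 < d by rewrite divr_gt0// subr_gt0.
have ball0 q : nm q <= nm q0 -> ~ finite_order c q ->
    forall w, nm (w - q) < 2 * d -> ps c w = 0.
  move=> qq0 nfq w wq; apply: (@ps_zero_ball c q r) => //.
    by rewrite h2 andbT; exact: le_lt_trans h1.
  by apply: lt_le_trans wq _; rewrite /d; lra.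
have key n : forall q, nm q <= n%:R * d -> nm q <= nm q0 -> finite_order c q.
  elim: n => [|n IH] q qn qq0; apply: contrapT => nfq.
    move: qn; rewrite mul0r => qn.
    have q0' : q = 0 by apply/eqP; rewrite -nm_eq0 eq_le qn nm_ge0.
    move: c0; rewrite -(ps0 hc) => /eqP; apply; apply: (ball0 q) => //.
    by rewrite q0' subr0 nm0 mulr_gt0.
  have [qd|dq] := leP (nm q) d.
    move: c0; rewrite -(ps0 hc) => /eqP; apply; apply: (ball0 q) => //.
    by rewrite sub0r nmN; lra.
  have q_gt0 : 0 < nm q by exact: lt_trans dq.
  (* [q'] is [q] moved by [d] towards the origin. The [d]-disc around it lies in the [2 * d]-disc
     around [q], on which [ps c] vanishes, so [q'] would fail to have finite order as well. *)
  pose q' : C := q * (1 - d / nm q)%:C.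
  have nq' : nm q' = nm q - d.
    rewrite nmM nm_real ger0_norm; last by rewrite subr_ge0 ler_pdivrMr// mul1r ltW.
    by rewrite mulrBr mulr1 mulrC divfK// gt_eqF.
  have dqq : nm (q' - q) = d.
    rewrite /q' rmorphB rmorph1 mulrBr mulr1 addrAC subrr sub0r nmN nmM nm_real.
    have dq0 : 0 <= d / nm q by rewrite divr_ge0 ?nm_ge0// ltW.
    by rewrite ger0_norm// mulrC divfK// gt_eqF.
  apply: (@finite_order_nonzero c q' d) => //.
  - by rewrite nq'; apply: le_lt_trans q01; lra.
  - move=> w wq'; apply: (ball0 q) => //.
    by apply: le_lt_trans (ler_nm_distD _ _ q') _; rewrite dqq; lra.
  - apply: IH; rewrite nq'; last by lra.
    by move: qn; rewrite -natr1 mulrDl mul1r; lra.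
apply: nf; apply: (key (Num.truncn (nm q0 / d)).+1) => //.
(* The number of steps of length [d] that suffice to reach the origin from [q0]. *)
rewrite -ler_pdivrMr// ltW// truncnS_gt//.
Qed.

End FiniteOrder.

(** * Local mapping properties *)

Section LocalMapping.
Variable R : realType.
Local Notation C := (Cplx R).
Implicit Types (f g : C -> C) (a w : C) (m : nat).

(** The order of [f - f a] at [a], expressed by a limit so that it passes through changes of
    variable without any factorization of [f]. *)
Definition has_order f a m (c : C) := [/\ (0 < m)%N, c != 0 &
  (fun w => (f w - f a) / (w - a) ^+ m) @ a^' --> c].

Lemma has_order_nm f a m c : has_order f a m c -> forall e : R, 0 < e ->
  exists2 d : R, 0 < d & forall w, nm (w - a) < d ->
    nm (f w - f a - c * (w - a) ^+ m) <= e * nm (w - a) ^+ m.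
Proof.
move=> [m0 c0 /cvg_nmP h] e e0; have /near_dnmP[d d0 hd] := h _ e0.
exists d => // w wd; have [->|wa] := eqVneq w a.
  by rewrite !subrr nm0 !expr0n gtn_eqF//= mulr0 subrr nm0 mulr0.
have wa' : (w - a) ^+ m != 0 by rewrite expf_neq0// subr_eq0.
have -> : f w - f a - c * (w - a) ^+ m = ((f w - f a) / (w - a) ^+ m - c) * (w - a) ^+ m.
  by rewrite mulrBl divfK.
by rewrite nmM nmX ler_wpM2r ?exprn_ge0 ?nm_ge0// ltW// hd.
Qed.

Lemma has_order_continuous f a m c : has_order f a m c -> f @ a --> f a.
Proof.
move=> ho; have [m0 c0 _] := ho; apply/cvg_nmP => e e0.
have [d d0 hd] := has_order_nm ho ltr01.
have K0 : 0 < nm c + 1 by rewrite ltr_wpDl// nm_ge0.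
apply/near_nmP; exists (Num.min (Num.min d 1) (e / (nm c + 1))).
  by rewrite !lt_min d0 ltr01 divr_gt0.
move=> w; rewrite !lt_min => /andP[/andP[/hd h1 h2] h3].
rewrite -[f w - f a](subrK (c * (w - a) ^+ m)).
apply: le_lt_trans (ler_nmD _ _) _; rewrite nmM nmX.
apply: le_lt_trans (lerD h1 (lexx _)) _; rewrite -mulrDl addrC.
apply: (@le_lt_trans _ _ ((nm c + 1) * nm (w - a))).
  rewrite ler_wpM2l ?(ltW K0)//; case: m m0 {ho hd h1} => // m _.
  by rewrite exprS ler_piMr ?nm_ge0// exprn_ile1 ?nm_ge0// ltW.
by rewrite mulrC -ltr_pdivlMr.
Qed.

Lemma is_derive_has_order f a (l : C) : is_derive a (1 : C) f l -> l != 0 ->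
  has_order f a 1 l.
Proof.
move=> /is_derive_nmP h l0; split => //; apply/cvg_nmP => e e0.
have [|d d0 hd] := h (e / 2); first by rewrite divr_gt0.
apply/near_dnmP; exists d => // w wa /hd; rewrite expr1.
have wa' : w - a != 0 by rewrite subr_eq0.
have -> : f w - f a - l * (w - a) = ((f w - f a) / (w - a) - l) * (w - a).
  by rewrite mulrBl divfK.
rewrite nmM ler_pM2r ?nm_gt0// => /le_lt_trans; apply.
by rewrite ltr_pdivrMr// ltr_pMr// ltr1n.
Qed.

(* Move from a in a direction rho with c rho^m = y - f a: to first order,
   f w - y is then (1 - s^m) (f a - y). *)
Lemma nm_min_decrease f a m c (y : C) : has_order f a m c -> f a != y ->
  forall e : R, 0 < e -> exists2 w, nm (w - a) < e & nm (f w - y) < nm (f a - y).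
Proof.
move=> ho fay e e0; have [m0 c0 _] := ho.
pose v := f a - y; have v0 : v != 0 by rewrite subr_eq0.
have [rho rhoE] : exists rho : C, rho ^+ m = - v / c.
  by exists (m.-root (- v / c : R[i])); exact: (@rootCK R[i] m m0).
have rho0 : rho != 0.
  apply/eqP => r0; move: rhoE; rewrite r0 expr0n gtn_eqF//= => /esym/eqP.
  by rewrite mulf_eq0 oppr_eq0 invr_eq0 (negbTE v0) (negbTE c0).
have nv0 : 0 < nm v by rewrite nm_gt0.
have nr0 : 0 < nm rho by rewrite nm_gt0.
(* With this tolerance the error is at most s^m |v| / 2, half of the gain s^m |v|. *)
have [|d d0 hd] := has_order_nm ho (e := nm v / (2 * nm rho ^+ m)).
  by rewrite divr_gt0// mulr_gt0// exprn_gt0.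
pose s := Num.min (1 / 2) (Num.min (d / (2 * nm rho)) (e / (2 * nm rho))).
have s0 : 0 < s by rewrite !lt_min !divr_gt0// mulr_gt0.
have s1 : s < 1 by rewrite gt_min; apply/orP; left; lra.
have K x : 0 < x -> s <= x / (2 * nm rho) -> nm (s%:C * rho) < x.
  move=> x0 sx; rewrite nmM nm_real ger0_norm ?(ltW s0)//.
  rewrite -ltr_pdivlMr//; apply: le_lt_trans sx _.
  by rewrite ltr_pM2l// ltf_pV2 ?posrE ?mulr_gt0// ltr_pMl// ltr1n.
have sd : s <= d / (2 * nm rho) by rewrite /s !ge_min lexx !orbT.
have se : s <= e / (2 * nm rho) by rewrite /s !ge_min lexx !orbT.
pose w := a + s%:C * rho.
have wE : w - a = s%:C * rho by rewrite /w addrAC subrr add0r.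
exists w; first by rewrite wE; exact: K.
have := hd w; rewrite wE => /(_ (K _ d0 sd)) h.
have -> : f w - y = v * (1 - s ^+ m)%:C + (f w - f a - c * (s%:C * rho) ^+ m).
  rewrite exprMn rhoE rmorphB rmorph1 rmorphXn /= /v.
  by field; exact: c0.
apply: le_lt_trans (ler_nmD _ _) _; rewrite nmM nm_real.
have sm0 : 0 < s ^+ m by rewrite exprn_gt0.
have sm1 : s ^+ m <= 1 by rewrite exprn_ile1// ltW.
rewrite ger0_norm ?subr_ge0//.
apply: le_lt_trans (lerD (lexx _) h) _.
rewrite nmM nm_real ger0_norm ?(ltW s0)// exprMn.
have -> : nm v / (2 * nm rho ^+ m) * (s ^+ m * nm rho ^+ m) = nm v * (s ^+ m / 2).
  by field; rewrite gt_eqF// exprn_gt0.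
rewrite -mulrDr -[ltRHS]mulr1 ltr_pM2l//; lra.
Qed.

(** The minimum of |f - y| over the closed disc is not attained on the circle, since the centre does
    better; at an interior point it can only be 0, by [nm_min_decrease]. *)
Lemma disc_hits f a (r : R) (y : C) : 0 < r ->
  (forall w, nm (w - a) <= r -> exists m c, has_order f w m c) ->
  (forall w, nm (w - a) = r -> nm (f a - y) < nm (f w - y)) ->
  exists2 w, nm (w - a) < r & f w = y.
Proof.
move=> r0 ho bd.
have [||w wr wmin] := @compact_nm_min R _ f y (@compact_disc R a r).
- by exists a; rewrite /= subrr nm0 ltW.
- by move=> w /ho[m [c /has_order_continuous]].
have wr' : nm (w - a) < r.
  rewrite lt_neqAle wr andbT; apply/eqP => /bd; rewrite ltNge wmin//.
  by rewrite /= subrr nm0 ltW.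
exists w => //; apply/eqP; apply/negPn/negP => fw.
have [m [c hw]] := ho _ wr.
have [|w' w'1 w'2] := nm_min_decrease hw fw (e := r - nm (w - a)).
  by rewrite subr_gt0.
move: w'2; rewrite ltNge wmin//=.
apply: le_trans (ler_nm_distD _ _ w) _; rewrite addrC -lerBrDl ltW//.
Qed.

(** On a small circle of radius r, |f w - f a| is at least |c| r^m / 2. If y is within |c| r^m / 4
    of [f a], the centre is therefore closer to y than the circle is, and [disc_hits] applies. *)
Lemma open_map f a : (\forall w \near a, exists m c, has_order f w m c) ->
  forall e : R, 0 < e -> exists2 d : R, 0 < d &
    forall y, nm (y - f a) < d -> exists2 w, nm (w - a) < e & f w = y.
Proof.
move=> /near_nmP[r1 r10 h1] e e0.
have [m [c ho]] : exists m c, has_order f a m c by apply: h1; rewrite subrr nm0.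
have [m0 c0 _] := ho; have nc0 : 0 < nm c by rewrite nm_gt0.
have [|r2 r20 h2] := has_order_nm ho (e := nm c / 2); first by rewrite divr_gt0.
pose r := Num.min e (Num.min r1 r2) / 2.
have r0 : 0 < r by rewrite divr_gt0// !lt_min e0 r10.
have [re r1' r2'] : [/\ r < e, r < r1 & r < r2].
  have : r < Num.min e (Num.min r1 r2).
    by rewrite /r ltr_pdivrMr// ltr_pMr ?ltr1n// !lt_min e0 r10.
  by rewrite !lt_min => /andP[-> /andP[-> ->]].
have rm0 : 0 < r ^+ m by rewrite exprn_gt0.
exists (nm c * r ^+ m / 4); first by rewrite divr_gt0// mulr_gt0.
move=> y hy; have [||w wr wy] := @disc_hits f a r y r0.
- by move=> w wr; apply: h1; exact: le_lt_trans r1'.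
- move=> w wr; have := h2 w; rewrite wr => /(_ r2') h.
  have h3 : nm (c * (w - a) ^+ m) - nm (f w - f a) <= nm c / 2 * r ^+ m.
    by apply: le_trans (ler_nm_dist _ _) _; rewrite nmBC.
  rewrite nmM nmX wr in h3.
  have h4 := ler_nm_distD (f w) (f a) y.
  rewrite nmBC in hy; rewrite (nmBC y) in h4; move: hy.
  by move: h3 h4; move: (nm (f a - y)) (nm (f w - y)) (nm (f w - f a)) => x z t; lra.
by exists w => //; exact: lt_trans re.
Qed.

(** Any root of 1 + X + ... + X^(m-1) will do; it differs from 1 because the value at 1 is m, which
    is nonzero. *)
Lemma root_of_unity_neq1 m : (1 < m)%N -> exists2 z : C, z ^+ m = 1 & z != 1.
Proof.
move=> m1; pose p : {poly R[i]} := \poly_(i < m) 1.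
have sp : size p = m by rewrite size_poly_eq// oner_neq0.
have /closed_rootP[z /rootP pz] : size p != 1%N by rewrite sp gtn_eqF.
have pE (x : R[i]) : p.[x] = \sum_(i < m) x ^+ i.
  by rewrite horner_poly; apply: eq_bigr => i _; rewrite mul1r.
exists z.
  by apply/eqP; rewrite -subr_eq0 subrX1 -pE pz mulr0.
apply/eqP => z1; move: pz; rewrite pE z1.
under eq_bigr do rewrite expr1n.
rewrite sumr_const card_ord => /eqP; rewrite pnatr_eq0 => /eqP m0.
by rewrite m0 in m1.
Qed.

(* For w = a + t, the value f w is taken again near a + z t, where z != 1 and
   z^m = 1. *)
Lemma not_locally_injective f a m c :
  (\forall w \near a, exists m c, has_order f w m c) ->
  has_order f a m c -> (1 < m)%N -> forall e : R, 0 < e ->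
  exists w w', [/\ nm (w - a) < e, nm (w' - a) < e, w != w' & f w = f w'].
Proof.
move=> /near_nmP[r1 r10 h1] ho m1 e e0.
have [m0 c0 _] := ho; have nc0 : 0 < nm c by rewrite nm_gt0.
have [z zm z1] := root_of_unity_neq1 m1.
have nz : nm z = 1.
  apply/eqP; rewrite -(@pexpr_eq1 _ _ m) ?nm_ge0//.
  by rewrite -nmX zm nm1.
have mR : 0 < m%:R :> R by rewrite ltr0n.
(* The derivative m of x^m at 1 yields |(1 + s)^m - 1| >= m |s| / 2 for small s; this is the lower
   bound [k] below. *)
have [|d d0 hd] := (is_derive_nmP _ _ _).1 (is_deriveX m (is_derive_id (1 : C) 1)) (m%:R / 2).
  by rewrite divr_gt0.
(* The three bounds serve the derivative estimate, keep the disc around [b] within [2 * t] of [a],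
   and keep that disc away from [w]. *)
pose eta := Num.min (d / 2) (Num.min (1 / 2) (nm (1 - z) / 2)).
have nz1 : 0 < nm (1 - z) by rewrite nm_gt0 subr_eq0 eq_sym.
have eta0 : 0 < eta by rewrite !lt_min !divr_gt0.
have [eta_d eta_1 eta_z] : [/\ eta < d, eta < 1 & eta < nm (1 - z)].
  split.
  - by rewrite /eta gt_min; apply/orP; left; lra.
  - by rewrite /eta !gt_min; apply/orP; right; apply/orP; left; lra.
  - by rewrite /eta !gt_min; apply/orP; right; apply/orP; right; lra.
pose k := m%:R / 2 * eta.
have k0 : 0 < k by rewrite mulr_gt0// divr_gt0.
have hk (s : C) : nm s = eta -> k <= nm ((1 + s) ^+ m - 1).
  move=> sE; have := hd (1 + s); rewrite addrC addKr sE => /(_ eta_d).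
  rewrite addrC /= !fctE expr1n !expr1n scaler1 => h.
  have h2 : nm (m%:R * s) - nm ((1 + s) ^+ m - 1) <= m%:R / 2 * eta.
    apply: le_trans (ler_nm_dist _ _) _; rewrite nmBC; apply: le_trans h.
    by rewrite mulr1 addrC.
  by move: h2; rewrite nmM nm_nat sE /k; lra.
(* On the circle around [b] the errors amount to 2^m + 1 units of [e1 * t ^+ m]; this leaves |f x -
   f w| at least 3 units, against at most 2 at the centre. *)
pose e1 := nm c * k / (2 ^+ m + 4).
have p2 : 0 < 2 ^+ m :> R by rewrite exprn_gt0.
have e10 : 0 < e1 by rewrite divr_gt0 ?mulr_gt0// addr_gt0.
have [r2 r20 h2] := has_order_nm ho e10.
pose t := Num.min e (Num.min r1 r2) / 4.
have t0 : 0 < t by rewrite divr_gt0// !lt_min e0 r10.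
have [te t1 t2] : [/\ 2 * t < e, 2 * t < r1 & 2 * t < r2].
  have : 2 * t < Num.min e (Num.min r1 r2).
    rewrite /t; have : 0 < Num.min e (Num.min r1 r2) by rewrite !lt_min e0 r10.
    lra.
  by rewrite !lt_min => /andP[-> /andP[-> ->]].
have tm0 : 0 < t ^+ m by rewrite exprn_gt0.
pose T : C := t%:C; have nT : nm T = t by rewrite nm_real ger0_norm// ltW.
have T0 : T != 0 by rewrite -nm_gt0 nT.
pose b := a + z * T; pose w := a + T.
have nb : nm (b - a) = t by rewrite /b addrAC subrr add0r nmM nz mul1r.
have nw : nm (w - a) = t by rewrite /w addrAC subrr add0r.
have far x : nm (x - b) <= eta * t -> nm (x - a) < 2 * t.
  move=> xb; apply: le_lt_trans (ler_nm_distD _ _ b) _; rewrite nb.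
  have : eta * t < t by rewrite gtr_pMl.
  lra.
have gw : nm (f w - f a - c * T ^+ m) <= e1 * t ^+ m.
  have := h2 w; rewrite nw /w [a + T]addrC addrK; apply; lra.
have gb : nm (f b - f a - c * T ^+ m) <= e1 * t ^+ m.
  have := h2 b; rewrite nb {2}/b [a + _]addrC addrK exprMn zm mul1r; apply; lra.
have et0 : 0 < eta * t by rewrite mulr_gt0.
have [||w' w'b w'w] := @disc_hits f b (eta * t) (f w) et0.
- by move=> x /far xb; apply: h1; exact: lt_trans t1.
- move=> x xb.
  have xa : nm (x - a) < 2 * t by apply: far; rewrite xb.
  have := h2 x (lt_trans xa t2); set gx := f x - f a - _ => hgx.
  have hgx' : nm gx <= e1 * (2 ^+ m * t ^+ m).
    apply: le_trans hgx _; rewrite ler_wpM2l ?(ltW e10)// -exprMn.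
    by rewrite lerXn2r ?nnegrE ?nm_ge0//; [rewrite mulr_ge0// ltW|exact: ltW].
  pose s := (x - b) / (z * T).
  have z0 : z != 0 by rewrite -nm_gt0 nz.
  have xaE : (x - a) ^+ m = (1 + s) ^+ m * T ^+ m.
    have -> : x - a = z * (1 + s) * T by rewrite /s /b; field; rewrite z0 T0.
    by rewrite !exprMn zm mul1r.
  have ns : nm s = eta by rewrite nmM nmV nmM nz mul1r nT xb mulfK// gt_eqF.
  have low : nm c * k * t ^+ m <= nm (c * ((1 + s) ^+ m - 1) * T ^+ m).
    rewrite !nmM nmX nT ler_wpM2r ?(ltW tm0)// ler_wpM2l ?nm_ge0//; exact: hk.
  have E1 : f x - f w = c * ((1 + s) ^+ m - 1) * T ^+ m + (gx - (f w - f a - c * T ^+ m)).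
    by rewrite /gx xaE; ring.
  have E2 : f b - f w = (f b - f a - c * T ^+ m) - (f w - f a - c * T ^+ m) by ring.
  have up : nm (f b - f w) <= 2 * e1 * t ^+ m.
    rewrite E2; apply: le_trans (ler_nmB _ _) _; apply: le_trans (lerD gb gw) _; lra.
  have dn : nm c * k * t ^+ m - (e1 * (2 ^+ m * t ^+ m) + e1 * t ^+ m) <= nm (f x - f w).
    have : nm (c * ((1 + s) ^+ m - 1) * T ^+ m) - nm (f x - f w) <=
      e1 * (2 ^+ m * t ^+ m) + e1 * t ^+ m.
      apply: le_trans (ler_nm_dist _ _) _; rewrite E1 opprD addNKr nmN.
      by apply: le_trans (ler_nmB _ _) _; exact: lerD.
    lra.
  apply: le_lt_trans up _; apply: lt_le_trans dn.
  have -> : nm c * k = e1 * (2 ^+ m + 4) by rewrite /e1 divfK// gt_eqF// addr_gt0.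
  have : 0 < e1 * t ^+ m by rewrite mulr_gt0.
  have -> : e1 * (2 ^+ m + 4) * t ^+ m - (e1 * (2 ^+ m * t ^+ m) + e1 * t ^+ m) =
    3 * (e1 * t ^+ m) by ring.
  rewrite -mulrA; move: (e1 * t ^+ m) => X; lra.
exists w, w'; split => //.
- by rewrite nw; lra.
- by apply: lt_trans te; apply: far; exact: ltW.
apply/eqP => ww; move: w'b; rewrite -ww /w /b.
have -> : a + T - (a + z * T) = (1 - z) * T by ring.
by rewrite nmM nT ltr_pM2r// => /lt_trans /(_ eta_z); rewrite ltxx.
Qed.

End LocalMapping.

(** * The group Gamma_0(N)^+ *)

Section ReIm.
Variable R : realType.
Local Notation C := (Cplx R).
Implicit Types x y z : C.

Lemma cReD x y : complex.Re (x + y) = complex.Re x + complex.Re y.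
Proof. by case: x; case: y. Qed.
Lemma cImD x y : complex.Im (x + y) = complex.Im x + complex.Im y.
Proof. by case: x; case: y. Qed.
Lemma cReM x y : complex.Re (x * y) =
  complex.Re x * complex.Re y - complex.Im x * complex.Im y.
Proof. by case: x; case: y. Qed.
Lemma cImM x y : complex.Im (x * y) =
  complex.Re x * complex.Im y + complex.Im x * complex.Re y.
Proof. by case: x => a b; case: y => c d /=; rewrite addrC. Qed.
Lemma cImV x : complex.Im x^-1 = - complex.Im x / nm x ^+ 2.
Proof. by rewrite nm_sqr; case: x => a b /=; rewrite mulNr. Qed.
Lemma cReV x : complex.Re x^-1 = complex.Re x / nm x ^+ 2.
Proof. by rewrite nm_sqr; case: x => a b. Qed.
Lemma uhpE z : uhp z = (0 < complex.Im z).
Proof. by []. Qed.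

Lemma open_uhp (z : C) : uhp z -> \forall w \near z, uhp w.
Proof.
move=> hz; apply/near_nmP; exists (complex.Im z) => // w hw.
have := le_lt_trans (ler_Im_nm _) hw; rewrite Im_sub ltr_norml => /andP[h _].
by rewrite uhpE; lra.
Qed.
End ReIm.

Section Moebius.
Variable R : realType.
Local Notation C := (Cplx R).
Implicit Types (g h : 'M[R]_2) (z w : C).

Definition unimodular g := g 0 0 * g 1 1 - g 0 1 * g 1 0 = 1.

Lemma mulmx2E g h i k : (g *m h) i k = g i 0 * h 0 k + g i 1 * h 1 k.
Proof.
rewrite mxE !big_ord_recl big_ord0 addr0.
by congr (_ + g i _ * h _ k); apply: val_inj.
Qed.

Lemma matrix2P g h : g 0 0 = h 0 0 -> g 0 1 = h 0 1 -> g 1 0 = h 1 0 ->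
  g 1 1 = h 1 1 -> g = h.
Proof.
move=> h1 h2 h3 h4; apply/matrixP => i k.
have E (l : 'I_2) : l = 0 \/ l = 1.
  by case: l => [[|[|//]] ?]; [left|right]; apply: val_inj.
by case: (E i) => ->; case: (E k) => ->.
Qed.

Lemma cocycle_neq0 g z : unimodular g -> uhp z -> cocycle g z != 0.
Proof.
move=> hg; rewrite uhpE => z0; apply/eqP => e.
have := congr1 (@complex.Im R) e; have := congr1 (@complex.Re R) e.
rewrite /cocycle cReD cImD cReM cImM /= mul0r subr0 addr0 mul0r addr0 => h1 /eqP.
rewrite mulf_eq0 (gt_eqF z0) orbF => /eqP c0.
move: h1 hg; rewrite c0 mul0r add0r /unimodular => ->.
by rewrite c0 !mulr0 subr0 => /eqP; rewrite eq_sym oner_eq0.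
Qed.

Lemma Im_mobius g z : unimodular g -> uhp z ->
  complex.Im (mobius g z) = complex.Im z / nm (cocycle g z) ^+ 2.
Proof.
move=> hg hz; rewrite /mobius cImM cReV cImV.
rewrite !mulrA -mulrDl; congr (_ / _).
rewrite /cocycle !(cReD, cImD, cReM, cImM) /= !mul0r !subr0 !addr0.
rewrite -[RHS]mul1r -hg; ring.
Qed.

Lemma mobius_uhp g z : unimodular g -> uhp z -> uhp (mobius g z).
Proof.
move=> hg hz; rewrite uhpE Im_mobius//; rewrite divr_gt0//.
by rewrite exprn_gt0// nm_gt0 cocycle_neq0.
Qed.

Lemma cocycleM g h z : unimodular h -> uhp z ->
  cocycle (g *m h) z = cocycle g (mobius h z) * cocycle h z.
Proof.
move=> hh hz; have c0 := cocycle_neq0 hh hz.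
rewrite {1}/cocycle !mulmx2E /mobius {1}/cocycle mulrDl mulrA divfK//.
by rewrite /cocycle !rmorphD !rmorphM; ring.
Qed.

Lemma mobiusM g h z : unimodular g -> unimodular h -> uhp z ->
  mobius (g *m h) z = mobius g (mobius h z).
Proof.
move=> hg hh hz; have c0 := cocycle_neq0 hh hz.
have c1 := cocycle_neq0 hg (mobius_uhp hh hz).
have num : (((g *m h) 0 0)%:C * z + ((g *m h) 0 1)%:C : C) =
  ((g 0 0)%:C * mobius h z + (g 0 1)%:C) * cocycle h z.
  rewrite mulrDl -mulrA /mobius divfK// !mulmx2E !rmorphD !rmorphM /cocycle; ring.
by rewrite {1}/mobius cocycleM// num invfM mulrACA divff// mulr1.
Qed.

Definition adj2 g : 'M[R]_2 := \matrix_(i < 2, k < 2)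
  (if i == 0 then (if k == 0 then g 1 1 else - g 0 1)
   else (if k == 0 then - g 1 0 else g 0 0)).

Lemma unimodular_adj g : unimodular g -> unimodular (adj2 g).
Proof. by rewrite /unimodular !mxE /= => <-; ring. Qed.

Lemma adj2_mull g : unimodular g -> adj2 g *m g = 1%:M.
Proof.
rewrite /unimodular => hg.
by apply: matrix2P; rewrite !mulmx2E !mxE /= ?mulr1n ?mulr0n; try ring; rewrite -hg; ring.
Qed.

Lemma mobius1 z : mobius (1%:M) z = z.
Proof. by rewrite /mobius /cocycle !mxE /= mulr1n mulr0n mul0r add0r mul1r addr0 divr1. Qed.

Lemma mobius_adjK g z : unimodular g -> uhp z -> mobius (adj2 g) (mobius g z) = z.
Proof.
by move=> hg hz; rewrite -mobiusM ?adj2_mull ?mobius1//; exact: unimodular_adj.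
Qed.

(** A fixed point solves a real quadratic of discriminant tr^2 - 4. If the leading coefficient is
    nonzero, a non-real root forces tr^2 < 4; if it is zero, the matrix is scalar and acts
    trivially. *)
Lemma mobius_fixed g z : unimodular g -> uhp z -> mobius g z = z ->
  `|\tr g| < 2 \/ forall w, mobius g w = w.
Proof.
move=> hg; have hdet := hg; move: hg; rewrite /unimodular => hg hz hfix.
have c0 := cocycle_neq0 hdet hz.
have eqn : (g 1 0)%:C * z ^+ 2 + ((g 1 1)%:C - (g 0 0)%:C) * z - (g 0 1)%:C = 0.
  have : (g 0 0)%:C * z + (g 0 1)%:C = z * cocycle g z.
    by rewrite -{2}hfix /mobius divfK.
  by move/eqP; rewrite -subr_eq0 /cocycle => /eqP e; rewrite -[RHS]oppr0 -e; ring.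
have y0 : 0 < complex.Im z by exact: hz.
have := congr1 (@complex.Im R) eqn; have := congr1 (@complex.Re R) eqn.
rewrite expr2 !(cReD, cImD, cReM, cImM, Re_sub, Im_sub) /=.
move: (complex.Re z) (complex.Im z) y0 => x y y0 eR eI.
have trE : \tr g = g 0 0 + g 1 1.
  rewrite /mxtrace !big_ord_recl big_ord0 addr0.
  by congr (g _ _ + g _ _); apply: val_inj.
have eI' : 2 * g 1 0 * x + g 1 1 - g 0 0 = 0.
  have : y * (2 * g 1 0 * x + g 1 1 - g 0 0) = 0 by rewrite -[RHS]eI; ring.
  by move/eqP; rewrite mulf_eq0 (gt_eqF y0) => /eqP.
have [c00|c00] := eqVneq (g 1 0) 0.
  right; have ad : g 1 1 = g 0 0 by move: eI'; rewrite c00; lra.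
  have b0 : g 0 1 = 0 by move: eR; rewrite c00 ad; lra.
  move=> w.
  rewrite /mobius /cocycle ad b0 c00 mul0r add0r addr0 mulrAC divff ?mul1r//.
  apply/eqP => /(congr1 (@complex.Re R)) /= a0.
  by move: hg; rewrite -ad c00 mulr0 ad a0 mulr0 subr0 => /eqP; rewrite eq_sym oner_eq0.
left; rewrite trE.
(* The discriminant, computed from the root: tr^2 - 4 = - (2 c y)^2. *)
have h4 : (g 0 0 + g 1 1) ^+ 2 = 4 - 4 * (g 1 0) ^+ 2 * y ^+ 2.
  have -> : (g 0 0 + g 1 1) ^+ 2 = (g 1 1 - g 0 0) ^+ 2 + 4 * (g 0 0 * g 1 1) by ring.
  have -> : g 1 1 - g 0 0 = - (2 * g 1 0 * x) by move: eI'; lra.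
  have -> : g 0 0 * g 1 1 = 1 + g 0 1 * g 1 0 by move: hg; lra.
  have eR' : g 0 1 = g 1 0 * (x * x - y * y) + (g 1 1 - g 0 0) * x by move: eR; lra.
  have eI2 : g 1 1 - g 0 0 = - (2 * g 1 0 * x) by move: eI'; lra.
  by rewrite eR' eI2; ring.
have h5 : 0 < 4 * (g 1 0) ^+ 2 * y ^+ 2.
  have y2 : 0 < y ^+ 2 by exact: exprn_gt0.
  have g2 : 0 < g 1 0 ^+ 2 by rewrite exprn_even_gt0.
  by apply: mulr_gt0 => //; apply: mulr_gt0.
rewrite -(@ltr_pXn2r _ 2)// ?nnegrE// real_normK ?num_real// h4; lra.
Qed.

Lemma is_derive_mobius g z : unimodular g -> uhp z ->
  is_derive z (1 : C) (mobius g) ((cocycle g z ^+ 2)^-1).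
Proof.
move=> hg hz; have c0 := cocycle_neq0 hg hz.
have hlin (a b : C) : is_derive z (1 : C) (fun w => a * w + b) a.
  apply: (is_derive_cast (cderivD (cderivMl a (cderiv_id z)) (cderiv_cst z b))).
  by rewrite mulr1 addr0.
have hv := cderivV c0 (hlin (g 1 0)%:C (g 1 1)%:C).
apply: (is_derive_cast (cderivM (hlin (g 0 0)%:C (g 0 1)%:C) hv)).
have dC : (g 0 0)%:C * (g 1 1)%:C - (g 0 1)%:C * (g 1 0)%:C = 1 :> C.
  by rewrite -!rmorphM -rmorphB hg.
rewrite -[RHS]mul1r -[in RHS]dC; move: c0; rewrite /cocycle => c0.
by field.
Qed.

End Moebius.

Section Group.
Variables (R : realType) (N : nat).
Hypothesis sfN : squarefree N.
Local Notation C := (Cplx R).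
Local Notation G := (@Gamma0plus R N).
Implicit Types (g h : 'M[R]_2) (z w : C).

Lemma squarefree_gt0 : (0 < N)%N.
Proof.
rewrite lt0n; apply/eqP => N0.
by have := sfN (d := 2); rewrite N0 dvdn0 => /(_ isT).
Qed.

Definition gmat (e : nat) (a b c d : int) : 'M[R]_2 :=
  (Num.sqrt e%:R)^-1 *: \matrix_(i < 2, k < 2)
     (if i == 0 then (if k == 0 then a else b)
      else (if k == 0 then c else d))%:~R.

Lemma gmatE e a b c d :
  [/\ gmat e a b c d 0 0 = a%:~R / Num.sqrt e%:R,
      gmat e a b c d 0 1 = b%:~R / Num.sqrt e%:R,
      gmat e a b c d 1 0 = c%:~R / Num.sqrt e%:R &
      gmat e a b c d 1 1 = d%:~R / Num.sqrt e%:R].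
Proof. by rewrite /gmat !mxE /=; split; rewrite mulrC. Qed.

Lemma Gamma_gmat g : G g -> exists e a b c d,
  [/\ (e %| N)%N, (0 < e)%N, [/\ (e%:Z %| a)%Z, (e%:Z %| d)%Z & (N%:Z %| c)%Z],
    a * d - b * c = e%:Z & g = gmat e a b c d].
Proof.
move=> [e [a [b [c [d [[h1 h2 h3 h4] [h5 h6]]]]]]].
exists e, a, b, c, d; split => //; apply: dvdn_gt0 h1; exact: squarefree_gt0.
Qed.

Lemma gmat_Gamma e a b c d : (e %| N)%N -> (e%:Z %| a)%Z -> (e%:Z %| d)%Z ->
  (N%:Z %| c)%Z -> a * d - b * c = e%:Z -> G (gmat e a b c d).
Proof. by move=> *; exists e, a, b, c, d. Qed.

Lemma gmat_unimodular e a b c d : (0 < e)%N -> a * d - b * c = e%:Z ->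
  unimodular (gmat e a b c d).
Proof.
move=> e0 det; rewrite /unimodular; have [-> -> -> ->] := gmatE e a b c d.
have s0 : Num.sqrt e%:R != 0 :> R by rewrite gt_eqF// sqrtr_gt0 ltr0n.
have s2 : Num.sqrt e%:R * Num.sqrt e%:R = e%:R :> R by rewrite -expr2 sqr_sqrtr.
have detR : a%:~R * d%:~R - b%:~R * c%:~R = e%:R :> R.
  by rewrite -!intrM -intrB det.
rewrite !mulf_div -mulrBl detR s2 divff// pnatr_eq0 -lt0n//.
Qed.

Lemma Gamma_unimodular g : G g -> unimodular g.
Proof.
by move=> /Gamma_gmat[e [a [b [c [d [_ e0 _ det ->]]]]]]; exact: gmat_unimodular.
Qed.

Lemma Gamma_adj g : G g -> G (adj2 g).
Proof.
move=> /Gamma_gmat[e [a [b [c [d [eN e0 [ea ed Nc] det ->]]]]]].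
suff -> : adj2 (gmat e a b c d) = gmat e d (- b) (- c) a.
  apply: gmat_Gamma => //; first by rewrite rpredN.
  by rewrite -det; ring.
have [h1 h2 h3 h4] := gmatE e a b c d.
have [k1 k2 k3 k4] := gmatE e d (- b) (- c) a.
by apply: matrix2P; rewrite ?k1 ?k2 ?k3 ?k4 mxE /= ?h1 ?h2 ?h3 ?h4 ?intrN ?mulNr.
Qed.

(** With t = gcd(e1, e2), e1 = f1 t and e2 = f2 t, every entry of the product of the integral
    matrices is divisible by t. Dividing by t leaves determinant f1 f2, which divides N because f1
    f2 t = lcm(e1, e2) does. *)
Lemma GammaM g h : G g -> G h -> G (g *m h).
Proof.
move=> /Gamma_gmat[e1 [a1 [b1 [c1 [d1 [e1N e10 [ea1 ed1 Nc1] det1 ->]]]]]].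
move=> /Gamma_gmat[e2 [a2 [b2 [c2 [d2 [e2N e20 [ea2 ed2 Nc2] det2 ->]]]]]].
set t := gcdn e1 e2; have t0 : (0 < t)%N by rewrite gcdn_gt0 e10.
have [f1 e1E] : exists f, e1 = (f * t)%N by apply/dvdnP; exact: dvdn_gcdl.
have [f2 e2E] : exists f, e2 = (f * t)%N by apply/dvdnP; exact: dvdn_gcdr.
have lN : (f1 * f2 * t %| N)%N.
  rewrite -mulnA mulnC -mulnA.
  have -> : (f2 * (t * f1))%N = lcmn e1 e2.
    apply/eqP; rewrite -(eqn_pmul2r t0).
    have -> : (lcmn e1 e2 * t)%N = (e1 * e2)%N by exact: muln_lcm_gcd.
    apply/eqP; transitivity (f1 * t * (f2 * t))%N; last by rewrite -e1E -e2E.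
    by move: (t) => u; ring.
  by rewrite dvdn_lcm e1N.
have [M NE] := dvdnP lN.
have [a1' a1E] := dvdzP ea1; have [d1' d1E] := dvdzP ed1.
have [a2' a2E] := dvdzP ea2; have [d2' d2E] := dvdzP ed2.
have [c1' c1E] := dvdzP Nc1; have [c2' c2E] := dvdzP Nc2.
have tz : t%:Z != 0 by rewrite -lt0n.
pose T : int := t%:Z; pose F1 : int := f1%:Z; pose F2 : int := f2%:Z; pose M' : int := M%:Z.
have E1 : e1%:Z = F1 * T by rewrite e1E PoszM.
have E2 : e2%:Z = F2 * T by rewrite e2E PoszM.
have EN : N%:Z = M' * F1 * F2 * T by rewrite NE !PoszM !mulrA.
pose A := a1' * F1 * a2' * F2 * T + b1 * c2' * M' * F1 * F2.
pose B := a1' * F1 * b2 + b1 * d2' * F2.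
pose C' := M' * F1 * F2 * T * (c1' * a2' * F2 + d1' * c2' * F1).
pose D := c1' * M' * F1 * F2 * b2 + d1' * F1 * d2' * F2 * T.
have hA : a1 * a2 + b1 * c2 = A * T by rewrite a1E a2E c2E E1 E2 EN /A; ring.
have hB : a1 * b2 + b1 * d2 = B * T by rewrite a1E d2E E1 E2 /B; ring.
have hC : c1 * a2 + d1 * c2 = C' * T by rewrite c1E a2E d1E c2E E1 E2 EN /C'; ring.
have hD : c1 * b2 + d1 * d2 = D * T by rewrite c1E d1E d2E E1 E2 EN /D; ring.
have -> : gmat e1 a1 b1 c1 d1 *m gmat e2 a2 b2 c2 d2 = gmat (f1 * f2) A B C' D.
  have [h1 h2 h3 h4] := gmatE e1 a1 b1 c1 d1.
  have [k1 k2 k3 k4] := gmatE e2 a2 b2 c2 d2.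
  have [l1 l2 l3 l4] := gmatE (f1 * f2) A B C' D.
  have sE : Num.sqrt e1%:R * Num.sqrt e2%:R = t%:R * Num.sqrt (f1 * f2)%:R :> R.
    rewrite -sqrtrM// -natrM e1E e2E.
    have -> : (f1 * t * (f2 * t))%N = ((t ^ 2) * (f1 * f2))%N by rewrite -mulnn; ring.
    by rewrite natrM sqrtrM// natrX sqrtr_sqr ger0_norm.
  have tR : t%:R != 0 :> R by rewrite pnatr_eq0 -lt0n.
  have key (x1 y1 x2 y2 X : int) : x1 * y1 + x2 * y2 = X * T ->
    x1%:~R / Num.sqrt e1%:R * (y1%:~R / Num.sqrt e2%:R) +
    x2%:~R / Num.sqrt e1%:R * (y2%:~R / Num.sqrt e2%:R) =
    X%:~R / Num.sqrt (f1 * f2)%:R :> R.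
    move=> hX; rewrite !mulf_div -mulrDl -!intrM -intrD hX sE intrM [t%:R * _]mulrC.
    by rewrite -mulf_div divff// mulr1.
  by apply: matrix2P; rewrite !mulmx2E ?h1 ?h2 ?h3 ?h4 ?k1 ?k2 ?k3 ?k4 ?l1 ?l2 ?l3 ?l4; exact: key.
apply: gmat_Gamma.
- by apply: dvdn_trans lN; rewrite dvdn_mulr.
- by apply/dvdzP; exists (a1' * a2' * T + b1 * c2' * M'); rewrite PoszM /A -/F1 -/F2; ring.
- by apply/dvdzP; exists (c1' * M' * b2 + d1' * d2' * T); rewrite PoszM /D -/F1 -/F2; ring.
- by apply/dvdzP; exists (c1' * a2' * F2 + d1' * c2' * F1); rewrite EN /C'; ring.
(* The entries are known only after multiplication by [T], so the determinant identity is checked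
   after multiplication by [T] twice. *)
apply: (mulIf tz); apply: (mulIf tz); rewrite -/T.
have -> : (A * D - B * C') * T * T = (A * T) * (D * T) - (B * T) * (C' * T) by ring.
rewrite -hA -hB -hC -hD PoszM -/F1 -/F2.
have -> : F1 * F2 * T * T = (a1 * d1 - b1 * c1) * (a2 * d2 - b2 * c2).
  by rewrite det1 det2 E1 E2; ring.
ring.
Qed.

Definition translation (n : int) : 'M[R]_2 := gmat 1 1 n 0 1.

Lemma Gamma_translation n : G (translation n).
Proof. by apply: gmat_Gamma; rewrite ?dvd1n ?dvd1z ?dvdz0 ?mulr1 ?mulr0 ?subr0. Qed.

Lemma mobius_translation n z : mobius (translation n) z = z + n%:~R.
Proof.
have [h1 h2 h3 h4] := gmatE 1 1 n 0 1.
rewrite /mobius /cocycle h1 h2 h3 h4 sqrtr1 !divr1 !rmorph1 !rmorph0 mul0r add0r.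
by rewrite divr1 mul1r rmorph_int.
Qed.

Lemma equivalent_sym z w : uhp z -> equivalent N z w -> equivalent N w z.
Proof.
move=> hz [g Gg <-]; exists (adj2 g); first exact: Gamma_adj.
by apply: mobius_adjK => //; exact: Gamma_unimodular.
Qed.

Lemma equivalent_trans z w v : uhp z -> equivalent N z w -> equivalent N w v ->
  equivalent N z v.
Proof.
move=> hz [g Gg <-] [h Gh <-]; exists (h *m g); first exact: GammaM.
by rewrite mobiusM//; exact: Gamma_unimodular.
Qed.

End Group.

(** * Proper discontinuity and reduction to a strip *)

Section Discontinuity.
Variables (R : realType) (N : nat).
Hypothesis sfN : squarefree N.
Local Notation C := (Cplx R).
Local Notation G := (@Gamma0plus R N).
Implicit Types (g h : 'M[R]_2) (z w : C).

Definition small_int (M : nat) (i : 'I_(2 * M).+1) : int := i%:Z - M%:Z.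

Lemma small_intP (M : nat) (a : int) : (`|a| <= M)%N ->
  exists i : 'I_(2 * M).+1, a = small_int i.
Proof.
move=> aM; have h : (`|(a + M%:Z)%R|%N < (2 * M).+1)%N by lia.
exists (Ordinal h); rewrite /small_int /= gez0_abs ?addrK//; lia.
Qed.

(** Bounded entries leave finitely many choices for e and the four integers, since sqrt e <= N. A
    finite type indexes them, so that a condition valid near 0 for each index holds for all at
    once. *)
Lemma bounded_Gamma (B : R) : exists (T : finType) (F : T -> 'M[R]_2),
  forall g, G g -> (forall i k, `|g i k| <= B) -> exists t, g = F t.
Proof.
pose M := (Num.truncn (B * N%:R)).+1.
exists ('I_N.+1 * ('I_(2 * M).+1 * 'I_(2 * M).+1) * ('I_(2 * M).+1 * 'I_(2 * M).+1))%type.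
exists (fun t : 'I_N.+1 * ('I_(2 * M).+1 * 'I_(2 * M).+1) *
  ('I_(2 * M).+1 * 'I_(2 * M).+1) => gmat R t.1.1 (small_int t.1.2.1) (small_int t.1.2.2)
                      (small_int t.2.1) (small_int t.2.2)).
move=> g /(Gamma_gmat sfN)[e [a [b [c [d [eN e0 _ _ ->]]]]]] hB.
have [h1 h2 h3 h4] := gmatE R e a b c d.
have eN' : (e < N.+1)%N by rewrite ltnS dvdn_leq// squarefree_gt0.
have s0 : 0 < Num.sqrt e%:R :> R by rewrite sqrtr_gt0 ltr0n.
have sN : Num.sqrt e%:R <= N%:R :> R.
  rewrite -[leRHS]ger0_norm// -sqrtr_sqr ler_wsqrtr// -natrX ler_nat.
  have N0 := squarefree_gt0 sfN; rewrite ltnS in eN'; apply: leq_trans eN' _.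
  by rewrite -mulnn leq_pmulr.
have key (x : int) : `|x%:~R / Num.sqrt e%:R| <= B -> exists i, x = @small_int M i.
  rewrite normrM normfV (gtr0_norm s0) ler_pdivrMr// => h.
  apply: small_intP; rewrite /M.
  have B0 : 0 <= B.
    by move: h; rewrite leNgt => /negP h; rewrite leNgt; apply/negP => B0; apply: h;
       apply: lt_le_trans (normr_ge0 _); rewrite nmulr_rlt0.
  have : (`|x|%N)%:R <= B * N%:R :> R.
    rewrite natr_absz intr_norm; apply: le_trans h _; exact: ler_wpM2l.
  move=> /le_lt_trans /(_ (truncnS_gt _)); rewrite ltr_nat => /ltnW //.
have [ia ea] := key a (eq_ind _ (fun u => `|u| <= B) (hB 0 0) _ h1).
have [ib eb] := key b (eq_ind _ (fun u => `|u| <= B) (hB 0 1) _ h2).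
have [ic ec] := key c (eq_ind _ (fun u => `|u| <= B) (hB 1 0) _ h3).
have [id ed] := key d (eq_ind _ (fun u => `|u| <= B) (hB 1 1) _ h4).
by exists (Ordinal eN', (ia, ib), (ic, id)); rewrite /= -ea -eb -ec -ed.
Qed.

Lemma mobius_separate g z w : uhp z -> unimodular g -> mobius g z <> w ->
  exists2 e : R, 0 < e & forall z', nm (z' - z) < e -> e <= nm (mobius g z' - w).
Proof.
move=> hz hg neq; have d0 : 0 < nm (mobius g z - w) by rewrite nm_gt0 subr_eq0; apply/eqP.
set d := nm _ in d0.
have /cvg_nmP/(_ (d / 2)) := is_derive_continuous (is_derive_mobius hg hz).
rewrite divr_gt0// => /(_ isT)/near_nmP[e e0 he].
exists (Num.min e (d / 2)); first by rewrite lt_min e0 divr_gt0.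
move=> z'; rewrite lt_min => /andP[/he h1 _].
rewrite ge_min; apply/orP; right.
have := ler_nm_distD (mobius g z) w (mobius g z'); rewrite -/d nmBC; lra.
Qed.

(** A real affine form is controlled by its value at a non-real point: the imaginary part bounds
    [u], and then [v] is a difference. *)
Lemma nm_affine_le (u v : R) z : uhp z ->
  `|u| <= nm (u%:C * z + v%:C) / complex.Im z /\
  `|v| <= nm (u%:C * z + v%:C) * (1 + nm z / complex.Im z).
Proof.
move=> hz; have y0 : 0 < complex.Im z := hz.
have h1 : `|u| <= nm (u%:C * z + v%:C) / complex.Im z.
  rewrite ler_pdivlMr//; have := ler_Im_nm (u%:C * z + v%:C).
  by rewrite cImD cImM /= mul0r !addr0 normrM (gtr0_norm y0).
split => //; rewrite -(nm_real v).
have vE : v%:C = (u%:C * z + v%:C) - u%:C * z :> C by rewrite addrC addKr.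
rewrite [X in nm X <= _]vE.
apply: le_trans (ler_nmB _ _) _; rewrite mulrDr mulr1 lerD2l nmM nm_real.
by rewrite mulrCA [nm z * _]mulrC; apply: ler_wpM2r => //; exact: nm_ge0.
Qed.

(* A matrix taking a point near z to a point near w has bounded entries, so only
   finitely many are involved; each can be separated individually. *)
Lemma properly_discontinuous z w : uhp z -> uhp w ->
  exists2 e : R, 0 < e & forall g z', G g -> nm (z' - z) < e ->
    nm (mobius g z' - w) < e -> mobius g z = w.
Proof.
move=> hz hw; have y0 : 0 < complex.Im z := hz; have v0 : 0 < complex.Im w := hw.
set y := complex.Im z in y0; set v := complex.Im w in v0.
(* For nearby points |cocycle|^2 = Im z' / Im (g z') is less than 2y / (v/2) = 4y/v; adding 1 avoids
   a square root, because 2x <= x^2 + 1. *)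
pose K := 4 * y / v + 1.
have K0 : 0 < K by rewrite ltr_wpDl// divr_ge0 ?mulr_ge0 ?ltW.
pose nz := nm z + y; pose nw := nm w + v.
(* [L] bounds both the numerator and the denominator of the Moebius map at [z'], and [B] the matrix
   entries, through [nm_affine_le]. *)
pose L := K * (1 + nw); pose B := L * (2 / y) + L * (1 + nz * (2 / y)).
have nz0 : 0 <= nz by rewrite addr_ge0 ?nm_ge0 ?ltW.
have nw0 : 0 <= nw by rewrite addr_ge0 ?nm_ge0 ?ltW.
have L0 : 0 <= L := mulr_ge0 (ltW K0) (addr_ge0 ler01 nw0).
have y2 : 0 < 2 / y by rewrite divr_gt0.
have [T [F hF]] := bounded_Gamma B.
have sep (t : T) : \forall e \near (0 : R)^'+, unimodular (F t) -> mobius (F t) z <> w ->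
    forall z', nm (z' - z) < e -> e <= nm (mobius (F t) z' - w).
  have [[hu hne]|nh] := pselect (unimodular (F t) /\ mobius (F t) z <> w); last first.
    by near=> e => h1 h2; exfalso; apply: nh.
  have [e e0 he] := mobius_separate hz hu hne.
  apply: filterS (nbhs_right_le e0) => e1 e1e _ _ z' hz'.
  by apply: (le_trans e1e); apply: he; exact: (lt_le_trans hz' e1e).
have all_sep := @filter_forall _ _ _ (0 : R)^'+ (at_right_proper_filter 0) sep.
near (0 : R)^'+ => e.
have e0 : 0 < e by near: e; exact: nbhs_right_gt.
have ey : e <= y / 2 by near: e; apply: nbhs_right_le; rewrite divr_gt0.
have ev : e <= v / 2 by near: e; apply: nbhs_right_le; rewrite divr_gt0.
have hsep : forall t, unimodular (F t) -> mobius (F t) z <> w ->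
    forall z', nm (z' - z) < e -> e <= nm (mobius (F t) z' - w).
  by near: e; exact: all_sep.
exists e => // g z' Gg zz' ww'.
have hg := Gamma_unimodular sfN Gg.
have y'1 : y / 2 < complex.Im z'.
  have := le_lt_trans (ler_Im_nm _) zz'; rewrite Im_sub ltr_norml -/y => /andP[h _]; lra.
have y'2 : complex.Im z' < 2 * y.
  have := le_lt_trans (ler_Im_nm _) zz'; rewrite Im_sub ltr_norml -/y => /andP[_ h]; lra.
have hz' : uhp z' by rewrite uhpE; apply: lt_trans y'1; rewrite divr_gt0.
have v'1 : v / 2 < complex.Im (mobius g z').
  have := le_lt_trans (ler_Im_nm _) ww'; rewrite Im_sub ltr_norml -/v => /andP[h _]; lra.
have c0 := cocycle_neq0 hg hz'.
have nc0 : 0 < nm (cocycle g z') by rewrite nm_gt0.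
have cK : nm (cocycle g z') <= K.
  have := v'1; rewrite Im_mobius// ltr_pdivlMr ?exprn_gt0// => h.
  have h2 : nm (cocycle g z') ^+ 2 < 4 * y / v.
    by rewrite ltr_pdivlMr//; move: h y'2 => /lt_trans h /h; lra.
  have : 0 <= (nm (cocycle g z') - 1) ^+ 2 by rewrite sqr_ge0.
  rewrite /K; move: (nm (cocycle g z')) nc0 h2 => c; move: (4 * y / v) => k c00 h2 h3.
  by rewrite leNgt; apply/negP => ck; nra.
have nz' : nm z' <= nz.
  rewrite -[z'](subrK z) addrC /nz; apply: le_trans (ler_nmD _ _) _.
  by rewrite lerD2l ltW//; apply: lt_le_trans zz' _; lra.
have nw' : nm (mobius g z') <= nw.
  rewrite -[mobius g z'](subrK w) addrC /nw; apply: le_trans (ler_nmD _ _) _.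
  by rewrite lerD2l ltW//; apply: lt_le_trans ww' _; lra.
have cL : nm (cocycle g z') <= L.
  by apply: le_trans cK _; rewrite /L ler_pMr// lerDl.
have nL : nm ((g 0 0)%:C * z' + (g 0 1)%:C) <= L.
  have -> : (g 0 0)%:C * z' + (g 0 1)%:C = mobius g z' * cocycle g z'.
    by rewrite /mobius divfK.
  rewrite nmM /L mulrC; apply: ler_pM; rewrite ?nm_ge0//.
  by apply: le_trans nw' _; rewrite lerDr.
have iy : (complex.Im z')^-1 <= 2 / y.
  rewrite -[2 / y]invrK lef_pV2 ?posrE ?invr_gt0//.
  by rewrite invfM invrK mulrC ltW.
have iy0 : 0 <= (complex.Im z')^-1 by rewrite invr_ge0 ltW.
have aff (p q : R) : nm (p%:C * z' + q%:C) <= L -> `|p| <= B /\ `|q| <= B.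
  move=> hL; have [h1 h2] := nm_affine_le p q hz'.
  have b1 : `|p| <= L * (2 / y).
    by apply: le_trans h1 _; apply: ler_pM; rewrite ?nm_ge0.
  have b2 : `|q| <= L * (1 + nz * (2 / y)).
    apply: le_trans h2 _; apply: ler_pM; rewrite ?nm_ge0//.
      by rewrite addr_ge0// mulr_ge0 ?nm_ge0.
    by rewrite lerD2l; apply: ler_pM; rewrite ?nm_ge0.
  split; [apply: le_trans b1 _; rewrite lerDl|apply: le_trans b2 _; rewrite lerDr].
    by rewrite mulr_ge0// addr_ge0// mulr_ge0// ltW.
  by rewrite mulr_ge0// ltW.
have [B1 B2] := aff _ _ nL; have [B3 B4] := aff _ _ cL.
have [t gE] : exists t, g = F t.
  apply: hF => // i k.
  have E (l : 'I_2) : l = 0 \/ l = 1.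
    by case: l => [[|[|//]] ?]; [left|right]; apply: val_inj.
  by case: (E i) => ->; case: (E k) => ->.
apply: contrapT => neq; have := hsep t; rewrite -gE => /(_ hg neq _ zz').
by rewrite leNgt ww'.
Unshelve. all: by end_near. Qed.

(** Pigeonhole: the n + 1 fractional parts of 0, x, ..., n x fall into n cells of length 1/n, and
    the difference of two in one cell is the required combination. *)
Lemma dirichlet (x : R) (n : nat) : (0 < n)%N -> exists c d : int,
  [/\ 0 < c, c <= n%:Z & `|c%:~R * x + d%:~R| <= n%:R^-1].
Proof.
move=> n0; pose r (i : nat) : R := i%:R * x - (Num.floor (i%:R * x))%:~R.
have r01 i : 0 <= r i < 1.
  by rewrite /r subr_ge0 ge_floor/= ltrBlDl -[X in _ < _ + X]/(1%:~R) -intrD floorD1_gt.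
have nR : 0 < n%:R :> R by rewrite ltr0n.
have cell (i : 'I_n.+1) : (Num.truncn (n%:R * r i) < n)%N.
  have /andP[r0 r1] := r01 i.
  have /andP[t1 _] := truncn_itv (mulr_ge0 (ltW nR) r0).
  by rewrite -(ltr_nat R); apply: le_lt_trans t1 _; rewrite gtr_pMr.
pose k i := Ordinal (cell i).
have : ~~ injectiveb k.
  apply/negP => /injectiveP /leq_card; by rewrite !card_ord ltnn.
move=> /injectivePn[i [l il /(congr1 val) /= E]].
wlog lt_il : i l il E / (i < l)%N.
  move=> H; have : (i != l :> nat) by exact: il.
  by rewrite neq_ltn => /orP[/H|/H]; apply => //; rewrite eq_sym.
exists (l%:Z - i%:Z), (Num.floor (i%:R * x) - Num.floor (l%:R * x)); split.
- by rewrite subr_gt0 ltz_nat.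
- by rewrite lerBlDr; have := ltn_ord l; lia.
have -> : (l%:Z - i%:Z)%:~R * x + (Num.floor (i%:R * x) - Num.floor (l%:R * x))%:~R =
  r l - r i by rewrite /r !intrB -!pmulrn; ring.
have /andP[i0 i1] := r01 i; have /andP[l0 l1] := r01 l.
have t1 := truncn_itv (mulr_ge0 (ltW nR) i0).
have t2 := truncn_itv (mulr_ge0 (ltW nR) l0).
move: t1 t2; rewrite E; move: (Num.truncn _) => m /andP[a1 a2] /andP[b1 b2].
rewrite -[n%:R^-1]mul1r ler_pdivlMr// -[X in _ * X](gtr0_norm nR) -normrM ler_norml.
move: a1 a2 b1 b2; rewrite -natr1 mulrBl ![n%:R * _]mulrC => a1 a2 b1 b2.
by apply/andP; split; lra.
Qed.

(* Dirichlet approximation of Re z with denominators up to (Im z)^(-1/2). *)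
Lemma short_vector z : uhp z -> exists c d : int,
  (c != 0) || (d != 0) /\ nm (c%:~R * z + d%:~R) ^+ 2 <= 5 * complex.Im z.
Proof.
move=> hz; have y0 : 0 < complex.Im z := hz; set y := complex.Im z in y0 *.
have [y1|y1] := leP 1 y.
  exists 0, 1; split => //; rewrite mul0r add0r nm1 expr1n; lra.
have sy : 0 < Num.sqrt y by rewrite sqrtr_gt0.
have sy2 : Num.sqrt y ^+ 2 = y by rewrite sqr_sqrtr// ltW.
have sy1 : Num.sqrt y <= 1 by rewrite -sqrtr1 ler_wsqrtr// ltW.
pose n := (Num.truncn (Num.sqrt y)^-1).+1.
have n1 : (Num.sqrt y)^-1 < n%:R by exact: truncnS_gt.
have n2 : n%:R <= 2 / Num.sqrt y.
  have : (Num.truncn (Num.sqrt y)^-1)%:R <= (Num.sqrt y)^-1.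
    by rewrite truncn_le invr_ge0 ltW.
  have : 1 <= (Num.sqrt y)^-1 by rewrite invf_ge1.
  by rewrite /n -natr1; lra.
have [c [d [c0 cn h]]] := dirichlet (complex.Re z) (ltn0Sn _ : 0 < n)%N.
have nR : 0 < n%:R :> R by rewrite ltr0n.
exists c, d; split; first by rewrite gt_eqF.
rewrite nm_sqr !(cReD, cImD, cReM, cImM).
have [rc ic] : complex.Re (c%:~R : C) = c%:~R /\ complex.Im (c%:~R : C) = 0.
  by rewrite -(rmorph_int (real_complex R)).
have [rd id] : complex.Re (d%:~R : C) = d%:~R /\ complex.Im (d%:~R : C) = 0.
  by rewrite -(rmorph_int (real_complex R)).
rewrite rc ic rd id !mul0r subr0 !addr0 -/y.
(* The constant 5 is 1 + 4: the real part contributes at most y to the square, the imaginary part at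
   most 4 y. *)
have h1 : (c%:~R * complex.Re z + d%:~R) ^+ 2 <= y.
  rewrite -(real_normK (num_real _)) -sy2 lerXn2r ?nnegrE ?normr_ge0 ?ltW//.
  apply: le_lt_trans h _; rewrite -[ltRHS]invrK ltf_pV2 ?posrE ?invr_gt0//.
have h2 : (c%:~R * y) ^+ 2 <= 4 * y.
  have cR : c%:~R <= n%:R :> R by rewrite pmulrn ler_int.
  have cR0 : 0 < c%:~R :> R by rewrite ltr0z.
  have : c%:~R * y <= 2 * Num.sqrt y.
    rewrite -{1}sy2 expr2 mulrA ler_pM2r//.
    by rewrite -ler_pdivlMr//; apply: le_trans n2.
  move=> h3; have -> : 4 * y = (2 * Num.sqrt y) ^+ 2 by rewrite exprMn sy2; ring.
  apply: lerXn2r => //; rewrite nnegrE; apply: mulr_ge0 => //; exact: ltW.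
lra.
Qed.

Lemma coprime_short_vector z : uhp z -> exists c d : int,
  coprimez c d /\ nm (c%:~R * z + d%:~R) ^+ 2 <= 5 * complex.Im z.
Proof.
move=> /short_vector[c [d [cd h]]].
have t0 : gcdz c d != 0 by rewrite gcdz_eq0 negb_and.
have [c' cE] := dvdzP (dvdz_gcdl c d); have [d' dE] := dvdzP (dvdz_gcdr c d).
set t := gcdz c d in t0 cE dE.
have tge : 1 <= t by rewrite -[1 <= t]/(0 < t) lt_neqAle eq_sym t0.
exists c', d'; split.
  rewrite /coprimez -(inj_eq (mulIf t0)) mul1r.
  have -> : gcdz c' d' * t = gcdz (c' * t) (d' * t) by rewrite -mulz_gcdl gez0_abs//; lia.
  by rewrite -cE -dE.
apply: le_trans h; rewrite lerXn2r ?nnegrE ?nm_ge0//.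
have -> : c%:~R * z + d%:~R = (c'%:~R * z + d'%:~R) * t%:~R by rewrite cE dE !intrM; ring.
rewrite nmM ler_peMr ?nm_ge0// -(rmorph_int (real_complex R)) nm_real.
apply: le_trans (ler_norm _); by rewrite (ler_int _ 1).
Qed.

(* With t = gcd(c, N) and e = N / t, the row (e c, e d) / sqrt e completes to an
   element of the group: e is prime to c because N is square-free. *)
Lemma raise_imaginary z : uhp z -> exists2 g, G g &
  (5 * N%:R)^-1 <= complex.Im (mobius g z).
Proof.
move=> hz; have y0 : 0 < complex.Im z := hz.
have [c [d [cop h]]] := coprime_short_vector hz.
have N0 := squarefree_gt0 sfN.
pose t := gcdn `|c| N; have [e NE] : exists e, N = (e * t)%N by apply/dvdnP; exact: dvdn_gcdr.
have e0 : (0 < e)%N by move: N0; rewrite NE muln_gt0 => /andP[].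
(* The gcd of e and c divides e, and it divides t because it divides both c and N; hence its square
   divides e t = N. *)
have ec : coprime e `|c|.
  apply/eqP; apply: sfN; rewrite expnS expn1 NE; apply: dvdn_mul.
    exact: dvdn_gcdl.
  rewrite dvdn_gcd dvdn_gcdr NE; apply: dvdn_trans (dvdn_gcdl _ _) _.
  exact: dvdn_mulr.
have cop2 : coprimez (e%:Z * d) c.
  rewrite /coprimez /gcdz abszM absz_nat; apply/eqP; congr Posz; apply/eqP.
  rewrite -/(coprime _ _) coprimeMl ec coprime_sym; exact: cop.
have [[u v] uv] := coprimezP _ _ cop2; rewrite /= in uv.
have det : (e%:Z * u) * (e%:Z * d) - (- v) * (e%:Z * c) = e%:Z.
  have -> : (e%:Z * u) * (e%:Z * d) - (- v) * (e%:Z * c) =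
    e%:Z * (u * (e%:Z * d) + v * c) by ring.
  by rewrite uv mulr1.
have Gg : G (gmat R e (e%:Z * u) (- v) (e%:Z * c) (e%:Z * d)).
  apply: gmat_Gamma => //; [|exact: dvdz_mulr|exact: dvdz_mulr|].
    by rewrite NE dvdn_mulr.
  by rewrite dvdzE abszM !absz_nat NE; apply: dvdn_mul => //; exact: dvdn_gcdl.
exists (gmat R e (e%:Z * u) (- v) (e%:Z * c) (e%:Z * d)) => //.
have hg := gmat_unimodular R e0 det.
rewrite Im_mobius//; have c0 := cocycle_neq0 hg hz.
have [_ _ h3 h4] := gmatE R e (e%:Z * u) (- v) (e%:Z * c) (e%:Z * d).
have s0 : 0 < Num.sqrt e%:R :> R by rewrite sqrtr_gt0 ltr0n.
have s2 : Num.sqrt e%:R ^+ 2 = e%:R :> R by rewrite sqr_sqrtr.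
have cE : nm (cocycle (gmat R e (e%:Z * u) (- v) (e%:Z * c) (e%:Z * d)) z) ^+ 2 =
  e%:R * nm (c%:~R * z + d%:~R) ^+ 2.
  have sC (x : int) : ((e%:Z * x)%:~R / Num.sqrt e%:R : R)%:C = (Num.sqrt e%:R)%:C * x%:~R :> C.
    rewrite intrM -pmulrn -{1}s2.
    have -> : Num.sqrt e%:R ^+ 2 * x%:~R / Num.sqrt e%:R = Num.sqrt e%:R * x%:~R :> R.
      by rewrite expr2 mulrAC mulfK ?gt_eqF.
    by rewrite rmorphM rmorph_int.
  rewrite /cocycle h3 h4 !sC -mulrA -mulrDr nmM exprMn nm_real.
  by rewrite real_normK ?num_real// s2.
rewrite ler_pdivlMr ?exprn_gt0 ?nm_gt0// cE.
have eN : e%:R <= N%:R :> R by rewrite ler_nat dvdn_leq// NE dvdn_mulr.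
have NR : 0 < N%:R :> R by rewrite ltr0n.
rewrite mulrC ler_pdivrMr ?mulr_gt0//.
apply: le_trans (ler_pM _ _ eN h) _; rewrite ?sqr_ge0//.
by rewrite mulrCA [leRHS]mulrC mulrA.
Qed.

(** Not a fundamental domain, only a set that meets every orbit; it is compact once cut off above.
    The height is the one supplied by [raise_imaginary]. *)
Definition fundamental_strip : set C :=
  [set z | 0 <= complex.Re z <= 1 /\ (5 * N%:R)^-1 <= complex.Im z].

Lemma strip_uhp z : fundamental_strip z -> uhp z.
Proof.
move=> [_ h]; rewrite uhpE; apply: lt_le_trans h.
by rewrite invr_gt0 mulr_gt0// ltr0n squarefree_gt0.
Qed.

Lemma reduce_to_strip z : uhp z ->
  exists2 w, fundamental_strip w & equivalent N z w.
Proof.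
move=> hz; have [g Gg h] := raise_imaginary hz.
have hg := Gamma_unimodular sfN Gg; have hgz := mobius_uhp hg hz.
pose n := Num.floor (complex.Re (mobius g z)).
exists (mobius (translation R (- n)) (mobius g z)).
  rewrite mobius_translation /fundamental_strip /= cReD cImD.
  have [-> ->] : complex.Re ((- n)%:~R : C) = (- n)%:~R /\ complex.Im ((- n)%:~R : C) = 0.
    by rewrite -(rmorph_int (real_complex R)).
  rewrite addr0; split => //; rewrite intrN subr_ge0 ge_floor/=.
  by rewrite lerBlDl -[X in _ <= _ + X]/(1%:~R) -intrD ltW// floorD1_gt.
apply: (equivalent_trans sfN hz); first by exists g; [exact: Gg|].
exists (translation R (- n)) => //; exact: Gamma_translation.
Qed.

End Discontinuity.

(** * The expansion at the cusp *)

Section Nome.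
Variable R : realType.
Local Notation C := (Cplx R).
Implicit Types z w : C.

(** The number 2 pi i, so that [nome z] is exp(tau z). *)
Definition tau : C := 0 +i* (2 * pi).

Lemma tau_neq0 : tau != 0.
Proof. by rewrite eq_complex /= negb_and orbC mulf_neq0 ?pnatr_eq0// gt_eqF// pi_gt0. Qed.

Lemma nomeD z w : nome (z + w) = nome z * nome w.
Proof.
rewrite /nome cReD cImD mulrACA -rmorphM -expRD; congr (_ * _).
  by congr (_%:C); congr expR; ring.
have -> (a b c d : R) : (a +i* b : C) * (c +i* d) = (a * c - b * d) +i* (a * d + b * c) by [].
by rewrite mulrDr cosD sinD; congr (_ +i* _); ring.
Qed.

Lemma nm_nome z : nm (nome z) = expR (- (2 * pi * complex.Im z)).
Proof.
rewrite nmM nm_real ger0_norm ?expR_ge0// -[RHS]mulr1; congr (_ * _).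
by rewrite nm_sqrt /= cos2Dsin2 sqrtr1.
Qed.

Lemma nome_neq0 z : nome z != 0.
Proof. by rewrite -nm_gt0 nm_nome expR_gt0. Qed.

Lemma nome0 : nome 0 = 1 :> C.
Proof. by rewrite /nome /= mulr0 oppr0 expR0 cos0 sin0 mul1r. Qed.

Lemma pi2_ge1 : 1 <= 2 * pi :> R.
Proof. have := pi_ge2 R; lra. Qed.

Lemma nm_nome_lt1 z : uhp z -> nm (nome z) < 1.
Proof.
move=> hz; have y0 : 0 < complex.Im z := hz.
by rewrite nm_nome -expR0 ltr_expR oppr_lt0 !mulr_gt0// pi_gt0.
Qed.

Lemma nome_small (d : R) : 0 < d -> exists2 Y : R, 0 < Y &
  forall z, Y < complex.Im z -> nm (nome z) < d.
Proof.
move=> d0; exists d^-1; first by rewrite invr_gt0.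
move=> z hz; have y0 : 0 < complex.Im z by apply: lt_trans hz; rewrite invr_gt0.
rewrite nm_nome expRN -[d]invrK ltf_pV2 ?posrE ?invr_gt0 ?expR_gt0//.
apply: lt_le_trans hz _.
have h := expR_ge1Dx (2 * pi * complex.Im z).
have : complex.Im z <= 2 * pi * complex.Im z by rewrite ler_peMl ?pi2_ge1// ltW.
lra.
Qed.

Lemma nome_real (r : R) : 0 < r < 1 -> exists2 z, uhp z & nome z = r%:C.
Proof.
move=> /andP[r0 r1]; exists (0 +i* (- ln r / (2 * pi))).
  by rewrite uhpE /= divr_gt0 ?mulr_gt0 ?pi_gt0// oppr_gt0 ln_lt0// r0.
have pi0 : 2 * pi != 0 :> R by rewrite mulf_neq0// gt_eqF// pi_gt0.
rewrite /nome /= mulr0 cos0 sin0.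
have -> : 2 * pi * (- ln r / (2 * pi)) = - ln r by rewrite mulrC divfK.
by rewrite opprK lnK ?posrE// mulr1.
Qed.

Lemma real_derive_nm (f : R -> R) (a l : R) : is_derive a 1 f l ->
  forall e : R, 0 < e -> exists2 d : R, 0 < d &
    forall x, `|x - a| < d -> `|f x - f a - l * (x - a)| <= e * `|x - a|.
Proof.
move=> [h <-] e e0; have {h} /cvgrPdist_lt/(_ e e0) := h.
rewrite near_withinE => /nbhs_ballP[d /= d0 hd]; exists d => // x xd.
have [->|xa] := eqVneq x a; first by rewrite !subrr mulr0 subrr normr0 mulr0.
have xa' : x - a != 0 by rewrite subr_eq0.
have := hd (x - a); rewrite /ball /= sub0r normrN => /(_ xd xa').
rewrite /GRing.scale /= mulr1 subrK => /ltW hh.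
have -> : f x - f a - 'D_1 f a * (x - a) =
   - ('D_1 f a - (x - a)^-1 * (f x - f a)) * (x - a).
  by field.
rewrite normrM normrN ler_wpM2r//.
Qed.

(** First-order expansions of [expR], [cos] and [sin] at 0 are combined in real and imaginary parts.
    The derivative elsewhere then follows from [nomeD]. *)
Lemma nome_derive0 : is_derive (0 : C) (1 : C) (@nome R) tau.
Proof.
have pi0 : 0 < 2 * pi :> R by rewrite mulr_gt0 ?pi_gt0.
apply/is_derive_nmP => e e0.
(* The errors below add up to 6 units of e1 (2 pi |w|), which the factor 8 covers. *)
pose K : R := 2 * pi * 8; have K0 : 0 < K by rewrite mulr_gt0.
pose e1 := Num.min 1 (e / K).
have e10 : 0 < e1 by rewrite lt_min ltr01 divr_gt0.
have e1K : e1 * K <= e by rewrite -ler_pdivlMr// ge_min lexx orbT.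
have e11 : e1 <= 1 by rewrite ge_min lexx.
have [d1 d10 h1] := real_derive_nm (is_derive_expR 0) e10.
have [d2 d20 h2] := real_derive_nm (is_derive_cos 0) e10.
have [d3 d30 h3] := real_derive_nm (is_derive_sin 0) e10.
pose d := Num.min e1 (Num.min d1 (Num.min d2 d3)) / (2 * pi) / 2.
exists d.
  by apply: divr_gt0 => //; apply: divr_gt0 => //; rewrite lt_min e10 /= lt_min d10 /= lt_min d20.
move=> w; rewrite subr0 => wd.
pose x := - (2 * pi * complex.Im w); pose y := 2 * pi * complex.Re w.
have nw := nm_ge0 w.
have xw : `|x| <= 2 * pi * nm w.
  by rewrite normrN normrM (gtr0_norm pi0) ler_pM2l// ler_Im_nm.
have yw : `|y| <= 2 * pi * nm w.
  by rewrite normrM (gtr0_norm pi0) ler_pM2l// ler_Re_nm.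
have small : 2 * pi * nm w < Num.min e1 (Num.min d1 (Num.min d2 d3)) / 2.
  by rewrite mulrC -ltr_pdivlMr// mulrAC.
have {small} small : [/\ 2 * pi * nm w < e1 / 2, 2 * pi * nm w < d1, 2 * pi * nm w < d2 & 2 * pi * nm w < d3].
  have m0 : 0 < Num.min e1 (Num.min d1 (Num.min d2 d3)) by rewrite lt_min e10 /= lt_min d10 /= lt_min d20.
  have lt2 u : Num.min e1 (Num.min d1 (Num.min d2 d3)) <= u -> 2 * pi * nm w < u by lra.
  split; [|apply: lt2..]; rewrite ?ge_min ?lexx ?orbT//.
  apply: lt_le_trans small _; rewrite ler_pM2r ?invr_gt0// ge_min lexx //.
case: small => s0 s1 s2 s3.
have {h1} := h1 x; rewrite subr0 expR0 mul1r => /(_ (le_lt_trans xw s1)) h1.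
have {h2} := h2 y; rewrite subr0 cos0 sin0 oppr0 mul0r subr0 => /(_ (le_lt_trans yw s2)) h2.
have {h3} := h3 y; rewrite subr0 sin0 cos0 mul1r subr0 => /(_ (le_lt_trans yw s3)) h3.
have E1 : `|expR x - 1| <= e1.
  have -> : expR x - 1 = (expR x - 1 - x) + x by ring.
  apply: le_trans (ler_normD _ _) _.
  have : e1 * `|x| <= `|x| by rewrite ler_piMl.
  lra.
have E2 : `|expR x| <= 2.
  have -> : expR x = (expR x - 1) + 1 by ring.
  by apply: le_trans (ler_normD _ _) _; rewrite normr1; lra.
rewrite nome0; apply: le_trans (ler_nm_ReIm _) _.
have -> : complex.Re (nome w - 1 - tau * w) = (expR x - 1 - x) + expR x * (cos y - 1).
  by rewrite !Re_sub !cReM /= -/x -/y /x; ring.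
have -> : complex.Im (nome w - 1 - tau * w) = expR x * (sin y - y) + (expR x - 1) * y.
  by rewrite !Im_sub !cImM /= -/x -/y /y; ring.
have b1 := ler_normD (expR x - 1 - x) (expR x * (cos y - 1)).
have b2 := ler_normD (expR x * (sin y - y)) ((expR x - 1) * y).
have b3 : `|expR x * (cos y - 1)| <= 2 * (e1 * `|y|).
  by rewrite normrM; apply: ler_pM.
have b4 : `|expR x * (sin y - y)| <= 2 * (e1 * `|y|).
  by rewrite normrM; apply: ler_pM.
have b5 : `|(expR x - 1) * y| <= e1 * `|y| by rewrite normrM ler_wpM2r.
have b6 : e1 * `|x| <= e1 * (2 * pi * nm w) by rewrite ler_pM2l.
have b7 : e1 * `|y| <= e1 * (2 * pi * nm w) by rewrite ler_pM2l.
have b8 : 8 * (e1 * (2 * pi * nm w)) <= e * nm w.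
  have -> : 8 * (e1 * (2 * pi * nm w)) = (e1 * K) * nm w by rewrite /K; ring.
  exact: ler_wpM2r.
have b9 : 0 <= e1 * (2 * pi * nm w) := mulr_ge0 (ltW e10) (mulr_ge0 (ltW pi0) nw).
lra.
Qed.

Lemma nome_derive z : is_derive z (1 : C) (@nome R) (tau * nome z).
Proof.
rewrite (_ : @nome R = (fun w => nome z * nome (w - z))); last first.
  by apply/funext => w; rewrite -nomeD addrC subrK.
rewrite /= subrr nome0 mulr1 [tau * _]mulrC; apply: cderivMl.
have hz := cderivB (cderiv_id z) (cderiv_cst z z).
rewrite subr0 in hz.
have := @is_derive1_chain _ (@nome R) (fun w => w - z) z tau 1 hz.
by rewrite subrr mulr1 => /(_ nome_derive0).
Qed.

Lemma nome_int (n : int) : nome (n%:~R) = 1 :> C.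
Proof.
have n1 : nome 1 = 1 :> C.
  rewrite /nome /= mulr0 oppr0 expR0 mul1r mulr1.
  by rewrite mulr_natl -[pi *+ 2]add0r cosD2pi sinD2pi cos0 sin0.
have nn (k : nat) : nome k%:R = 1 :> C.
  by elim: k => [|k IH]; [exact: nome0|rewrite -natr1 nomeD IH n1 mulr1].
case: n => k; first exact: nn.
have := nomeD (Negz k)%:~R k.+1%:R.
rewrite nn mulr1 => <-; rewrite NegzE intrN addNr; exact: nome0.
Qed.

(** After subtracting a floor the difference s satisfies 0 <= Re s < 1. The modulus of [nome s]
    gives Im s = 0, and cos (2 pi s) = 1 gives sin (pi s) = 0, whereas the sine is positive on the
    open interval from 0 to pi. *)
Lemma nome_eq z w : nome z = nome w -> exists n : int, w = z + n%:~R.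
Proof.
move=> e; pose t := w - z.
have nt : nome t = 1 by apply: (mulIf (nome_neq0 z)); rewrite -nomeD subrK mul1r.
pose n := Num.floor (complex.Re t); exists n.
pose s := t - n%:~R; suff s0 : s = 0.
  by move/eqP: s0; rewrite subr_eq0 /t subr_eq addrC => /eqP.
have ns : nome s = 1.
  by have := nomeD s n%:~R; rewrite nome_int mulr1 /s subrK nt => <-.
have i0 : complex.Im s = 0.
  have := nm_nome s; rewrite ns nm1 -expR0 => /expR_inj/esym/eqP.
  by rewrite oppr_eq0 mulf_eq0 gt_eqF ?mulr_gt0 ?pi_gt0//= => /eqP.
have [r0 r1] : 0 <= complex.Re s /\ complex.Re s < 1.
  have rn : complex.Re (n%:~R : C) = n%:~R by rewrite -(rmorph_int (real_complex R)).
  rewrite /s Re_sub rn; split; first by rewrite subr_ge0 ge_floor.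
  by rewrite ltrBlDl -[X in _ < _ + X]/(1%:~R) -intrD floorD1_gt.
move: ns => /(congr1 (@complex.Re R)); rewrite /nome i0 mulr0 oppr0 expR0 mul1r /=.
have -> : 2 * pi * complex.Re s = (pi * complex.Re s) *+ 2 by rewrite -mulr_natl; ring.
rewrite cos_mulr2n => hc.
have sn : sin (pi * complex.Re s) = 0.
  have := cos2Dsin2 (pi * complex.Re s).
  move=> h; apply/eqP; rewrite -sqrf_eq0; apply/eqP; move: hc h.
  by rewrite -mulr_natl; lra.
have rs : complex.Re s = 0.
  apply/eqP; rewrite eq_le r0 andbT leNgt; apply/negP => rp.
  have := @sin_gt0_pi R (pi * complex.Re s); rewrite sn ltxx => H.
  by apply: notF; apply: H; rewrite mulr_gt0 ?pi_gt0//= gtr_pMr// pi_gt0.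
by apply/eqP; rewrite eq_complex rs i0 !eqxx.
Qed.

End Nome.

(** * Laurent expansions with a simple pole at the origin *)

Section Laurent.
Variable R : realType.
Local Notation C := (Cplx R).
Implicit Types (q z : C) (c : nat -> C).

Lemma cvg_seq_nm_bounded (u : nat -> C) (l : C) : u @ \oo --> l ->
  exists M : R, forall n, nm (u n) <= M.
Proof.
move=> /(@cvg_nmP R nat \oo _ u l) /(_ 1 ltr01) [n0 _ hn0].
exists (nm l + 1 + \sum_(i < n0) nm (u i)) => n.
have s0 : 0 <= \sum_(i < n0) nm (u i) by apply: sumr_ge0 => i _; exact: nm_ge0.
have [lt|ge] := ltnP n n0.
  rewrite (bigD1 (Ordinal lt))//= addrCA lerDl addr_ge0//.
    by rewrite addr_ge0 ?nm_ge0.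
  by apply: sumr_ge0 => i _; exact: nm_ge0.
have := hn0 n ge => /= h; have := ler_nm_dist (u n) l; lra.
Qed.

Lemma series_pscoef c : (forall r : R, 0 < r < 1 -> exists l : C,
    series (fun n => c n * r%:C ^+ n) @ \oo --> l) -> pscoef c.
Proof.
move=> h rho /andP[r0 r1]; have [->|rn0] := eqVneq rho 0.
  exists (nm (c 0%N)) => n; rewrite expr0n; case: n => [|n] /=; first by rewrite mulr1.
  by rewrite mulr0 nm_ge0.
have [|l hl] := h rho; first by rewrite lt_neqAle eq_sym rn0 r0.
have hs := cvg_series_cvg_0 (cvgP _ hl).
have [M hM] := cvg_seq_nm_bounded hs; exists M => n.
by have := hM n; rewrite nmM nmX nm_real ger0_norm.
Qed.

Lemma pscoef_unshift c : pscoef (fun n => c n.+1) -> pscoef c.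
Proof.
move=> h rho /andP[r0 r1]; have [|M hM] := h rho; first by rewrite r0.
have M0 : 0 <= M by apply: le_trans (hM 0%N); rewrite mulr_ge0 ?nm_ge0 ?exprn_ge0.
exists (nm (c 0%N) + M); case=> [|n].
  by rewrite expr0 mulr1 lerDl.
rewrite exprS mulrCA; apply: (@le_trans _ _ M); last by rewrite lerDr nm_ge0.
apply: le_trans (hM n); apply: ler_piMl; last exact: ltW.
by rewrite mulr_ge0 ?nm_ge0 ?exprn_ge0.
Qed.

Variable c : nat -> C.
Hypothesis hc : pscoef c.

(** Coefficients of the k-th derivative of [ps c]. *)
Definition dc (k : nat) : nat -> C := iter k (@dcoef R) c.

Lemma pscoef_dc k : pscoef (dc k).
Proof. by elim: k => [|k IH] //=; exact: pscoef_dcoef. Qed.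

(** This is j as a function of q; [laurent1], [laurent2] and [laurent3] are its successive
    derivatives in q. *)
Definition laurent q : C := q^-1 + ps c q.
Definition laurent1 q : C := - q ^- 2 + ps (dc 1) q.
Definition laurent2 q : C := 2 * q ^- 3 + ps (dc 2) q.
Definition laurent3 q : C := - (6 * q ^- 4) + ps (dc 3) q.

Lemma cderiv_invX (n : nat) q : q != 0 ->
  is_derive q (1 : C) (fun w => w ^- n) (- (n%:R * q ^- n.+1)).
Proof.
move=> q0; apply: (is_derive_cast (cderivV _ (cderivX n (cderiv_id q)))).
  by rewrite expf_neq0.
case: n => [|n] /=; first by rewrite !mul0r oppr0 mul0r.
by rewrite !exprS; field; rewrite q0 expf_neq0.
Qed.

Lemma is_derive_laurent q : q != 0 -> nm q < 1 ->
  is_derive q (1 : C) laurent (laurent1 q).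
Proof.
move=> q0 q1; have := cderivD (cderivV q0 (cderiv_id q)) (ps_is_derive hc q1).
by move=> H; apply: (is_derive_cast H); rewrite /laurent1 mulN1r.
Qed.

Lemma is_derive_laurent1 q : q != 0 -> nm q < 1 ->
  is_derive q (1 : C) laurent1 (laurent2 q).
Proof.
move=> q0 q1; have := cderivD (cderivMl (-1) (cderiv_invX 2 q0)) (ps_is_derive (pscoef_dc 1) q1).
rewrite (_ : (fun w => _ + _) = laurent1); last by apply/funext => w; rewrite mulN1r.
by move=> H; apply: (is_derive_cast H); rewrite /laurent2 mulN1r opprK.
Qed.

Lemma is_derive_laurent2 q : q != 0 -> nm q < 1 ->
  is_derive q (1 : C) laurent2 (laurent3 q).
Proof.
move=> q0 q1; have := cderivD (cderivMl 2 (cderiv_invX 3 q0)) (ps_is_derive (pscoef_dc 2) q1).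
by move=> H; apply: (is_derive_cast H); rewrite /laurent3; congr (_ + _); ring.
Qed.

(** Multiplication by q removes the pole: q (laurent q - laurent q0) is the power series [F], whose
    constant term is 1. It is therefore not identically zero, and [ps_finite_order] applies. *)
Lemma laurent_factor q0 : q0 != 0 -> nm q0 < 1 -> exists m b,
  [/\ (0 < m)%N, pscoef b, ps b q0 != 0 &
  forall q, q != 0 -> nm q < 1 ->
    laurent q - laurent q0 = (q - q0) ^+ m * (ps b q / q)].
Proof.
move=> q00 q01; pose J0 := laurent q0.
pose d n : C := if n is 0 then c 0%N - J0 else c n.
pose F n : C := if n is n'.+1 then d n' else 1.
have hd : pscoef d := @pscoef_unshift d (pscoef_shift hc).
have hF : pscoef F := @pscoef_unshift F hd.
have dE q : nm q < 1 -> ps d q = ps c q - J0.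
  by move=> q1; rewrite ps_shift// [ps c q]ps_shift//=; ring.
have FE q : nm q < 1 -> ps F q = 1 + q * (ps c q - J0).
  by move=> q1; rewrite ps_shift//= dE.
have LE q : q != 0 -> nm q < 1 -> laurent q - J0 = ps F q / q.
  by move=> qn0 q1; rewrite FE// /laurent; field.
have [m [b [hb b0 bE]]] := @ps_finite_order _ F q0 hF (oner_neq0 _) q01.
exists m, b; split => //.
  rewrite lt0n; apply/eqP => m0; have := bE q0 q01; rewrite m0 mul1r => e.
  move: b0; rewrite -e; have /esym := LE q0 q00 q01; rewrite subrr => /eqP.
  by rewrite mulf_eq0 invr_eq0 (negbTE q00) orbF => ->.
by move=> q qn0 q1; rewrite LE// bE// mulrA.
Qed.

Lemma laurent_has_order q0 : q0 != 0 -> nm q0 < 1 ->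
  exists m l, has_order laurent q0 m l.
Proof.
move=> q00 q01; have [m [b [m0 hb b0 bE]]] := laurent_factor q00 q01.
exists m, (ps b q0 / q0); split => //; first by rewrite mulf_neq0// invr_eq0.
have h : (fun q => ps b q / q) @ q0^' --> ps b q0 / q0.
  apply: cvgM; last by apply: cvgV => //; apply: cvg_within.
  apply: cvg_within_filter; exact: ps_continuous.
apply: cvg_trans h; apply: near_eq_cvg.
apply/near_dnmP; exists (Num.min (nm q0) (1 - nm q0)).
  by rewrite lt_min nm_gt0 q00 subr_gt0.
move=> q qq0; rewrite lt_min => /andP[h1 h2].
have qn0 : q != 0.
  by apply/eqP => q_0; move: h1; rewrite q_0 sub0r nmN ltxx.
have q1 : nm q < 1.
  by rewrite -[q](subrK q0); apply: le_lt_trans (ler_nmD _ _) _; lra.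
by rewrite bE// [RHS]mulrAC divff ?mul1r// expf_neq0// subr_eq0.
Qed.

End Laurent.

Section OrderComp.
Variable R : realType.
Local Notation C := (Cplx R).

Lemma cvg_pow (T : Type) (F : set_system T) (FF : Filter F) (u : T -> C) (l : C) n :
  u @ F --> l -> (fun x => u x ^+ n) @ F --> l ^+ n.
Proof.
move=> ul; elim: n => [|n IH]; first by rewrite expr0; exact: cvg_cst.
rewrite exprS (_ : (fun x => u x ^+ n.+1) = (fun x => u x * u x ^+ n)); last first.
  by apply/funext => x; rewrite exprS.
exact: cvgM.
Qed.

(** A nonzero derivative keeps g away from g a near a, so limits over punctured neighbourhoods can
    be composed with g. *)
Lemma cvg_dnbhs_deriv (g : C -> C) (a l : C) : is_derive a (1 : C) g l -> l != 0 ->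
  g @ a^' --> (g a)^' /\ \forall w \near a^', g w != g a.
Proof.
move=> hg l0; have [_ _ hg1] := is_derive_has_order hg l0.
have gne : \forall w \near a^', g w != g a.
  have /cvg_nmP/(_ (nm l)) := hg1; rewrite nm_gt0 => /(_ l0).
  apply: filterS => w h; apply/eqP => e; move: h.
  by rewrite e subrr mul0r sub0r nmN ltxx.
split; last exact: gne.
move=> A /near_dnmP[e e0 he]; have hga := is_derive_continuous hg.
have h1 : \forall w \near a^', nm (g w - g a) < e.
  by move/cvg_nmP: hga => /(_ e e0); exact: cvg_within.
by apply: filterS2 gne h1 => w h2 h3; exact: he.
Qed.

Lemma has_order_comp (F g : C -> C) (a l k : C) m : has_order F (g a) m k ->
  is_derive a (1 : C) g l -> l != 0 -> has_order (F \o g) a m (k * l ^+ m).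
Proof.
move=> [m0 k0 hF] hg l0; split; [exact: m0|by rewrite mulf_neq0// expf_neq0|].
have [_ _ hg1] := is_derive_has_order hg l0; have [gc gne] := cvg_dnbhs_deriv hg l0.
have h1 := cvg_comp _ _ gc hF.
have h2 : (fun w => ((g w - g a) / (w - a) ^+ 1) ^+ m) @ a^' --> l ^+ m.
  by apply: cvg_pow; exact: hg1.
apply: cvg_trans (cvgM h1 h2); apply: near_eq_cvg.
have wa : \forall w \near a^', w != a by apply/near_dnmP; exists 1.
apply: filterS2 gne wa => w w1 w2.
have E : (F (g w) - F (g a)) / (g w - g a) ^+ m * ((g w - g a) / (w - a)) ^+ m =
  (F (g w) - F (g a)) / (w - a) ^+ m.
  by rewrite expr_div_n mulrA divfK// expf_neq0// subr_eq0.
exact: E.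
Qed.

End OrderComp.

Section CuspExpansion.
Variable R : realType.
Local Notation C := (Cplx R).
Implicit Types (q z w : C).
Variables (c : nat -> C) (j : C -> C).
Hypothesis hc : pscoef c.
Hypothesis jE : forall z, uhp z -> j z = laurent c (nome z).

Lemma ps_bounded b (r : R) : pscoef b -> r < 1 ->
  exists2 K : R, 0 <= K & forall q, nm q <= r -> nm (ps b q) <= K.
Proof.
move=> hb r1; have [r0|r0] := ltP r 0.
  by exists 0 => // q qr; have := nm_ge0 q; lra.
have /andP[h1 h2] := mid_lt1 r1; set rho := (1 + r) / 2 in h1 h2.
have rho0 : 0 < rho by exact: le_lt_trans h1.
have [|M hM] := hb rho; first by rewrite h2 ltW.
have M0 : 0 <= M by apply: le_trans (hM 0%N); rewrite mulr_ge0 ?nm_ge0// exprn_ge0// ltW.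
have d0 : 0 < 1 - r / rho by rewrite subr_gt0 ltr_pdivrMr// mul1r.
exists (M / (1 - r / rho)); first by rewrite divr_ge0// ltW.
move=> q qr; have [|_ h] := @ps_dominated R b q rho M _ hM; first exact: le_lt_trans h1.
apply: (le_trans h); apply: ler_wpM2l => //.
have qrr : nm q / rho <= r / rho by rewrite ler_pM2r ?invr_gt0.
by rewrite lef_pV2 ?posrE//; lra.
Qed.

(** The derivatives of j in z as closed formulas in q, from d/dz = tau q d/dq. *)
Definition j1 z : C := tau R * (nome z * laurent1 c (nome z)).
Definition j2 z : C := tau R ^+ 2 * (nome z * laurent1 c (nome z) +
  nome z ^+ 2 * laurent2 c (nome z)).
Definition j3 z : C := tau R ^+ 3 * (nome z * laurent1 c (nome z) +
  3 * (nome z ^+ 2 * laurent2 c (nome z)) + nome z ^+ 3 * laurent3 c (nome z)).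

Lemma near_uhp_deriv (f g : C -> C) z l : uhp z ->
  (forall w, uhp w -> f w = g w) -> is_derive z (1 : C) g l -> is_derive z (1 : C) f l.
Proof.
move=> hz fg; apply: cderiv_near.
by apply: filterS (open_uhp hz) => w hw; rewrite fg.
Qed.

Lemma laurent_comp z (f f' : C -> C) : uhp z ->
  (forall q, q != 0 -> nm q < 1 -> is_derive q (1 : C) f (f' q)) ->
  is_derive z (1 : C) (fun w => f (nome w)) (f' (nome z) * (tau R * nome z)).
Proof.
move=> hz hf; apply: (is_derive1_chain (nome_derive z)).
by apply: hf; [exact: nome_neq0|exact: nm_nome_lt1].
Qed.

Lemma is_derive_j z : uhp z -> is_derive z (1 : C) j (j1 z).
Proof.
move=> hz; apply: (near_uhp_deriv hz jE).
apply: (is_derive_cast (laurent_comp hz (is_derive_laurent hc))).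
by rewrite /j1; ring.
Qed.

Lemma is_derive_j1 z : uhp z -> is_derive z (1 : C) j1 (j2 z).
Proof.
move=> hz; have h1 := laurent_comp hz (is_derive_laurent1 hc).
apply: (is_derive_cast (cderivMl (tau R) (cderivM (nome_derive z) h1))).
by rewrite /j2; ring.
Qed.

Lemma is_derive_j2 z : uhp z -> is_derive z (1 : C) j2 (j3 z).
Proof.
move=> hz; have h1 := laurent_comp hz (is_derive_laurent1 hc).
have h2 := laurent_comp hz (is_derive_laurent2 hc).
have hn := nome_derive z.
apply: (is_derive_cast (cderivMl (tau R ^+ 2) (cderivD (cderivM hn h1)
  (cderivM (cderivX 2 hn) h2)))).
by rewrite /j3 /=; ring.
Qed.

Lemma j_has_order z : uhp z -> exists m l, has_order j z m l.
Proof.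
move=> hz; have [m [l ho]] := laurent_has_order hc (nome_neq0 z) (nm_nome_lt1 hz).
have t0 : tau R * nome z != 0 by rewrite mulf_neq0 ?nome_neq0 ?tau_neq0.
have [m0 k0 hk] := has_order_comp ho (nome_derive z) t0.
exists m, (l * (tau R * nome z) ^+ m); split; [exact: m0|exact: k0|].
apply: cvg_trans hk; apply: near_eq_cvg; apply: cvg_within.
by apply: filterS (open_uhp hz) => w hw /=; rewrite !jE.
Qed.

Lemma near_j_has_order z : uhp z -> \forall w \near z, exists m l, has_order j w m l.
Proof. by move=> hz; apply: filterS (open_uhp hz) => w; exact: j_has_order. Qed.

Lemma derive0_order_gt1 (f : C -> C) z m l : is_derive z (1 : C) f 0 ->
  has_order f z m l -> (1 < m)%N.
Proof.
move=> hd ho; have [m0 l0 _] := ho; rewrite ltn_neqAle m0 andbT; apply/eqP => m1.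
have : is_derive z (1 : C) f l.
  apply/is_derive_nmP => e e0; have [d d0 h] := has_order_nm ho e0; exists d => // w /h.
  by rewrite -m1 !expr1.
by move=> /(cderiv_unique hd) e; move: l0; rewrite -e eqxx.
Qed.

Lemma j_cusp (B : R) : exists2 Y : R, 0 < Y &
  forall z, Y < complex.Im z -> B < nm (j z).
Proof.
have [|K K0 hK] := ps_bounded hc (r := 1 / 2); first by lra.
have B0 : 0 < K + `|B| + 1 by rewrite ltr_wpDl// addr_ge0.
have [|Y Y0 hY] := @nome_small R (Num.min (1 / 2) (K + `|B| + 1)^-1).
  by rewrite lt_min invr_gt0 B0 divr_gt0.
exists Y => // z hz; have := hY z hz; rewrite lt_min => /andP[h1 h2].
have uz : uhp z by rewrite uhpE; exact: lt_trans hz.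
rewrite jE// /laurent; have q0 := nome_neq0 z.
have h3 : K + `|B| + 1 < nm (nome z)^-1.
  by rewrite nmV -[ltLHS]invrK ltf_pV2 ?posrE ?invr_gt0 ?nm_gt0.
have h4 := ler_nm_dist (nome z)^-1 (- ps c (nome z)).
rewrite nmN opprK in h4; have h5 := hK _ (ltW h1); have := ler_norm B; lra.
Qed.

Lemma j1_cusp : exists2 Y : R, 0 < Y & forall z, Y < complex.Im z -> j1 z != 0.
Proof.
have [|K K0 hK] := ps_bounded (pscoef_dc hc 1) (r := 1 / 2); first by lra.
have K1 : 0 < K + 1 by rewrite ltr_wpDl.
have [|Y Y0 hY] := @nome_small R (Num.min (1 / 2) (K + 1)^-1).
  by rewrite lt_min invr_gt0 K1 divr_gt0.
exists Y => // z hz; have := hY z hz; rewrite lt_min => /andP[h1 h2].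
have q0 := nome_neq0 z; rewrite mulf_neq0 ?tau_neq0// mulf_neq0//.
apply/eqP => e; have : nome z ^+ 2 * ps (dc c 1) (nome z) = 1.
  move/eqP: e; rewrite /laurent1 addrC subr_eq0 => /eqP ->.
  by rewrite divff// expf_neq0.
move/(congr1 (@nm R)); rewrite nm1 nmM nmX => e1.
have h3 : nm (ps (dc c 1) (nome z)) <= K by apply: hK; exact: ltW.
have h4 : nm (nome z) * (K + 1) < 1.
  by rewrite -ltr_pdivlMr// mul1r.
have n0 := nm_ge0 (nome z); have p0 := nm_ge0 (ps (dc c 1) (nome z)).
have : nm (nome z) * nm (ps (dc c 1) (nome z)) <= nm (nome z) * K by rewrite ler_wpM2l.
move: e1; rewrite expr2 -mulrA.
by move: (nm (nome z) * nm (ps _ _)) => X e1 hX; nra.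
Qed.

Lemma laurent_eq_diff q q' : laurent c q = laurent c q' ->
  ps c q - ps c q' = q'^-1 - q^-1.
Proof.
move=> e; have -> : ps c q = - q^-1 + laurent c q by rewrite /laurent addKr.
by rewrite e /laurent addrA addrK addrC.
Qed.

(** Equal values give q - q' = (ps c q - ps c q') q q'. The power series is Lipschitz with constant
    K + L on a half disc, so for small q and q' the right side is strictly smaller unless q = q'. *)
Lemma j_cusp_injective : exists2 Y : R, 0 < Y & forall z w,
  Y < complex.Im z -> Y < complex.Im w -> j z = j w -> nome z = nome w.
Proof.
have [|K K0 hK] := ps_taylor2 hc (r := 1 / 2); first by lra.
have [|L L0 hL] := ps_bounded (pscoef_dcoef hc) (r := 1 / 2); first by lra.
have K1 : 0 < K + L + 1 by lra.
have [|Y Y0 hY] := @nome_small R (Num.min (1 / 2) (K + L + 1)^-1).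
  by rewrite lt_min invr_gt0 K1 divr_gt0.
exists Y => // z w hz hw.
have uz : uhp z by rewrite uhpE; exact: lt_trans hz.
have uw : uhp w by rewrite uhpE; exact: lt_trans hw.
have := hY z hz; have := hY w hw; rewrite !lt_min => /andP[w1 w2] /andP[z1 z2].
rewrite !jE//; have := nome_neq0 z; have := nome_neq0 w.
move: (nome z) (nome w) w1 w2 z1 z2 => q q' w1 w2 z1 z2 q'0 q0 e.
apply/eqP; rewrite -subr_eq0 -nm_eq0; apply/negPn/negP; rewrite nm_eq0 => d0.
have d0' : 0 < nm (q - q') by rewrite nm_gt0.
have E : q - q' = (ps c q - ps c q') * (q * q').
  rewrite (laurent_eq_diff e).
  by field; rewrite q0 q'0.
have h1 : nm (ps c q - ps c q') <= (K + L) * nm (q - q').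
  rewrite -[ps c q - ps c q'](subrK (ps (dcoef c) q' * (q - q'))).
  apply: le_trans (ler_nmD _ _) _; rewrite mulrDl; apply: lerD.
    apply: le_trans (hK _ _ (ltW z1) (ltW w1)) _.
    apply: ler_wpM2l; first exact: ltW.
    rewrite expr2; apply: ler_piMl; first exact: nm_ge0.
    by apply: le_trans (ler_nmB _ _) _; lra.
  by rewrite nmM; apply: ler_wpM2r; [exact: nm_ge0|apply: hL; exact: ltW].
have h2 : nm (q * q') * (K + L + 1) < 1.
  rewrite nmM -ltr_pdivlMr// mul1r; apply: le_lt_trans z2.
  apply: ler_piMr; [exact: nm_ge0|lra].
have := congr1 (@nm R) E; rewrite nmM => e1.
have h3 : nm (q - q') <= (K + L) * nm (q - q') * nm (q * q').
  by rewrite {1}e1; apply: ler_wpM2r => //; exact: nm_ge0.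
have n0 := nm_ge0 (q * q').
have h4 : (K + L) * nm (q * q') < 1 by move: h2 n0; move: (nm (q * q')) => x; nra.
move: h3; rewrite -mulrA [nm (q - q') * _]mulrC mulrA leNgt => /negP; apply.
by rewrite gtr_pMl.
Qed.

Lemma nm_int_lt1 (n : int) : nm (n%:~R : C) < 1 -> n = 0.
Proof.
rewrite -(rmorph_int (real_complex R)) nm_real -intr_norm.
by rewrite -[1]/(1%:~R) ltr_int; lia.
Qed.

Lemma nm_near_bounds q q0 (r : R) : nm (q - q0) < nm q0 / 2 ->
  nm (q - q0) < r - nm q0 -> nm q <= r /\ nm q0 / 2 <= nm q.
Proof.
have := ler_nm_dist q q0; have := ler_nm_dist q0 q; rewrite (nmBC q0 q).
by move: (nm q) (nm q0) (nm (q - q0)) => x y t *; split; lra.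
Qed.

Lemma nm_near_half (x y : C) : nm (y - x) < nm x / 2 -> nm x / 2 <= nm y.
Proof.
have := ler_nm_dist x y; rewrite (nmBC x y).
by move: (nm x) (nm y) (nm (y - x)) => a b t; clear; lra.
Qed.

(** If the values agree, the linear term L'(q') (q - q') equals minus the Taylor remainder, whence
    |L'(q')| <= K' |q - q'|. Close to q0 this contradicts |L'(q')| >= D / 2. *)
Lemma laurent_locally_injective q0 : q0 != 0 -> nm q0 < 1 -> laurent1 c q0 != 0 ->
  exists2 e : R, 0 < e & forall q q', nm (q - q0) < e -> nm (q' - q0) < e ->
    laurent c q = laurent c q' -> q = q'.
Proof.
move=> q00 q01 l0.
have [D DE] : exists D, D = nm (laurent1 c q0) by eexists.
have D0 : 0 < D by rewrite DE nm_gt0.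
have /andP[r1 r2] := mid_lt1 q01; set r := (1 + nm q0) / 2 in r1 r2.
have nq0 : 0 < nm q0 by rewrite nm_gt0.
have r0 : 0 < r by exact: lt_trans r1.
have [|K K0 hK] := ps_taylor2 hc (r := r); first by rewrite r0.
(* The summand 8 / |q0|^3 bounds 1 / (q q'^2), the remainder coefficient of the pole, since |q| and
   |q'| are at least |q0| / 2. *)
pose K' := K + 8 / nm q0 ^+ 3.
have K'0 : 0 < K' by rewrite addr_gt0// divr_gt0// exprn_gt0.
have /near_nmP[e1 e10 he1] : \forall q \near q0, nm (laurent1 c q - laurent1 c q0) < D / 2.
  have /cvg_nmP := is_derive_continuous (is_derive_laurent1 hc q00 q01).
  by apply; rewrite divr_gt0.
exists (Num.min e1 (Num.min (D / (8 * K')) (Num.min (nm q0 / 2) (r - nm q0)))).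
  by rewrite !lt_min e10 !divr_gt0 ?mulr_gt0//= subr_gt0.
move=> q q'; rewrite !lt_min => /andP[_ /andP[a2 /andP[a3 a4]]].
move=> /andP[/he1 b1 /andP[b2 /andP[b3 b4]]] e.
have [nq1 nq2] := nm_near_bounds a3 a4.
have [nq'1 nq'2] := nm_near_bounds b3 b4.
have h0 : 0 < nm q0 / 2 by rewrite divr_gt0.
have qn0 : q != 0 by rewrite -nm_gt0; exact: lt_le_trans nq2.
have q'n0 : q' != 0 by rewrite -nm_gt0; exact: lt_le_trans nq'2.
apply/eqP; rewrite -subr_eq0 -nm_eq0; apply/negPn/negP; rewrite nm_eq0 => d0.
have d0' : 0 < nm (q - q') by rewrite nm_gt0.
have T : nm (laurent1 c q' * (q - q')) <= K' * nm (q - q') ^+ 2.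
  have -> : laurent1 c q' * (q - q') = - ((ps c q - ps c q' - ps (dcoef c) q' * (q - q')) +
     (q - q') ^+ 2 / (q * q' ^+ 2)).
    rewrite (laurent_eq_diff e) /laurent1 /dc /=.
    by move: (ps _ _) => X; field; rewrite qn0 q'n0.
  rewrite nmN; apply: le_trans (ler_nmD _ _) _; rewrite mulrDl; apply: lerD.
    exact: hK.
  rewrite nmM nmX nmV mulrC; apply: ler_wpM2r; first exact: sqr_ge0.
  rewrite nmM nmX.
  have p1 : (nm q0 / 2) ^+ 3 <= nm q * nm q' ^+ 2.
    rewrite exprS; apply: ler_pM => //; first exact: ltW.
      by rewrite exprn_ge0// ltW.
    by apply: lerXn2r => //; rewrite nnegrE ?nm_ge0// ltW.
  have p0 : 0 < (nm q0 / 2) ^+ 3 by rewrite exprn_gt0.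
  apply: (@le_trans _ _ ((nm q0 / 2) ^+ 3)^-1).
    by rewrite lef_pV2 ?posrE//; exact: lt_le_trans p1.
  rewrite expr_div_n invfM invrK mulrC le_eqVlt; apply/orP; left; apply/eqP.
  by congr (_ * _); ring.
have h1 : nm (laurent1 c q') <= K' * nm (q - q').
  by move: T; rewrite nmM expr2 mulrA ler_pM2r.
have h2 : D / 2 <= nm (laurent1 c q').
  by rewrite DE; apply: nm_near_half; rewrite -DE.
have h3 : nm (q - q') < D / (4 * K').
  apply: le_lt_trans (ler_nm_distD _ _ q0) _; rewrite (nmBC q0).
  have -> : D / (4 * K') = D / (8 * K') + D / (8 * K') by field; rewrite gt_eqF.
  exact: ltrD.
move: h3; rewrite ltr_pdivlMr ?mulr_gt0// mulrCA => h3.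
move: h1 h2 h3; rewrite [nm (q - q') * K']mulrC.
by move: (nm (laurent1 c q')) (K' * nm (q - q')) => x y; move: D0; clear; lra.
Qed.

Lemma j_locally_injective z : uhp z -> j1 z != 0 -> exists2 e : R, 0 < e &
  forall w w', nm (w - z) < e -> nm (w' - z) < e -> j w = j w' -> w = w'.
Proof.
move=> hz jz; have q00 := nome_neq0 z; have q01 := nm_nome_lt1 hz.
have l0 : laurent1 c (nome z) != 0.
  by apply: contra_neq jz => e; rewrite /j1 e !mulr0.
have [d d0 hd] := laurent_locally_injective q00 q01 l0.
have /near_nmP[e e0 he] : \forall w \near z, uhp w /\ nm (nome w - nome z) < d.
  apply: filterI; first exact: open_uhp.
  by have /cvg_nmP := is_derive_continuous (nome_derive z); apply.
(* The radius 1/2 makes |w' - w| < 1, so the integer translation between [w] and [w'] is zero. *)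
exists (Num.min e (1 / 2)); first by rewrite lt_min e0 divr_gt0.
move=> w w'; rewrite !lt_min => /andP[/he[uw a1] w1] /andP[/he[uw' b1] w'1].
rewrite !jE// => /(hd _ _ a1 b1) qq.
have [n wE] := nome_eq qq; have : nm (w' - w) < 1.
  apply: le_lt_trans (ler_nm_distD _ _ z) _.
  by rewrite (nmBC z) [ltRHS](splitr 1) ltrD.
have -> : w' - w = n%:~R by rewrite wE addrAC subrr add0r.
by move=> /nm_int_lt1 n0; rewrite wE n0 addr0.
Qed.

End CuspExpansion.

(** * Local behaviour of the Schwarzian *)

Section Limits.
Variable R : realType.
Local Notation C := (Cplx R).
Context {T : Type} {F : set_system T} (FF : Filter F).
Implicit Types (f g : T -> C) (a b k : C).

Lemma ccvg_cst k : (fun=> k) @ F --> k.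
Proof. exact: cvg_cst. Qed.
Lemma ccvgD f g a b : f @ F --> a -> g @ F --> b -> (fun x => f x + g x) @ F --> a + b.
Proof. exact: cvgD. Qed.
Lemma ccvgB f g a b : f @ F --> a -> g @ F --> b -> (fun x => f x - g x) @ F --> a - b.
Proof. exact: cvgB. Qed.
Lemma ccvgM f g a b : f @ F --> a -> g @ F --> b -> (fun x => f x * g x) @ F --> a * b.
Proof. exact: cvgM. Qed.
Lemma ccvgMl f a k : f @ F --> a -> (fun x => k * f x) @ F --> k * a.
Proof. by move=> h; exact: (ccvgM (@ccvg_cst k) h). Qed.
Lemma ccvgV f a : a != 0 -> f @ F --> a -> (fun x => (f x)^-1) @ F --> a^-1.
Proof. exact: cvgV. Qed.
Lemma ccvgX f a n : f @ F --> a -> (fun x => f x ^+ n) @ F --> a ^+ n.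
Proof. exact: cvg_pow. Qed.
Lemma ccvg_congr f a b : f @ F --> a -> a = b -> f @ F --> b.
Proof. by move=> h <-. Qed.
Lemma ccvg_near f g a : (\forall x \near F, f x = g x) -> f @ F --> a -> g @ F --> a.
Proof. by move=> h; apply: cvg_trans; exact: near_eq_cvg. Qed.
Lemma ccvg_neq0 f a : a != 0 -> f @ F --> a -> \forall x \near F, f x != 0.
Proof.
move=> a0 /cvg_nmP/(_ (nm a)); rewrite nm_gt0 => /(_ a0).
by apply: filterS => x h; apply/eqP => e; move: h; rewrite e sub0r nmN ltxx.
Qed.

End Limits.
Arguments ccvg_cst {R T F} FF k.
Arguments ccvgD {R T F} FF {f g a b} _ _.
Arguments ccvgB {R T F} FF {f g a b} _ _.
Arguments ccvgM {R T F} FF {f g a b} _ _.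
Arguments ccvgMl {R T F} FF {f a} k _.
Arguments ccvgV {R T F} FF {f a} _ _.
Arguments ccvgX {R T F} FF {f a} n _.
Arguments ccvg_congr {R T F f a b} _ _.
Arguments ccvg_near {R T F} FF {f g a} _ _.
Arguments ccvg_neq0 {R T F} FF {f a} _ _.

Section Jets.
Variable R : realType.
Local Notation C := (Cplx R).

Lemma cvg_bounded_mul0 (s u : C -> C) (a : C) (l : C) : s @ a --> (0 : C) -> u @ a --> l ->
  (fun q => s q * u q) @ a --> (0 : C).
Proof.
pose FFq := nbhs_filter a.
by move=> h1 h2; apply: (ccvg_congr (ccvgM FFq h1 h2)); rewrite mul0r.
Qed.

Lemma cvg_dnbhs (f : C -> C) (a l : C) : f @ a --> l -> f @ a^' --> l.
Proof. by move=> h; apply: cvg_trans h; apply: cvg_app; exact: cvg_within. Qed.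

(** The Euler operator s d/ds sends s^m u to s^m (m u + s u'); unlike d/ds it preserves the exponent
    m. *)
Lemma euler_step (f f' u u' : C -> C) (q0 q : C) m :
  (\forall w \near q, f w = (w - q0) ^+ m * u w) ->
  is_derive q (1 : C) f (f' q) -> is_derive q (1 : C) u (u' q) ->
  (q - q0) * f' q = (q - q0) ^+ m * (m%:R * u q + (q - q0) * u' q).
Proof.
move=> fE hf hu.
have hs : is_derive q (1 : C) (fun w => w - q0) 1.
  by apply: (is_derive_cast (cderivB (cderiv_id q) (cderiv_cst q q0))); rewrite subr0.
have h := cderivM (cderivX m hs) hu.
have {hf} hf := cderiv_near fE hf.
rewrite (cderiv_unique hf h).
case: m {fE hf h} => [|m] /=; first by rewrite !mul0r !expr0; ring.
by rewrite !exprS; ring.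
Qed.

(** The factors k, k (k - 1), k (k - 1) (k - 2) are those of the derivatives of s^k, so the value is
    the one obtained for an exact power. *)
Lemma jet_limit_value (x k : C) : x != 0 -> k != 0 ->
  x ^+ 2 * ((k - 2) * ((k - 1) * (k * x)) * (k * x) - 3 / 2 * ((k - 1) * (k * x)) ^+ 2) /
  (k * x) ^+ 4 - 0 = (1 - k ^+ 2) / (2 * k ^+ 2).
Proof. by move=> x0 k0; field; rewrite k0 x0. Qed.

(** Here t stands for s, x for s^m, a for v, and b, d, e for w1, w2, w3: all powers of s cancel
    except in the contribution of the nome. *)
Lemma jet_quotient (t x a b d e q : C) : t != 0 -> x != 0 -> b != 0 -> q != 0 ->
  a ^+ 2 * (e * b - 3 / 2 * d ^+ 2) * (b ^+ 4)^-1 -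
    t * (t * a ^+ 2 * (2 * q ^+ 2 * b ^+ 2)^-1) =
  ((x * e / t ^+ 3 * (x * b / t) - 3 / 2 * (x * d / t ^+ 2) ^+ 2) / (x * b / t) ^+ 4 -
    (2 * q ^+ 2 * (x * b / t) ^+ 2)^-1) * (x * a) ^+ 2.
Proof. by move=> t0 x0 b0 q0; field; rewrite t0 x0 b0 q0. Qed.

(* Here L - L q0 = s^m v with s = q - q0, and s^k L^(k) = s^m w_k where
   w_(k+1) = (m - k) w_k + s w_k'. *)
Variables (m : nat) (q0 : C) (L L1 L2 L3 v v1 v2 v3 : C -> C).
Hypothesis m_gt0 : (0 < m)%N.
Hypothesis v0 : v q0 != 0.
Hypothesis hL : \forall q \near q0, L q - L q0 = (q - q0) ^+ m * v q.
Hypothesis dL : \forall q \near q0, [/\ is_derive q (1 : C) L (L1 q),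
  is_derive q (1 : C) L1 (L2 q) & is_derive q (1 : C) L2 (L3 q)].
Hypothesis dv : \forall q \near q0, [/\ is_derive q (1 : C) v (v1 q),
  is_derive q (1 : C) v1 (v2 q) & is_derive q (1 : C) v2 (v3 q)].
Hypothesis cv3 : v3 @ q0 --> v3 q0.

Let FFq : Filter (nbhs q0) := nbhs_filter q0.
Let s (q : C) := q - q0.
Let w1 (q : C) := m%:R * v q + s q * v1 q.
Let w1' (q : C) := (m%:R + 1) * v1 q + s q * v2 q.
Let w1'' (q : C) := (m%:R + 2) * v2 q + s q * v3 q.
Let w2 (q : C) := (m%:R - 1) * w1 q + s q * w1' q.
Let w2' (q : C) := m%:R * w1' q + s q * w1'' q.
Let w3 (q : C) := (m%:R - 2) * w2 q + s q * w2' q.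

Let ds (q : C) : is_derive q (1 : C) s 1.
Proof. by apply: (is_derive_cast (cderivB (cderiv_id q) (cderiv_cst q q0))); rewrite subr0. Qed.

Lemma near_near (P : C -> Prop) : (\forall q \near q0, P q) ->
  \forall q \near q0, \forall w \near q, P w.
Proof. by move=> h; exact: nbhs_interior. Qed.

Lemma jet_relations : \forall q \near q0,
  [/\ s q * L1 q = s q ^+ m * w1 q, s q ^+ 2 * L2 q = s q ^+ m * w2 q &
      s q ^+ 3 * L3 q = s q ^+ m * w3 q].
Proof.
have E1 : \forall q \near q0, s q * L1 q = s q ^+ m * w1 q.
  apply: filterS2 (near_near hL) (filterI dL dv) => q hq [[d1 _ _] [e1 _ _]].
  have k1 : is_derive q (1 : C) (fun q => L q - L q0) (L1 q).
    by apply: (is_derive_cast (cderivB d1 (cderiv_cst q (L q0)))); rewrite subr0.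
  exact: (@euler_step (fun q => L q - L q0) L1 v v1 q0 q m hq k1 e1).
have E2 : \forall q \near q0, s q ^+ 2 * L2 q = s q ^+ m * w2 q.
  apply: filterS2 (near_near E1) (filterI (filterI dL dv) E1) => q hq [[[d1 d2 _] [e1 e2 _]] hq1].
  have h := @euler_step (fun q => s q * L1 q) (fun q => L1 q + s q * L2 q) w1 w1' q0 q m hq.
  have h1 : is_derive q (1 : C) (fun q => s q * L1 q) (L1 q + s q * L2 q).
    by apply: (is_derive_cast (cderivM (ds q) d2)); rewrite mul1r.
  have h2 : is_derive q (1 : C) w1 (w1' q).
    apply: (is_derive_cast (cderivD (cderivMl m%:R e1) (cderivM (ds q) e2))).
    by rewrite /w1'; move: (v1 q) (v2 q) (s q); clear; move=> a b t; ring.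
  have {h} := h h1 h2; rewrite -/(s q) /w2 => h.
  have -> : s q ^+ 2 * L2 q = s q * (L1 q + s q * L2 q) - s q * L1 q.
    by move: (L1 q) (L2 q) (s q); clear; move=> a b t; ring.
  rewrite h hq1; move: (w1 q) (w1' q) (s q) (s q ^+ m); clear; move=> a b t x; ring.
have E3 : \forall q \near q0, s q ^+ 3 * L3 q = s q ^+ m * w3 q.
  apply: filterS2 (near_near E2) (filterI (filterI dL dv) E2) => q hq [[[d1 d2 d3] [e1 e2 e3]] hq1].
  have h := @euler_step (fun q => s q ^+ 2 * L2 q)
    (fun q => 2 * s q * L2 q + s q ^+ 2 * L3 q) w2 w2' q0 q m hq.
  have h1 : is_derive q (1 : C) (fun q => s q ^+ 2 * L2 q) (2 * s q * L2 q + s q ^+ 2 * L3 q).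
    by apply: (is_derive_cast (cderivM (cderivX 2 (ds q)) d3)); rewrite /= mulr1 expr1.
  have k1 : is_derive q (1 : C) w1 (w1' q).
    apply: (is_derive_cast (cderivD (cderivMl m%:R e1) (cderivM (ds q) e2))).
    by rewrite /w1'; move: (v1 q) (v2 q) (s q); clear; move=> a b t; ring.
  have k2 : is_derive q (1 : C) w1' (w1'' q).
    apply: (is_derive_cast (cderivD (cderivMl (m%:R + 1) e2) (cderivM (ds q) e3))).
    by rewrite /w1''; move: (v2 q) (v3 q) (s q); clear; move=> a b t; ring.
  have h2 : is_derive q (1 : C) w2 (w2' q).
    apply: (is_derive_cast (cderivD (cderivMl (m%:R - 1) k1) (cderivM (ds q) k2))).
    by rewrite /w2'; move: (w1' q) (w1'' q) (s q); clear; move=> a b t; ring.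
  have {h} := h h1 h2; rewrite -/(s q) /w3 => h.
  have -> : s q ^+ 3 * L3 q = s q * (2 * s q * L2 q + s q ^+ 2 * L3 q) - 2 * (s q ^+ 2 * L2 q).
    by move: (L2 q) (L3 q) (s q); clear; move=> a b t; ring.
  rewrite h hq1; move: (w2 q) (w2' q) (s q) (s q ^+ m); clear; move=> a b t x; ring.
by apply: filterS2 E1 (filterI E2 E3) => q h1 [h2 h3].
Qed.

Lemma jet_limits : [/\ v @ q0 --> v q0, w1 @ q0 --> m%:R * v q0,
  w2 @ q0 --> (m%:R - 1) * (m%:R * v q0) &
  w3 @ q0 --> (m%:R - 2) * ((m%:R - 1) * (m%:R * v q0))].
Proof.
have [d1 d2 d3] := nbhs_singleton dv.
have c0 := is_derive_continuous d1; have c1 := is_derive_continuous d2.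
have c2 := is_derive_continuous d3.
have cs : s @ q0 --> (0 : C).
  by have := is_derive_continuous (ds q0); rewrite /s subrr.
have aux (k : C) (u u' : C -> C) (l l' : C) : u @ q0 --> l -> u' @ q0 --> l' ->
    (fun q => k * u q + s q * u' q) @ q0 --> k * l.
  move=> h1 h2; apply: (ccvg_congr (ccvgD FFq (ccvgMl FFq k h1) (cvg_bounded_mul0 cs h2))).
  by rewrite addr0.
have cw1 : w1 @ q0 --> m%:R * v q0 := aux _ _ _ _ _ c0 c1.
have cw1' : w1' @ q0 --> (m%:R + 1) * v1 q0 := aux _ _ _ _ _ c1 c2.
have cw1'' : w1'' @ q0 --> (m%:R + 2) * v2 q0 := aux _ _ _ _ _ c2 cv3.
have cw2 : w2 @ q0 --> (m%:R - 1) * (m%:R * v q0) := aux _ _ _ _ _ cw1 cw1'.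
have cw2' : w2' @ q0 --> m%:R * ((m%:R + 1) * v1 q0) := aux _ _ _ _ _ cw1' cw1''.
split; [exact: c0|exact: cw1|exact: cw2|exact: (aux _ _ _ _ _ cw2 cw2')].
Qed.

Lemma jet_L1_neq0 : \forall q \near q0^', L1 q != 0.
Proof.
have [_ c1 _ _] := jet_limits.
have l0 : m%:R * v q0 != 0 by rewrite mulf_neq0// pnatr_eq0 -lt0n.
have n1 : \forall q \near q0, w1 q != 0 := ccvg_neq0 FFq l0 c1.
have /near_nmP[e e0 he] : \forall q \near q0,
   (s q * L1 q = s q ^+ m * w1 q) /\ w1 q != 0.
  by apply: filterS2 jet_relations n1 => q [].
apply/near_dnmP; exists e => // q qq0 /he[h1 h2]; apply/eqP => L10.
move: h1; rewrite L10 mulr0 => /esym/eqP; rewrite mulf_eq0 (negbTE h2) orbF.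
by rewrite expf_eq0 subr_eq0 (negbTE qq0) andbF.
Qed.

Lemma jet_schwarzian_limit : q0 != 0 ->
  (fun q => ((L3 q * L1 q - 3 / 2 * L2 q ^+ 2) / L1 q ^+ 4 - (2 * q ^+ 2 * L1 q ^+ 2)^-1) *
    (L q - L q0) ^+ 2) @ q0^' --> ((1 - m%:R ^+ 2) / (2 * m%:R ^+ 2) : C).
Proof.
move=> q00; have [cv c1 c2 c3] := jet_limits.
have m0 : m%:R != 0 :> C by rewrite pnatr_eq0 -lt0n.
have l0 : m%:R * v q0 != 0 by rewrite mulf_neq0.
have cs : s @ q0 --> (0 : C).
  by have := is_derive_continuous (ds q0); rewrite /s subrr.
have cid : (fun q : C => q) @ q0 --> q0 by exact: cvg_id.
have [l1 l1E] : exists l, l = m%:R * v q0 by eexists.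
rewrite -l1E in l0 c1 c2 c3.
have [l2 l2E] : exists l, l = (m%:R - 1) * l1 by eexists.
rewrite -l2E in c2 c3.
have [l3 l3E] : exists l, l = (m%:R - 2) * l2 by eexists.
rewrite -l3E in c3.
have l40 : l1 ^+ 4 != 0 by rewrite expf_neq0.
have d0 : 2 * q0 ^+ 2 * l1 ^+ 2 != 0 by rewrite !mulf_neq0 ?expf_neq0// pnatr_eq0.
have lim1 : (fun q => v q ^+ 2 * (w3 q * w1 q - 3 / 2 * w2 q ^+ 2) * (w1 q ^+ 4)^-1) @ q0 -->
    v q0 ^+ 2 * (l3 * l1 - 3 / 2 * l2 ^+ 2) * (l1 ^+ 4)^-1.
  apply: (ccvgM FFq (ccvgM FFq (ccvgX FFq 2 cv) _) (ccvgV FFq l40 (ccvgX FFq 4 c1))).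
  exact: (ccvgB FFq (ccvgM FFq c3 c1) (ccvgMl FFq (3 / 2) (ccvgX FFq 2 c2))).
(* The contribution of the nome keeps a factor s^2 and vanishes in the limit. *)
have lim2 : (fun q => s q * (s q * v q ^+ 2 * (2 * q ^+ 2 * w1 q ^+ 2)^-1)) @ q0 --> (0 : C).
  apply: (cvg_bounded_mul0 cs).
  apply: (ccvgM FFq (ccvgM FFq cs (ccvgX FFq 2 cv)) (ccvgV FFq d0 _)).
  exact: (ccvgM FFq (ccvgMl FFq 2 (ccvgX FFq 2 cid)) (ccvgX FFq 2 c1)).
have lim := ccvgB FFq lim1 lim2.
have E : v q0 ^+ 2 * (l3 * l1 - 3 / 2 * l2 ^+ 2) * (l1 ^+ 4)^-1 - 0 =
   (1 - m%:R ^+ 2) / (2 * m%:R ^+ 2).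
  by rewrite l3E l2E l1E; exact: jet_limit_value.
apply: (ccvg_congr _ E).
apply: (ccvg_near (dnbhs_filter q0) _ (cvg_dnbhs lim)).
have n2 : \forall q \near q0^', q != 0 /\ (L q - L q0 = s q ^+ m * v q /\
   [/\ s q * L1 q = s q ^+ m * w1 q, s q ^+ 2 * L2 q = s q ^+ m * w2 q &
      s q ^+ 3 * L3 q = s q ^+ m * w3 q]).
  apply: cvg_within; apply: filterI.
    apply/near_nmP; exists (nm q0); first by rewrite nm_gt0.
    by move=> q h; apply/eqP => e; move: h; rewrite e sub0r nmN ltxx.
  exact: filterI hL jet_relations.
have n3 : \forall q \near q0^', q != q0 by apply/near_dnmP; exists 1.
apply: filterS2 jet_L1_neq0 (filterI n2 n3) => q L10 [[qn0 [hLq [r1 r2 r3]]] qq0].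
have s0 : s q != 0 by rewrite subr_eq0.
have sm0 : s q ^+ m != 0 by rewrite expf_neq0.
have e1 : L1 q = s q ^+ m * w1 q / s q by rewrite -r1 mulrAC divff// mul1r.
have e2 : L2 q = s q ^+ m * w2 q / s q ^+ 2.
  by rewrite -r2 mulrAC divff ?mul1r// expf_neq0.
have e3 : L3 q = s q ^+ m * w3 q / s q ^+ 3.
  by rewrite -r3 mulrAC divff ?mul1r// expf_neq0.
have w10 : w1 q != 0.
  by apply: contra_neq L10 => e; rewrite e1 e mulr0 mul0r.
by rewrite hLq e1 e2 e3; exact: jet_quotient.
Qed.

End Jets.

Section LocalStructure.
Variable R : realType.
Local Notation C := (Cplx R).
Implicit Types (q z w : C).

Lemma near_dnbhsW (a : C) (P : C -> Prop) : (\forall w \near a, P w) ->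
  \forall w \near a^', P w.
Proof. by move=> h; apply: cvg_within. Qed.

Lemma near_dnbhs_comp (g : C -> C) (a b : C) (P : C -> Prop) : g @ a^' --> b^' ->
  (\forall q \near b^', P q) -> \forall w \near a^', P (g w).
Proof. by move=> h hP; exact: (h _ hP). Qed.

Lemma factor_has_order (f v : C -> C) q0 m : (0 < m)%N -> v q0 != 0 -> v @ q0 --> v q0 ->
  (\forall q \near q0, f q - f q0 = (q - q0) ^+ m * v q) -> has_order f q0 m (v q0).
Proof.
move=> m0 v0 cv fE; split; [exact: m0|exact: v0|].
apply: (ccvg_near (dnbhs_filter q0) _ (cvg_dnbhs cv)).
have n3 : \forall q \near q0^', q != q0 by apply/near_dnmP; exists 1.
apply: filterS2 (near_dnbhsW fE) n3 => q -> qq0.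
by rewrite [RHS]mulrAC divff ?mul1r// expf_neq0// subr_eq0.
Qed.

Section Quotient.
Variable b : nat -> C.
Hypothesis hb : pscoef b.
(** The cofactor of (q - q0)^m provided by [laurent_factor]; the three functions that follow are its
    derivatives. *)
Definition vq0 q : C := ps b q * q^-1.
Definition vq1 q : C := ps (dc b 1) q * q^-1 - ps b q * q ^- 2.
Definition vq2 q : C := ps (dc b 2) q * q^-1 - 2 * (ps (dc b 1) q * q ^- 2) + 2 * (ps b q * q ^- 3).
Definition vq3 q : C := ps (dc b 3) q * q^-1 - 3 * (ps (dc b 2) q * q ^- 2) +
  6 * (ps (dc b 1) q * q ^- 3) - 6 * (ps b q * q ^- 4).

Lemma is_derive_psV k n q : q != 0 -> nm q < 1 ->
  is_derive q (1 : C) (fun w => ps (dc b k) w * w ^- n)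
    (ps (dc b k.+1) q * q ^- n - n%:R * (ps (dc b k) q * q ^- n.+1)).
Proof.
move=> q0 q1; apply: (is_derive_cast (cderivM (ps_is_derive (pscoef_dc hb k) q1) (cderiv_invX n q0))).
by rewrite mulrN mulrCA.
Qed.

Lemma is_derive_vq q : q != 0 -> nm q < 1 -> [/\ is_derive q (1 : C) vq0 (vq1 q),
  is_derive q (1 : C) vq1 (vq2 q) & is_derive q (1 : C) vq2 (vq3 q)].
Proof.
move=> q0 q1; have d := fun k n => @is_derive_psV k n q q0 q1.
split.
- by apply: (is_derive_cast (d 0%N 1%N)); rewrite /vq1 mul1r.
- apply: (is_derive_cast (cderivB (d 1%N 1%N) (d 0%N 2%N))); rewrite /vq2 expr1 mul1r.
  by move: (ps _ _) (ps _ _) (ps _ _) => x y t; ring.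
- apply: (is_derive_cast (cderivD (cderivB (d 2%N 1%N) (cderivMl 2 (d 1%N 2%N)))
    (cderivMl 2 (d 0%N 3%N)))); rewrite /vq3 expr1 mul1r.
  by move: (ps _ _) (ps _ _) (ps _ _) (ps _ _) => x y t u; ring.
Qed.

Lemma continuous_vq3 q : q != 0 -> nm q < 1 -> vq3 @ q --> vq3 q.
Proof.
move=> q0 q1; have c k n := is_derive_continuous (@is_derive_psV k n q q0 q1).
have F := nbhs_filter q.
exact: (ccvgB F (ccvgD F (ccvgB F (c 3%N 1%N) (ccvgMl F 3 (c 2%N 2%N)))
   (ccvgMl F 6 (c 1%N 3%N))) (ccvgMl F 6 (c 0%N 4%N))).
Qed.
End Quotient.

Variables (c : nat -> C) (j : C -> C).
Hypothesis hc : pscoef c.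
Hypothesis jE : forall z, uhp z -> j z = laurent c (nome z).

(* S(j) / j'^2 in terms of q = nome z; the last term is the contribution of the
   Schwarzian of nome. *)
Definition schw_q q : C :=
  (laurent3 c q * laurent1 c q - 3 / 2 * laurent2 c q ^+ 2) / laurent1 c q ^+ 4 -
  (2 * q ^+ 2 * laurent1 c q ^+ 2)^-1.

Lemma near_punctured_disc q0 : q0 != 0 -> nm q0 < 1 ->
  \forall q \near q0, q != 0 /\ nm q < 1.
Proof.
move=> q00 q01; apply/near_nmP; exists (Num.min (nm q0) (1 - nm q0)).
  by rewrite lt_min nm_gt0 q00 subr_gt0.
move=> q; rewrite lt_min => /andP[h1 h2]; split.
  by apply/eqP => e; move: h1; rewrite e sub0r nmN ltxx.
rewrite -[q](subrK q0); apply: le_lt_trans (ler_nmD _ _) _; move: h2.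
by move: (nm (q - q0)) (nm q0) => x y; lra.
Qed.

Lemma laurent_local q0 : q0 != 0 -> nm q0 < 1 ->
  (\forall q \near q0^', laurent1 c q != 0) /\
  exists m l, has_order (laurent c) q0 m l /\
  (fun q => schw_q q * (laurent c q - laurent c q0) ^+ 2) @ q0^' -->
    ((1 - m%:R ^+ 2) / (2 * m%:R ^+ 2) : C).
Proof.
move=> q00 q01; have [m [b [m0 hb b0 bE]]] := laurent_factor hc q00 q01.
have nd := near_punctured_disc q00 q01.
have hL : \forall q \near q0, laurent c q - laurent c q0 = (q - q0) ^+ m * vq0 b q.
  by apply: filterS nd => q [qn0 q1]; exact: bE.
have dL : \forall q \near q0, [/\ is_derive q (1 : C) (laurent c) (laurent1 c q),
  is_derive q (1 : C) (laurent1 c) (laurent2 c q) &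
  is_derive q (1 : C) (laurent2 c) (laurent3 c q)].
  apply: filterS nd => q [qn0 q1].
  by split; [exact: is_derive_laurent|exact: is_derive_laurent1|exact: is_derive_laurent2].
have dv : \forall q \near q0, [/\ is_derive q (1 : C) (vq0 b) (vq1 b q),
  is_derive q (1 : C) (vq1 b) (vq2 b q) & is_derive q (1 : C) (vq2 b) (vq3 b q)].
  by apply: filterS nd => q [qn0 q1]; exact: is_derive_vq.
have v0 : vq0 b q0 != 0 by rewrite mulf_neq0// invr_eq0.
have c3 := continuous_vq3 hb q00 q01.
split; first exact: (jet_L1_neq0 m0 v0 hL dL dv c3).
exists m, (vq0 b q0); split; last exact: (jet_schwarzian_limit m0 v0 hL dL dv c3 q00).
have [d _ _] := nbhs_singleton dv.
exact: (factor_has_order m0 v0 (is_derive_continuous d) hL).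
Qed.

Definition schw z : C := schw_q (nome z).

(** The zeros of j' are isolated, and one and the same m is the order of j at z and the parameter of
    the limit. *)
Lemma j_local z : uhp z -> (\forall w \near z^', j1 c w != 0) /\
  exists m l, has_order j z m l /\
  (fun w => schw w * (j w - j z) ^+ 2) @ z^' --> ((1 - m%:R ^+ 2) / (2 * m%:R ^+ 2) : C).
Proof.
move=> hz; have [h1 [m [l [h2 h3]]]] := laurent_local (nome_neq0 z) (nm_nome_lt1 hz).
have t0 : tau R * nome z != 0 by rewrite mulf_neq0 ?nome_neq0 ?tau_neq0.
have [cn _] := cvg_dnbhs_deriv (nome_derive z) t0.
have huhp : \forall w \near z^', uhp w := near_dnbhsW (open_uhp hz).
split.
  have cnh := near_dnbhs_comp (P := fun q => laurent1 c q != 0) cn h1.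
  apply: filterS cnh => w hw.
  by rewrite mulf_neq0 ?tau_neq0// mulf_neq0 ?nome_neq0.
exists m, (l * (tau R * nome z) ^+ m); split.
  have [m0 k0 hk] := has_order_comp h2 (nome_derive z) t0.
  split; [exact: m0|exact: k0|].
  apply: (ccvg_near (dnbhs_filter z) _ hk).
  by apply: filterS huhp => w hw /=; rewrite !jE.
apply: (ccvg_near (dnbhs_filter z) _ (cvg_comp _ _ cn h3)).
by apply: filterS huhp => w hw /=; rewrite !jE.
Qed.

End LocalStructure.

(** * The map induced by j on orbits *)

Section Global.
Variables (R : realType) (N : nat).
Local Notation C := (Cplx R).
Implicit Types (q z w y : C) (g : 'M[R]_2).
Variables (c : nat -> C) (j : C -> C).
Hypothesis sfN : squarefree N.
Hypothesis hc : pscoef c.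
Hypothesis jE : forall z, uhp z -> j z = laurent c (nome z).
Hypothesis jinv : forall g z, Gamma0plus N g -> uhp z -> j (mobius g z) = j z.

Lemma equivalent_j z w : uhp z -> equivalent N z w -> j z = j w.
Proof. by move=> hz [g Gg <-]; rewrite jinv. Qed.

Lemma equivalent_uhp z w : uhp z -> equivalent N z w -> uhp w.
Proof. by move=> hz [g Gg <-]; apply: mobius_uhp => //; exact: (Gamma_unimodular sfN). Qed.

Definition strip_below (Y : R) : set C := [set z | fundamental_strip N z /\ complex.Im z <= Y].

Lemma compact_strip_below Y : compact (strip_below Y).
Proof.
have -> : strip_below Y = [set z : C | 0 <= complex.Re z <= 1 /\
    (5 * N%:R)^-1 <= complex.Im z <= Y].
  apply/seteqP; split => z /=.
    by move=> [[h1 h2] h3]; split => //; apply/andP.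
  by move=> [h1 /andP[h2 h3]].
exact: compact_rect.
Qed.

Lemma strip_below_uhp Y z : strip_below Y z -> uhp z.
Proof. by move=> [h _]; exact: (strip_uhp sfN h). Qed.

Lemma j_continuous z : uhp z -> j @ z --> j z.
Proof. by move=> hz; exact: is_derive_continuous (is_derive_j hc jE hz). Qed.

Lemma j_surjective y : exists2 z, uhp z & j z = y.
Proof.
have hi : uhp (0 +i* 1 : C) by rewrite uhpE /= ltr01.
have [z1 z1s z1i] := reduce_to_strip sfN hi.
(* Above this height |j - y| exceeds its value at [z1], so the search for a minimum is confined to a
   compact set. *)
have [Y Y0 hY] := j_cusp hc jE (nm y + nm (j z1 - y)).
have far z : Y < complex.Im z -> nm (j z1 - y) < nm (j z - y).
  move=> /hY h; have := ler_nm_dist (j z) y.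
  by move: h; move: (nm (j z1 - y)) (nm (j z - y)) (nm (j z)) (nm y) => a b d e; lra.
have z1Y : complex.Im z1 <= Y by rewrite leNgt; apply/negP => /far; rewrite ltxx.
have [||w wK wmin] := @compact_nm_min R (strip_below Y) j y (@compact_strip_below Y).
- by exists z1.
- by move=> z /strip_below_uhp; exact: j_continuous.
have uw := strip_below_uhp wK.
exists w => //; apply/eqP; apply/negPn/negP => neq.
have [m [l ho]] := j_has_order hc jE uw.
have iw : 0 < complex.Im w := uw.
(* The better point may leave the strip; its representative [w2] there has the same value of j and
   contradicts minimality, either directly or because values above [Y] are too far from y. *)
have [w' ww' lt] := nm_min_decrease ho neq iw.
have uw' : uhp w'.
  have := le_lt_trans (ler_Im_nm _) ww'; rewrite Im_sub ltr_norml uhpE => /andP[h _].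
  by move: h iw; move: (complex.Im w') (complex.Im w) => a b; lra.
have [w2 w2s w2e] := reduce_to_strip sfN uw'.
rewrite (equivalent_j uw' w2e) in lt.
have [w2Y|w2Y] := leP (complex.Im w2) Y.
  by move: lt; rewrite ltNge wmin.
have := far _ w2Y; have := wmin z1 (conj z1s z1Y).
by move: lt; move: (nm (j w2 - y)) (nm (j w - y)) (nm (j z1 - y)) => a b d; lra.
Qed.

Lemma j1_equivalent z w : uhp z -> equivalent N z w -> j1 c z = 0 -> j1 c w = 0.
Proof.
move=> hz [g Gg <-] e; have hg := Gamma_unimodular sfN Gg.
have d1 := is_derive_j hc jE (mobius_uhp hg hz).
have d2 := is_derive1_chain (is_derive_mobius hg hz) d1.
have d3 : is_derive z (1 : C) (j \o mobius g) (j1 c z).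
  apply: cderiv_near (is_derive_j hc jE hz).
  by apply: filterS (open_uhp hz) => v hv /=; rewrite jinv.
have /eqP := cderiv_unique d2 d3; rewrite e mulf_eq0 invr_eq0 expf_eq0.
by rewrite (negbTE (cocycle_neq0 hg hz)) /= orbF => /eqP.
Qed.

(** Every critical point is equivalent to one in the truncated strip, since j' is nonzero near the
    cusp; there the zeros of j' are isolated and compactness leaves finitely many. *)
Lemma critical_values_finite : exists s : seq C,
  forall z, uhp z -> j1 c z = 0 -> j z \in s.
Proof.
have [Y Y0 hY] := j1_cusp hc.
(* An open set in which z is the only possible zero of j'. *)
pose U z : set C := interior [set w | w != z -> j1 c w != 0].
have := @compact_strip_below Y; rewrite compact_cover.
move=> /(_ C (strip_below Y) U) [||D _ hD].
- by move=> z _; exact: open_interior.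
- move=> z zK; exists z => //=; rewrite /U /interior /=.
  have [h _] := j_local hc jE (strip_below_uhp zK).
  by move: h; rewrite /dnbhs near_withinE.
exists [seq j z | z <- finmap.enum_fset D] => z hz e.
have [w ws we] := reduce_to_strip sfN hz.
have ew := j1_equivalent hz we e.
have wY : complex.Im w <= Y by rewrite leNgt; apply/negP => /hY; rewrite ew eqxx.
have [z0 /= z0D hw] := hD w (conj ws wY).
have wz0 : w = z0.
  apply/eqP; apply/negPn/negP => ne; have /(_ ne) := interior_subset hw.
  by rewrite ew eqxx.
by rewrite (equivalent_j hz we) wz0; exact: map_f.
Qed.

Definition collision y := exists z w, [/\ uhp z, uhp w, j z = y, j w = y &
  ~ equivalent N z w].

Lemma open_map_uhp z (e : R) : uhp z -> 0 < e -> exists2 d : R, 0 < d &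
  forall y, nm (y - j z) < d -> exists2 w, uhp w /\ nm (w - z) < e & j w = y.
Proof.
move=> hz e0; have iz : 0 < complex.Im z := hz.
have [|d d0 hd] := open_map (near_j_has_order hc jE hz) (e := Num.min e (complex.Im z)).
  by rewrite lt_min e0.
exists d => // y /hd[w]; rewrite lt_min => /andP[h1 h2] jw; exists w => //.
split => //; have := le_lt_trans (ler_Im_nm _) h2.
rewrite Im_sub ltr_norml uhpE => /andP[h _].
by move: h iz; move: (complex.Im w) (complex.Im z) => a b; lra.
Qed.

(** Openness of j moves both preimages along with y, and proper discontinuity keeps them
    inequivalent. *)
Lemma collision_open y : collision y -> exists2 d : R, 0 < d &
  forall y', nm (y' - y) < d -> collision y'.
Proof.
move=> [z [w [hz hw jz jw neq]]].
have [e e0 he] := properly_discontinuous sfN hz hw.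
have [d1 d10 h1] := open_map_uhp hz e0; have [d2 d20 h2] := open_map_uhp hw e0.
exists (Num.min d1 d2); first by rewrite lt_min d10.
move=> y'; rewrite lt_min => /andP[y1 y2].
have [|z' [uz' zz'] jz'] := h1 y'; first by rewrite jz.
have [|w' [uw' ww'] jw'] := h2 y'; first by rewrite jw.
exists z', w'; split => // -[g Gg gz]; apply: neq; exists g; first exact: Gg.
by apply: (he g z' Gg zz'); rewrite gz.
Qed.

Lemma collision_strip y (B : R) : nm y < B -> collision y -> forall Y : R,
  (forall z, Y < complex.Im z -> B < nm (j z)) -> exists z w,
  [/\ strip_below Y z, strip_below Y w, j z = y, j w = y & ~ equivalent N z w].
Proof.
move=> yB [z [w [hz hw jz jw neq]]] Y hY.
have [z' zs ze] := reduce_to_strip sfN hz; have [w' ws we] := reduce_to_strip sfN hw.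
have jz' : j z' = y by rewrite -(equivalent_j hz ze).
have jw' : j w' = y by rewrite -(equivalent_j hw we).
have low v : j v = y -> complex.Im v <= Y.
  by move=> jv; rewrite leNgt; apply/negP => /hY; rewrite jv => /(lt_trans yB); rewrite ltxx.
exists z', w'; split => //; [by split => //; exact: low|by split => //; exact: low|].
move=> e; apply: neq; apply: (equivalent_trans sfN hz ze).
have uz' := equivalent_uhp hz ze.
apply: (equivalent_trans sfN uz' e); exact: (equivalent_sym sfN hw we).
Qed.

Lemma compact_nm_bounded (A : set C) (f : C -> C) : compact A ->
  (forall z, A z -> f @ z --> f z) -> exists B : R, forall z, A z -> nm (f z) <= B.
Proof.
move=> cA cf; have [A0|A0] := pselect (A !=set0); last first.
  by exists 0 => z Az; exfalso; apply: A0; exists z.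
have [|m mA h] := @compact_EVT_max C R (fun z => nm (f z)) A A0 cA.
  apply: continuous_in_subspaceT => z /set_mem Az.
  by apply: cvg_nm; exact: cf.
by exists (nm (f m)) => z Az; apply: h; exact: mem_set.
Qed.

(** If |y| is large, both representatives in the strip lie high up, where equal values of j force
    equal nomes, that is, an integer translation. *)
Lemma collision_bounded : exists B : R, forall y, collision y -> nm y <= B.
Proof.
have [Y Y0 hY] := j_cusp_injective hc jE.
have [|B hB] := compact_nm_bounded (@compact_strip_below Y) (f := j).
  by move=> z /strip_below_uhp; exact: j_continuous.
exists B => y [z [w [hz hw jz jw neq]]]; rewrite leNgt; apply/negP => By.
have [z' zs ze] := reduce_to_strip sfN hz; have [w' ws we] := reduce_to_strip sfN hw.
have jz' : j z' = y by rewrite -(equivalent_j hz ze).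
have jw' : j w' = y by rewrite -(equivalent_j hw we).
have high v : fundamental_strip N v -> j v = y -> Y < complex.Im v.
  move=> vs jv; rewrite ltNge; apply/negP => vY.
  by move: By; rewrite -jv ltNge => /negP; apply; exact: hB.
have nz := hY _ _ (high _ zs jz') (high _ ws jw'); rewrite jz' jw' in nz.
have [n wE] := nome_eq (nz erefl).
apply: neq; apply: (equivalent_trans sfN hz ze).
have uz' := equivalent_uhp hz ze.
apply: (equivalent_trans sfN uz' _ (equivalent_sym sfN hw we)).
by exists (translation R n); [exact: Gamma_translation|rewrite mobius_translation].
Qed.

(** The inverse of g brings w' back near z, where j is injective because j' does not vanish
    there. *)
Lemma equivalent_near z w : uhp z -> uhp w -> equivalent N z w -> j1 c z != 0 ->
  exists2 e : R, 0 < e & forall z' w', nm (z' - z) < e -> nm (w' - w) < e ->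
    j z' = j w' -> equivalent N z' w'.
Proof.
move=> hz hw [g Gg gz] jz; have hg := Gamma_unimodular sfN Gg.
have [e e0 he] := j_locally_injective hc jE hz jz.
have hh := unimodular_adj hg; have Gh := Gamma_adj sfN Gg.
have hwz : mobius (adj2 g) w = z by rewrite -gz mobius_adjK.
have /near_nmP[d d0 hd] : \forall w' \near w, uhp w' /\ nm (mobius (adj2 g) w' - z) < e.
  apply: filterI; first exact: open_uhp.
  have /cvg_nmP := is_derive_continuous (is_derive_mobius hh hw).
  by rewrite hwz; apply.
have /near_nmP[d' d'0 hd'] := open_uhp hz.
exists (Num.min e (Num.min d d')); first by rewrite !lt_min e0 d0.
move=> z' w'; rewrite !lt_min => /andP[z1 /andP[_ /hd' uz']] /andP[_ /andP[/hd[uw' w1] _]] jj.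
have -> : z' = mobius (adj2 g) w' by apply: he => //; rewrite jinv.
by apply: (equivalent_sym sfN uw'); exists (adj2 g).
Qed.

(** A tube argument over pairs in the truncated strip: near each pair either one value stays off y0,
    or the points are equivalent and remain so by [equivalent_near]. Compactness makes the
    neighbourhood of y0 uniform. *)
Lemma collision_closed y0 : ~ collision y0 -> (forall z, uhp z -> j z = y0 -> j1 c z != 0) ->
  exists2 d : R, 0 < d & forall y, nm (y - y0) < d -> ~ collision y.
Proof.
(* All y within 1 of y0 have modulus less than |y0| + 1, so a single height [Y] serves them. *)
move=> nc ncrit; have [Y Y0 hY] := j_cusp hc jE (nm y0 + 1).
pose K := strip_below Y.
have cK : compact (K `*` K) by apply: compact_setX; exact: compact_strip_below.
pose P y (p : C * C) := j p.1 = y -> j p.2 = y -> equivalent N p.1 p.2.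
have avoid z : uhp z -> j z <> y0 -> exists2 e : R, 0 < e & forall z' y,
    nm (z' - z) < e -> nm (y - y0) < e -> j z' <> y.
  move=> hz ne; pose D := nm (j z - y0).
  have D0 : 0 < D by rewrite nm_gt0 subr_eq0; apply/eqP.
  have /near_nmP[e e0 he] : \forall z' \near z, nm (j z' - j z) < D / 2.
    by have /cvg_nmP := j_continuous hz; apply; rewrite divr_gt0.
  exists (Num.min e (D / 2)); first by rewrite lt_min e0 divr_gt0.
  move=> z' y; rewrite !lt_min => /andP[/he h1 _] /andP[_ h2] jz'.
  have := ler_nm_distD (j z) y0 y; rewrite -/D -jz' (nmBC (j z)).
  move: h1 h2; rewrite -jz'.
  by move: (nm (j z' - j z)) (nm (j z' - y0)) => a b; lra.
have : \forall y \near y0, K `*` K `<=` P y.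
  apply: ((compact_near_coveringP (K `*` K)).1 cK C (nbhs y0) P (nbhs_filter y0)).
  move=> -[z w] [/= zK wK].
  have uz := strip_below_uhp zK; have uw := strip_below_uhp wK.
  have [e e0 he] : exists2 e : R, 0 < e & forall z' w' y, nm (z' - z) < e ->
      nm (w' - w) < e -> nm (y - y0) < e -> P y (z', w').
    have [jz|/eqP jz] := eqVneq (j z) y0; last first.
      have [e e0 he] := avoid z uz jz; exists e => // z' w' y h1 _ h3 jz'.
      by exfalso; exact: (he z' y h1 h3).
    have [jw|/eqP jw] := eqVneq (j w) y0; last first.
      have [e e0 he] := avoid w uw jw; exists e => // z' w' y _ h2 h3 _ jw'.
      by exfalso; exact: (he w' y h2 h3).
    have zw : equivalent N z w.
      by apply: contrapT => ne; apply: nc; exists z, w.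
    have [e e0 he] := equivalent_near uz uw zw (ncrit z uz jz).
    exists e => // z' w' y h1 h2 _ /= jz' jw'; apply: he => //; by rewrite jz' jw'.
  exists ([set p : C * C | nm (p.1 - z) < e /\ nm (p.2 - w) < e],
          [set y | nm (y - y0) < e]) => /=.
    split; last by apply/near_nmP; exists e.
    exists ([set z' | nm (z' - z) < e], [set w' | nm (w' - w) < e]) => /=.
      by split; apply/near_nmP; exists e.
    by move=> [z' w'] [].
  by move=> [[z' w'] y] [[/= h1 h2] h3]; exact: he.
move=> /near_nmP[d d0 hd]; exists (Num.min d 1); first by rewrite lt_min d0 ltr01.
move=> y; rewrite lt_min => /andP[/hd yd y1] coll.
have yB : nm y < nm y0 + 1.
  have := ler_nm_dist y y0; move: y1.
  by move: (nm (y - y0)) (nm y) (nm y0) => a b d'; lra.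
have [z [w [zK wK jz jw ne]]] := collision_strip yB coll hY.
by apply: ne; exact: (yd (z, w) (conj zK wK)).
Qed.

(* On a ray from y that avoids the critical values, the last collision would
   contradict openness. *)
Lemma no_collision y : ~ collision y.
Proof.
move=> cy; have [s hs] := critical_values_finite; have [B hB] := collision_bounded.
pose slope v : R := complex.Im (v - y) / complex.Re (v - y).
(* The ray from y has a slope larger than that of every critical value seen from y, so it meets none
   of them for t > 0. A zero denominator in [slope] is harmless, since points of the ray have real
   part t after subtracting y. *)
pose k : R := 1 + \sum_(v <- s) `|slope v|.
pose pt (t : R) : C := y + t%:C * (1 +i* k).
have ptI t : complex.Re (pt t - y) = t /\ complex.Im (pt t - y) = t * k.
  by rewrite /pt addrAC subrr add0r cReM cImM /= !mul0r subr0 addr0 mulr1.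
have nmpt t t' : nm (pt t - pt t') = `|t - t'| * nm (1 +i* k : C).
  by rewrite -nm_real -nmM; congr nm; rewrite /pt rmorphB /=; ring.
have k0 : 0 < nm (1 +i* k : C) by rewrite nm_gt0 eq_complex /= oner_eq0.
have k1 : 1 <= nm (1 +i* k : C).
  by apply: le_trans (ler_Re_nm _); rewrite /= normr1.
have avoid t : 0 < t -> pt t \notin s.
  move=> t0; apply/negP => ps'; have [e1 e2] := ptI t.
  have : slope (pt t) = k by rewrite /slope e1 e2 mulrC mulKf// gt_eqF.
  move=> sk; have : `|slope (pt t)| <= \sum_(v <- s) `|slope v|.
    by rewrite (big_rem (pt t))//= lerDl sumr_ge0.
  rewrite sk => /(le_trans (ler_norm k)).
  by rewrite /k gerDr ler10.
pose T := [set t : R | 0 <= t /\ collision (pt t)].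
have pt0 : pt 0 = y by rewrite /pt mul0r addr0.
have T0 : T 0 by split; rewrite ?pt0.
have Tub : has_ubound T.
  exists (B + nm y) => t [t0 /hB h]; have := ler_nm_dist (pt t - pt 0) (- pt 0).
  rewrite opprK subrK pt0 nmN -{1}pt0 nmpt subr0 ger0_norm// => h2.
  have : t <= t * nm (1 +i* k : C) by rewrite ler_peMr.
  by move: h h2; move: (nm (pt t)) (t * _) => a b; lra.
have hT : has_sup T by split; [exists 0|].
have s0 : 0 <= sup T by exact: ub_le_sup.
(* The supremum is attained: either it is 0, where y itself is a collision, or its point is not a
   critical value and [collision_closed] applies. *)
have cs : collision (pt (sup T)).
  have [se|sne] := eqVneq (sup T) 0; first by rewrite se pt0.
  have sp : 0 < sup T by rewrite lt_neqAle eq_sym sne.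
  apply: contrapT => nc; have [|d d0 hd] := collision_closed nc.
    move=> z hz jz; apply/eqP => j10; have := hs _ hz j10.
    by rewrite jz (negbTE (avoid _ sp)).
  have [|t [t0 ct] lt_t] := sup_adherent (eps := d / nm (1 +i* k : C)) _ hT.
    by rewrite divr_gt0.
  apply: (hd _ _ ct); rewrite nmpt -ltr_pdivlMr//.
  have ts : t <= sup T by exact: ub_le_sup.
  by rewrite ler0_norm ?subr_le0// opprB ltrBlDl -ltrBlDr.
have [d d0 hd] := collision_open cs.
pose t := sup T + d / (2 * nm (1 +i* k : C)).
have dk : 0 < d / (2 * nm (1 +i* k : C)) by rewrite divr_gt0// mulr_gt0.
have Tt : T t.
  split; first by rewrite addr_ge0// ltW.
  apply: hd; rewrite nmpt /t addrAC subrr add0r ger0_norm ?ltW//.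
  by rewrite invfM mulrA divfK ?gt_eqF// ltr_pdivrMr// ltr_pMr// ltr1n.
have := ub_le_sup Tub Tt; rewrite /t gerDl leNgt; by rewrite dk.
Qed.

Lemma j_injective z w : uhp z -> uhp w -> j z = j w -> equivalent N z w.
Proof.
move=> hz hw e; apply: contrapT => ne; apply: (@no_collision (j z)).
by exists z, w.
Qed.

End Global.

(** * Critical points are the elliptic points *)

Section Elliptic.
Variables (R : realType) (N : nat).
Local Notation C := (Cplx R).
Implicit Types (q z w y : C) (g : 'M[R]_2).
Variables (c : nat -> C) (j : C -> C).
Hypothesis sfN : squarefree N.
Hypothesis hc : pscoef c.
Hypothesis jE : forall z, uhp z -> j z = laurent c (nome z).
Hypothesis jinv : forall g z, Gamma0plus N g -> uhp z -> j (mobius g z) = j z.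

(** Differentiating j (g z) = j z at a fixed point gives j'(z) = 0 or cocycle^2 = 1. In the latter
    case c = 0 and a = d = 1 or -1, so the trace has absolute value 2. *)
Lemma elliptic_critical z : elliptic_point N z -> j1 c z = 0.
Proof.
move=> [hz [g [Gg tr gz]]]; have hg := Gamma_unimodular sfN Gg.
have d0 := is_derive_j hc jE hz.
have d1 : is_derive (mobius g z) (1 : C) j (j1 c z) by rewrite gz.
have d2 := is_derive1_chain (is_derive_mobius hg hz) d1.
have d3 : is_derive z (1 : C) (j \o mobius g) (j1 c z).
  apply: cderiv_near d0.
  by apply: filterS (open_uhp hz) => v hv /=; rewrite jinv.
have e := cderiv_unique d2 d3; apply/eqP/negPn/negP => j0.
have {e} e : (cocycle g z ^+ 2)^-1 = 1 by apply: (mulfI j0); rewrite mulr1.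
have y0 : 0 < complex.Im z := hz.
have : (cocycle g z == 1) || (cocycle g z == -1).
  by rewrite -sqrf_eq1 -invr_eq1 e.
have im0 (k : R) : cocycle g z = k%:C -> g 1 0 = 0 /\ g 1 1 = k.
  move=> ce; have := congr1 (@complex.Im R) ce; have := congr1 (@complex.Re R) ce.
  rewrite /cocycle cReD cImD cReM cImM /= !mul0r subr0 !addr0 => h1 /eqP.
  rewrite mulf_eq0 (gt_eqF y0) orbF => /eqP h2; split => //.
  by move: h1; rewrite h2 mul0r add0r.
have trE : \tr g = g 0 0 + g 1 1.
  rewrite /mxtrace !big_ord_recl big_ord0 addr0.
  by congr (g _ _ + g _ _); apply: val_inj.
have contra (k : R) : k ^+ 2 = 1 -> cocycle g z = k%:C -> False.
  move=> k2 /im0[h1 h2]; move: hg; rewrite /unimodular h1 mulr0 subr0 h2 => h3.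
  have h4 : g 0 0 = k by rewrite -[LHS]mulr1 -k2 expr2 mulrA h3 mul1r.
  move: tr; rewrite trE h4 h2 -(@ltr_pXn2r _ 2)// ?nnegrE// real_normK ?num_real//.
  have -> : (k + k) ^+ 2 = 4 * k ^+ 2 by ring.
  by rewrite k2; lra.
case/orP => /eqP ce.
  by apply: (contra 1); rewrite ?expr1n// ce rmorph1.
by apply: (contra (-1)); rewrite ?sqrrN ?expr1n// ce rmorphN rmorph1.
Qed.

(** Order m > 1 gives distinct w, w' near z with equal values, hence g with g w = w'. Proper
    discontinuity yields g z = z, and g moves w, so [mobius_fixed] leaves only the elliptic case. *)
Lemma critical_elliptic z : uhp z -> j1 c z = 0 -> elliptic_point N z.
Proof.
move=> hz e0; split => //; have [m [l ho]] := j_has_order hc jE hz.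
have m1 : (1 < m)%N.
  by apply: (derive0_order_gt1 (f := j)) ho; rewrite -e0; exact: is_derive_j.
have [e ep he] := properly_discontinuous sfN hz hz.
have [d d0 hd] := (near_nmP _ _).1 (open_uhp hz).
have [|w [w' [h1 h2 ne jj]]] := not_locally_injective (near_j_has_order hc jE hz) ho m1 (e := Num.min e d).
  by rewrite lt_min ep.
move: h1 h2; rewrite !lt_min => /andP[w1 /hd uw] /andP[w2 /hd uw'].
have [g Gg gw] := j_injective sfN hc jE jinv uw uw' jj.
have gz : mobius g z = z by apply: (he g w Gg w1); rewrite gw.
exists g; split => //; have hg := Gamma_unimodular sfN Gg.
have [//|id] := mobius_fixed hg hz gz.
by move: ne; rewrite -gw id eqxx.
Qed.

Lemma elliptic_representatives_exist : exists E : seq C, elliptic_representatives N E.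
Proof.
have [s hs] := critical_values_finite sfN hc jE jinv.
(* One critical point is selected over each critical value. Covering only the values in [s] is what
   permits induction on [s]. *)
have [E [h1 h2 h3 h4]] : exists E : seq C, [/\ forall e, e \in E -> uhp e /\ j1 c e = 0,
    forall z, uhp z -> j1 c z = 0 -> j z \in s -> exists2 e, e \in E & j z = j e,
    uniq E & {in E &, injective j}].
  elim: s {hs} => [|y s [E [h1 h2 h3 h4]]]; first by exists [::]; split.
  have [[z [hz ez jz nE]]|no] := pselect (exists z, [/\ uhp z, j1 c z = 0, j z = y &
      forall e, e \in E -> j e != y]).
    exists (z :: E); split.
    - by move=> e; rewrite inE => /orP[/eqP ->|/h1].
    - move=> w hw ew; rewrite inE => /orP[/eqP jw|/(h2 _ hw ew)[e eE je]].
        by exists z; rewrite ?mem_head// jw jz.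
      by exists e => //; rewrite inE eE orbT.
    - rewrite /= h3 andbT; apply/negP => /nE; by rewrite jz eqxx.
    - move=> a b; rewrite !inE => /orP[/eqP ->|aE] /orP[/eqP ->|bE] //; last exact: h4.
        by rewrite jz => e; have := nE b bE; rewrite -e eqxx.
      by rewrite jz => e; have := nE a aE; rewrite e eqxx.
  exists E; split => // w hw ew; rewrite inE => /orP[/eqP jw|/(h2 _ hw ew)//].
  apply: contrapT => ne; apply: no; exists w; split => // e eE; apply/eqP => je.
  by apply: ne; exists e => //; rewrite jw je.
exists E; split => //.
- by move=> e /h1[ue ce]; exact: critical_elliptic.
- move=> z ez; have [uz _] := ez; have cz := elliptic_critical ez.
  have [e eE je] := h2 z uz cz (hs _ uz cz); exists e => //.
  by have [ue _] := h1 e eE; exact: (j_injective sfN hc jE jinv uz ue je).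
- move=> e e' eE e'E ee; have [ue _] := h1 e eE; apply: h4 => //.
  exact: (equivalent_j jinv ue ee).
Qed.

Lemma critical_value_elliptic (E : seq C) : elliptic_representatives N E ->
  [/\ forall e, e \in E -> uhp e /\ j1 c e = 0,
      forall z, uhp z -> j1 c z = 0 -> exists2 e, e \in E & j z = j e,
      forall z e, uhp z -> e \in E -> j z = j e -> j1 c z = 0 &
      uniq (map j E)].
Proof.
move=> [h1 h2 h3 h4]; have k1 e : e \in E -> uhp e /\ j1 c e = 0.
  by move=> /h1 he; split; [case: he|exact: elliptic_critical].
split => //.
- move=> z hz cz; have [e eE ze] := h2 z (critical_elliptic hz cz).
  by exists e => //; exact: (equivalent_j jinv hz ze).
- move=> z e hz eE je; have [ue ce] := k1 e eE.
  have ze := j_injective sfN hc jE jinv ue hz (esym je).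
  exact: (j1_equivalent sfN hc jE jinv ue ze ce).
- rewrite map_inj_in_uniq// => e e' eE e'E je.
  have [ue _] := k1 e eE; have [ue' _] := k1 e' e'E.
  by apply: h4 => //; exact: (j_injective sfN hc jE jinv ue ue' je).
Qed.

End Elliptic.

(** * The Schwarzian as a rational function of j *)

Section SchwarzianModular.
Variables (R : realType) (N : nat).
Local Notation C := (Cplx R).
Implicit Types (q z w y : C) (g : 'M[R]_2).
Variables (c : nat -> C) (j : C -> C).
Hypothesis sfN : squarefree N.
Hypothesis hc : pscoef c.
Hypothesis jE : forall z, uhp z -> j z = laurent c (nome z).
Hypothesis jinv : forall g z, Gamma0plus N g -> uhp z -> j (mobius g z) = j z.

Lemma schw_field (t q a b d : C) : t != 0 -> q != 0 -> a != 0 ->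
  (d * a - 3 / 2 * b ^+ 2) / a ^+ 4 - (2 * q ^+ 2 * a ^+ 2)^-1 =
  ((t ^+ 3 * (q * a + 3 * (q ^+ 2 * b) + q ^+ 3 * d)) * (t * (q * a)) -
    3 / 2 * (t ^+ 2 * (q * a + q ^+ 2 * b)) ^+ 2) / (t * (q * a)) ^+ 4.
Proof. by move=> t0 q0 a0; field; rewrite t0 q0 a0. Qed.

(** The right side is S(j)/(j')^2 written out; passing from q to z produces the last term of
    [schw_q]. *)
Lemma schwE z : j1 c z != 0 ->
  schw c z = (j3 c z * j1 c z - 3 / 2 * j2 c z ^+ 2) / j1 c z ^+ 4.
Proof.
move=> jz; have l0 : laurent1 c (nome z) != 0.
  by apply: contra_neq jz => e; rewrite /j1 e !mulr0.
exact: (schw_field _ _ (tau_neq0 R) (nome_neq0 z) l0).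
Qed.

Lemma schw_field2 (x y t : C) : x != 0 ->
  ((t * x - y * y) / x ^+ 2 - 2^-1 * (y / x) ^+ 2) / x ^+ 2 =
  (t * x - 3 / 2 * y ^+ 2) / x ^+ 4.
Proof. by move=> x0; field. Qed.

Lemma schwarzianE z : uhp z -> derive1 j z != 0 ->
  schwarzian j z / derive1 j z ^+ 2 = schw c z.
Proof.
move=> hz; have d1 w : uhp w -> derive1 j w = j1 c w.
  by move=> hw; exact: derive1_val (is_derive_j hc jE hw).
rewrite d1// => jz; rewrite schwE//.
have d2 w : uhp w -> derive1n 2 j w = j2 c w.
  move=> hw; apply: derive1_val; apply: (near_uhp_deriv hw d1).
  exact: is_derive_j1.
have du : is_derive z (1 : C) (fun w => derive1n 2 j w / derive1 j w)
   ((j3 c z * j1 c z - j2 c z * j2 c z) / j1 c z ^+ 2).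
  apply: (@near_uhp_deriv _ _ (fun w => j2 c w * (j1 c w)^-1) z _ hz).
    by move=> w hw; rewrite d1// d2.
  have h := cderivM (is_derive_j2 hc hz) (cderivV jz (is_derive_j1 hc hz)).
  apply: (is_derive_cast h).
  by move: (j1 c z) (j2 c z) (j3 c z) jz => x y t x0; field.
by rewrite /schwarzian (derive1_val du) d1// d2//; exact: schw_field2.
Qed.

Lemma derivable_laurent3 q : q != 0 -> nm q < 1 -> exists l : C, is_derive q (1 : C) (laurent3 c) l.
Proof.
move=> q0 q1.
have -> : laurent3 c = fun w => -1 * (6 * w ^- 4) + ps (dc c 3) w.
  by apply: funext => w; rewrite /laurent3 mulN1r.
by eexists; exact: (cderivD (cderivMl (-1) (cderivMl 6 (cderiv_invX 4 q0)))
  (ps_is_derive (pscoef_dc hc 3) q1)).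
Qed.

Lemma derivable_schw z : uhp z -> j1 c z != 0 -> exists l : C, is_derive z (1 : C) (schw c) l.
Proof.
move=> hz jz; have q0 := nome_neq0 z; have q1 := nm_nome_lt1 hz.
have l0 : laurent1 c (nome z) != 0.
  by apply: contra_neq jz => e; rewrite /j1 e !mulr0.
have [l d3] := derivable_laurent3 q0 q1.
have d1 := is_derive_laurent1 hc q0 q1; have d2 := is_derive_laurent2 hc q0 q1.
have a0 : laurent1 c (nome z) ^+ 4 != 0 by rewrite expf_neq0.
have b0 : 2 * nome z ^+ 2 * laurent1 c (nome z) ^+ 2 != 0.
  by apply: mulf_neq0 (expf_neq0 _ l0); apply: mulf_neq0 (expf_neq0 _ q0); rewrite pnatr_eq0.
have e1 := cderivV (f := fun q => laurent1 c q ^+ 4) a0 (cderivX 4 d1).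
have e2 := cderivB (cderivM d3 d1) (cderivMl (3 / 2) (cderivX 2 d2)).
have e3 := cderivV (f := fun q => 2 * q ^+ 2 * laurent1 c q ^+ 2) b0
  (cderivM (cderivMl 2 (cderivX 2 (cderiv_id (nome z)))) (cderivX 2 d1)).
have e4 := cderivB (cderivM e2 e1) e3.
by eexists; exact: (is_derive1_chain (nome_derive z) e4).
Qed.

Lemma schw_meromorphic : meromorphic_uhp (schw c).
Proof.
move=> z hz; have [nz [m [l [[m0 l0 ho] lim]]]] := j_local hc jE hz.
have F := dnbhs_filter z.
have c1 := ccvgM F lim (ccvgX F 2 (ccvgV F l0 ho)).
set L := _ * _ in c1.
(* The factor (w - z)^(2m) already makes the function bounded; two further factors make it
   differentiable at z with derivative 0, whatever value [schw] takes there. *)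
exists (2 * m).+2%N, (fun w => (w - z) ^+ (2 * m).+2 * schw c w); split; last by near=> w.
have jne : \forall w \near z^', j w != j z.
  have n3 : \forall q \near z^', q != z by apply/near_dnmP; exists 1.
  apply: filterS (ccvg_neq0 F l0 ho) => w; apply: contra_neq => ->.
  by rewrite subrr mul0r.
have bd : \forall w \near z^', nm ((w - z) ^+ (2 * m) * schw c w) < nm L + 1.
  have /cvg_nmP/(_ 1 ltr01) := c1; have n3 : \forall q \near z^', q != z.
    by apply/near_dnmP; exists 1.
  move=> h; apply: filterS2 h (filterI jne n3) => w h [jw wz].
  have jd : j w - j z != 0 by rewrite subr_eq0.
  have sd : (w - z) ^+ m != 0 by rewrite expf_neq0// subr_eq0.
  have E : schw c w * (j w - j z) ^+ 2 * (((j w - j z) / (w - z) ^+ m)^-1) ^+ 2 =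
     (w - z) ^+ (2 * m) * schw c w.
    rewrite invf_div expr_div_n [(2 * m)%N]mulnC exprM.
    by rewrite mulrA mulrAC -[schw c w * _ / _]mulrA divff ?expf_neq0// mulr1 mulrC.
  move: h; rewrite E; have := ler_nm_dist ((w - z) ^+ (2 * m) * schw c w) L.
  by move: (nm _) (nm _) (nm L) => x y t; lra.
have dz : is_derive z (1 : C) (fun w => (w - z) ^+ (2 * m).+2 * schw c w) 0.
  apply/is_derive_nmP => e e0; have /near_dnmP[d d0 hd] := bd.
  have K0 : 0 < nm L + 1 by rewrite ltr_wpDl// nm_ge0.
  exists (Num.min d (e / (nm L + 1))); first by rewrite lt_min d0 divr_gt0.
  move=> w; rewrite lt_min => /andP[wd we].
  have [->|wz] := eqVneq w z; first by rewrite !subrr mulr0 subrr nm0 mulr0.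
  have h := hd w wz wd.
  have -> : (w - z) ^+ (2 * m).+2 * schw c w - (z - z) ^+ (2 * m).+2 * schw c z - 0 * (w - z) =
      (w - z) * ((w - z) * ((w - z) ^+ (2 * m) * schw c w)).
    move: (schw c w) (schw c z) (w - z) (2 * m)%N => x y t n.
    have z0 : (z - z) ^+ n.+2 = 0 by rewrite subrr expr0n.
    by rewrite z0 !mul0r !subr0 !exprS !mulrA.
  rewrite nmM mulrC; apply: ler_wpM2r; first exact: nm_ge0.
  rewrite nmM; apply: (@le_trans _ _ (nm (w - z) * (nm L + 1))).
    by apply: ler_wpM2l; [exact: nm_ge0|exact: ltW].
  by rewrite -ler_pdivlMr// ltW.
have /near_dnmP[d1 d10 h1] := nz; have /near_nmP[d2 d20 h2] := open_uhp hz.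
apply/near_nmP; exists (Num.min d1 d2); first by rewrite lt_min d10.
move=> w; rewrite lt_min => /andP[w1 w2].
have [->|wz] := eqVneq w z; first by case: dz.
have [k dk] := derivable_schw (h2 w w2) (h1 w wz w1).
have ds : is_derive w (1 : C) (fun w => w - z) (1 - 0) := cderivB (cderiv_id w) (cderiv_cst w z).
by case: (cderivM (cderivX (2 * m).+2 ds) dk).
Unshelve. all: by end_near. Qed.

(** Successive differentiation of j (g z) = j z. The terms with the lower left entry of g cancel in
    the Schwarzian combination, as [schw_invariant_field] checks. *)
Lemma j_mobius g z : Gamma0plus N g -> uhp z -> [/\
  j1 c (mobius g z) = cocycle g z ^+ 2 * j1 c z,
  j2 c (mobius g z) = cocycle g z ^+ 4 * j2 c z + 2 * (g 1 0)%:C * cocycle g z ^+ 3 * j1 c z &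
  j3 c (mobius g z) = cocycle g z ^+ 6 * j3 c z + 6 * (g 1 0)%:C * cocycle g z ^+ 5 * j2 c z +
     6 * (g 1 0)%:C ^+ 2 * cocycle g z ^+ 4 * j1 c z].
Proof.
move=> Gg hz0; have hg := Gamma_unimodular sfN Gg; pose k : C := (g 1 0)%:C.
have dC w : is_derive w (1 : C) (cocycle g) k.
  apply: (is_derive_cast (cderivD (cderivMl k (cderiv_id w)) (cderiv_cst w (g 1 1)%:C))).
  by rewrite mulr1 addr0.
have A w : uhp w -> j1 c (mobius g w) = cocycle g w ^+ 2 * j1 c w.
  move=> hz; have d1 := is_derive_j hc jE (mobius_uhp hg hz).
  have d2 := is_derive1_chain (is_derive_mobius hg hz) d1.
  have d3 : is_derive w (1 : C) (j \o mobius g) (j1 c w).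
    apply: cderiv_near (is_derive_j hc jE hz).
    by apply: filterS (open_uhp hz) => v hv /=; rewrite jinv.
  have c0 : cocycle g w ^+ 2 != 0 by rewrite expf_neq0// cocycle_neq0.
  by rewrite -(cderiv_unique d2 d3) mulrC divfK.
have B w : uhp w -> j2 c (mobius g w) =
    cocycle g w ^+ 4 * j2 c w + 2 * k * cocycle g w ^+ 3 * j1 c w.
  move=> hz; have d1 := is_derive_j1 hc (mobius_uhp hg hz).
  have d2 := is_derive1_chain (is_derive_mobius hg hz) d1.
  have d3 := near_uhp_deriv hz A (cderivM (cderivX 2 (dC w)) (is_derive_j1 hc hz)).
  have c0 : cocycle g w ^+ 2 != 0 by rewrite expf_neq0// cocycle_neq0.
  have := cderiv_unique d2 d3; move/(canRL (divfK c0)) => ->.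
  by move: (cocycle g w) (j1 c w) (j2 c w) => a x y; rewrite /=; ring.
split; [exact: A|exact: B|].
have d1 := is_derive_j2 hc (mobius_uhp hg hz0).
have d2 := is_derive1_chain (is_derive_mobius hg hz0) d1.
have d3 := near_uhp_deriv hz0 B (cderivD (cderivM (cderivX 4 (dC z)) (is_derive_j2 hc hz0))
  (cderivM (cderivMl (2 * k) (cderivX 3 (dC z))) (is_derive_j1 hc hz0))).
have c0 : cocycle g z ^+ 2 != 0 by rewrite expf_neq0// cocycle_neq0.
have := cderiv_unique d2 d3; move/(canRL (divfK c0)) => ->.
by move: (cocycle g z) (j1 c z) (j2 c z) (j3 c z) => a x y t; rewrite /= -/k; ring.
Qed.

Lemma schw_invariant_field (a k x y t : C) : a != 0 -> x != 0 ->
  ((a ^+ 6 * t + 6 * k * a ^+ 5 * y + 6 * k ^+ 2 * a ^+ 4 * x) * (a ^+ 2 * x) -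
    3 / 2 * (a ^+ 4 * y + 2 * k * a ^+ 3 * x) ^+ 2) / (a ^+ 2 * x) ^+ 4 =
  (t * x - 3 / 2 * y ^+ 2) / x ^+ 4.
Proof. by move=> a0 x0; field; rewrite a0 x0. Qed.

Lemma schw_invariant g z : Gamma0plus N g -> uhp z -> j1 c z != 0 ->
  schw c (mobius g z) = schw c z.
Proof.
move=> Gg hz jz; have [e1 e2 e3] := j_mobius Gg hz.
have c0 := cocycle_neq0 (Gamma_unimodular sfN Gg) hz.
have jg : j1 c (mobius g z) != 0 by rewrite e1 mulf_neq0// expf_neq0.
rewrite (schwE jg) (schwE jz) e1 e2 e3.
move: (cocycle g z) ((g 1 0)%:C) (j1 c z) (j2 c z) (j3 c z) c0 jz.
by move=> a k x y t; exact: schw_invariant_field.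
Qed.

Lemma ps_term_cusp b n : pscoef b -> (fun q => q ^+ n.+1 * ps b q) @ (0 : C) --> (0 : C).
Proof.
move=> hb; have F := nbhs_filter (0 : C).
have h : ps b @ (0 : C) --> ps b 0 by apply: ps_continuous => //; rewrite nm0.
have cid : (fun q : C => q) @ (0 : C) --> (0 : C) by exact: cvg_id.
apply: (ccvg_congr (ccvgM F (ccvgX F n.+1 cid) h)).
by rewrite expr0n mul0r.
Qed.

Lemma cusp_field (q a b d : C) : q != 0 -> a != 0 ->
  q ^+ 2 * ((d * a - 3 / 2 * b ^+ 2) * (a ^+ 4)^-1 - (2 * a ^+ 2)^-1) =
  (q ^- 4 * d * (q ^- 2 * a) - 3 / 2 * (q ^- 3 * b) ^+ 2) / (q ^- 2 * a) ^+ 4 -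
  (2 * q ^+ 2 * (q ^- 2 * a) ^+ 2)^-1.
Proof. by move=> q0 a0; field; rewrite q0 a0. Qed.

(** Rescaled by q^2, q^3, q^4 the three derivatives tend to -1, 2, -6. The Schwarzian part (-6)(-1)
    - (3/2) 2^2 is 0, and the nome contributes -1/2. *)
Lemma schw_cusp : exists2 f : C -> C, f @ (0 : C)^' --> (- (1 / 2) : C) &
  \forall q \near (0 : C)^', schw_q c q = q ^+ 2 * f q.
Proof.
have F := nbhs_filter (0 : C).
pose al q : C := -1 + q ^+ 2 * ps (dc c 1) q.
pose be q : C := 2 + q ^+ 3 * ps (dc c 2) q.
pose ga q : C := -6 + q ^+ 4 * ps (dc c 3) q.
have cal : al @ (0 : C) --> (-1 : C).
  by apply: (ccvg_congr (ccvgD F (ccvg_cst F (-1)) (ps_term_cusp 1 (pscoef_dc hc 1)))); rewrite addr0.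
have cbe : be @ (0 : C) --> (2 : C).
  by apply: (ccvg_congr (ccvgD F (ccvg_cst F 2) (ps_term_cusp 2 (pscoef_dc hc 2)))); rewrite addr0.
have cga : ga @ (0 : C) --> (-6 : C).
  by apply: (ccvg_congr (ccvgD F (ccvg_cst F (-6)) (ps_term_cusp 3 (pscoef_dc hc 3)))); rewrite addr0.
have a4 : (-1 : C) ^+ 4 != 0 by rewrite expf_neq0// oppr_eq0 oner_eq0.
have a2 : 2 * (-1 : C) ^+ 2 != 0 by rewrite sqrrN expr1n mulr1 pnatr_eq0.
have lim := ccvgB F (ccvgM F (ccvgB F (ccvgM F cga cal) (ccvgMl F (3 / 2) (ccvgX F 2 cbe)))
   (ccvgV F a4 (ccvgX F 4 cal))) (ccvgV F a2 (ccvgMl F 2 (ccvgX F 2 cal))).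
exists (fun q => (ga q * al q - 3 / 2 * be q ^+ 2) * (al q ^+ 4)^-1 - (2 * al q ^+ 2)^-1).
  apply: cvg_dnbhs; apply: (ccvg_congr lim); by field.
have m1 : (-1 : C) != 0 by rewrite oppr_eq0 oner_eq0.
have n1 : \forall q \near (0 : C)^', al q != 0 := near_dnbhsW (ccvg_neq0 F m1 cal).
have n0 : \forall q \near (0 : C)^', q != 0 by apply/near_dnmP; exists 1.
apply: filterS2 n1 n0 => q al0 q0.
have e1 : laurent1 c q = q ^- 2 * al q.
  by rewrite /laurent1 /al mulrDr mulrN1 mulrA mulVf ?mul1r// expf_neq0.
have e2 : laurent2 c q = q ^- 3 * be q.
  by rewrite /laurent2 /be mulrDr mulrA mulVf ?expf_neq0// mul1r mulrC.
have e3 : laurent3 c q = q ^- 4 * ga q.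
  by rewrite /laurent3 /ga mulrDr mulrA mulVf ?expf_neq0// mul1r mulrN [6 * _]mulrC.
by rewrite /schw_q e1 e2 e3; apply/esym; exact: cusp_field.
Qed.

Lemma laurent_cusp : (fun q => q * laurent c q) @ (0 : C)^' --> (1 : C).
Proof.
have F := nbhs_filter (0 : C).
have h := ccvgD F (ccvg_cst F 1) (ps_term_cusp 0 hc).
apply: (ccvg_near (dnbhs_filter 0) _ (cvg_dnbhs (ccvg_congr h (addr0 1)))).
have n0 : \forall q \near (0 : C)^', q != 0 by apply/near_dnmP; exists 1.
by apply: filterS n0 => q q0; rewrite /laurent expr1 mulrDr divff.
Qed.

Lemma modular_function_schw : modular_function N (schw c).
Proof.
split.
- exact: schw_meromorphic.
- move=> g z Gg hz; have [nz _] := j_local hc jE hz.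
  by apply: filterS2 nz (near_dnbhsW (open_uhp hz)) => w jw hw; exact: schw_invariant.
have [f fl fE] := schw_cusp.
have F0 := dnbhs_filter (0 : C).
have F := nbhs_filter (0 : C).
have cid : (fun q : C => q) @ (0 : C) --> (0 : C) by exact: cvg_id.
have lim := ccvgM F0 (cvg_dnbhs (ccvgX F 2 cid)) fl.
rewrite expr0n mul0r in lim.
have /cvg_nmP/(_ 1 ltr01) bd := lim.
have /near_dnmP[d d0 hd] : \forall q \near (0 : C)^', nm (schw_q c q) < 1.
  by apply: filterS2 bd fE => q; rewrite subr0 => h ->.
have [Y Y0 hY] := nome_small d0.
(* The function tends to 0 at the cusp, so no power of the nome is required. *)
exists 0%N, Y, 1 => z hz zY; rewrite expr0 invr1 mulr1 nmE -[leRHS]/(1%:C) lecR.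
apply: ltW; apply: hd; first exact: nome_neq0.
by rewrite subr0; exact: hY.
Qed.

End SchwarzianModular.

(** * Reading a polynomial off its growth at infinity *)

Section PolynomialLimits.
Variable R : realType.
Local Notation C := (Cplx R).
Implicit Type p : {poly C}.

Lemma ccvg_horner (T : Type) (F : set_system T) (FF : Filter F) (u : T -> C) (a : C) p :
  u @ F --> a -> (fun x => p.[u x]) @ F --> p.[a].
Proof.
move=> ua; elim/poly_ind: p => [|p k IH].
  have -> : (fun x => (0 : {poly C}).[u x]) = fun=> 0 by apply: funext => x; rewrite horner0.
  by rewrite horner0; exact: (ccvg_cst FF).
have -> : (fun x => (p * 'X + k%:P).[u x]) = fun x => p.[u x] * u x + k.
  by apply: funext => x; rewrite hornerMXaddC.
by rewrite hornerMXaddC; exact: (ccvgD FF (ccvgM FF IH ua) (ccvg_cst FF k)).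
Qed.

(** The reversed polynomial turns a limit at infinity into a value at 0. *)
Lemma horner_rev p n (t : C) : t != 0 -> (size p <= n.+1)%N ->
  p.[t] * t ^- n = (\poly_(i < n.+1) p`_(n - i)).[t^-1].
Proof.
move=> t0 pn; rewrite horner_poly (horner_coef_wide _ pn) mulr_suml.
rewrite (reindex_inj rev_ord_inj) /=; apply: eq_bigr => i _.
have ni : (i <= n)%N by rewrite -ltnS.
rewrite subSS -mulrA; congr (_ * _).
have -> : t ^+ n = t ^+ (n - i) * t ^+ i by rewrite -exprD subnK.
by rewrite invfM mulrA mulfV ?expf_neq0// mul1r exprVn.
Qed.

Arguments ccvg_horner {T F} FF {u a} p _.

Section AtInfinity.
Context {T : Type} {F : set_system T} (PF : ProperFilter F).
Variable u : T -> C.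
Hypothesis u_neq0 : \forall x \near F, u x != 0.
Hypothesis u_infty : (fun x => (u x)^-1) @ F --> (0 : C).
Let FF : Filter F := PF.

Lemma ccvg_unique (f : T -> C) (a b : C) : f @ F --> a -> f @ F --> b -> a = b.
Proof. by apply: cvg_unique; exact: norm_hausdorff. Qed.

Lemma horner_infty p n : (size p <= n.+1)%N ->
  (fun x => p.[u x] * u x ^- n) @ F --> p`_n.
Proof.
move=> pn; have h := ccvg_horner FF (\poly_(i < n.+1) p`_(n - i)) u_infty.
rewrite horner_coef0 coef_poly subn0 /= in h.
apply: (ccvg_near FF _ h).
by apply: filterS u_neq0 => x ux; rewrite horner_rev.
Qed.

(** The conclusion says m = deg p + 2. A smaller m would make the leading coefficient vanish, a
    larger one would make l vanish. *)
Lemma degree_infty p m (l : C) : l != 0 ->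
  (fun x => u x ^+ 2 * p.[u x] * u x ^- m) @ F --> l ->
  m = (size p).+1 /\ lead_coef p = l.
Proof.
move=> l0 lim; have [p0|p0] := eqVneq p 0.
  case/eqP: l0; apply: (ccvg_unique lim).
  have -> : (fun x => u x ^+ 2 * p.[u x] * u x ^- m) = fun=> 0.
    by apply: funext => x; rewrite p0 horner0 mulr0 mul0r.
  exact: (ccvg_cst FF).
have := p0; rewrite -size_poly_gt0; case E: (size p) => [//|s] _.
have [ms|ms] := leqP m s.+1.
  have h := @horner_infty p s; rewrite E in h; have {}h := h (leqnn _).
  have h1 : (fun x => p.[u x] * u x ^- s) @ F --> l * 0 ^+ (s.+2 - m).
    apply: (ccvg_near FF _ (ccvgM FF lim (ccvgX FF (s.+2 - m) u_infty))).
    apply: filterS u_neq0 => x ux; rewrite exprVn.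
    have x2 : u x ^+ 2 != 0 by rewrite expf_neq0.
    rewrite -mulrA -invfM -exprD subnKC; last by rewrite ltnW.
    by rewrite -[s.+2]add2n exprD invfM mulrACA mulfV// mul1r.
  have := ccvg_unique h h1; rewrite subSn// exprS mul0r mulr0 => e.
  by move: p0; rewrite -lead_coef_eq0 /lead_coef E /= e eqxx.
case: m ms lim => [//|[//|m]] ms lim.
have pm : (size p <= m.+1)%N by rewrite E; rewrite !ltnS in ms.
have h : (fun x => p.[u x] * u x ^- m) @ F --> l.
  apply: (ccvg_near FF _ lim); apply: filterS u_neq0 => x ux.
  have x2 : u x ^+ 2 != 0 by rewrite expf_neq0.
  rewrite -[m.+2]add2n exprD invfM mulrACA.
  by rewrite mulfV// mul1r.
have e := ccvg_unique (horner_infty pm) h.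
have : (m < size p)%N by rewrite ltnNge; apply: contra_neqN l0 => hm; rewrite -e nth_default.
rewrite E ltnS => ms'; have em : m = s by apply/eqP; rewrite eqn_leq ms' -ltnS -E.
by rewrite /lead_coef E /= -em e.
Qed.

End AtInfinity.
End PolynomialLimits.
Arguments ccvg_horner {R T F} FF {u a} p _.

Section HauptmodulExpansion.
Variables (R : realType) (N : nat).
Local Notation C := (Cplx R).

Lemma hauptmodul_expansion (j : C -> C) : normalized_hauptmodul N j ->
  exists2 c : nat -> C, pscoef c & forall z, uhp z -> j z = laurent c (nome z).
Proof.
(* The expansion has no constant term, and [a 0] is never read; the coefficient sequence is
   therefore completed by 0. *)
move=> [_ _ [a ha] _]; pose c k := if k is 0%N then 0 else a k.
have hs z : uhp z -> series (fun n => c n * nome z ^+ n) @ \oo --> j z - (nome z)^-1.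
  move=> hz; have F : Filter (nbhs (\oo : set_system nat)) by typeclasses eauto.
  apply: (ccvg_near F _ (ccvgB F (ha z hz) (ccvg_cst F (nome z)^-1))).
  exists 1%N => // n /= n1; rewrite addrAC subrr add0r /series /= [RHS]big_ltn//.
  rewrite mul0r add0r big_nat_cond [RHS]big_nat_cond.
  by apply: eq_bigr => k; rewrite andbT => /andP[]; case: k.
have hc : pscoef c.
  apply: series_pscoef => r hr; have [z hz e] := nome_real hr.
  by rewrite -e; exists (j z - (nome z)^-1); exact: hs.
exists c => // z hz.
by rewrite /laurent (ps_lim (hs z hz)) addrC subrK.
Qed.

End HauptmodulExpansion.

(** * Poles and degree of the Schwarzian as a rational function of j *)

Section RationalSchwarzian.
Variables (R : realType) (N : nat).
Local Notation C := (Cplx R).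
Implicit Types (q z w y : C) (g : 'M[R]_2) (p : {poly C}).
Variables (c : nat -> C) (j : C -> C).
Hypothesis sfN : squarefree N.
Hypothesis hc : pscoef c.
Hypothesis jE : forall z, uhp z -> j z = laurent c (nome z).
Hypothesis jinv : forall g z, Gamma0plus N g -> uhp z -> j (mobius g z) = j z.

Lemma near_horner_j_neq0 p z : uhp z -> p != 0 -> \forall w \near z^', p.[j w] != 0.
Proof.
move=> hz p0; have [m [q]] := multiplicity_XsubC p (j z); rewrite p0 /= => nr pE.
have F := dnbhs_filter z; have [k [l [_ l0 ho]]] := j_has_order hc jE hz.
have n1 := ccvg_neq0 F l0 ho.
have n2 := ccvg_neq0 F nr (ccvg_horner F q (cvg_dnbhs (j_continuous hc jE hz))).
apply: filterS2 n1 n2 => w h1 h2; rewrite pE hornerM mulf_neq0// horner_exp.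
rewrite expf_neq0// !hornerE; apply: contra_neq h1 => ->; exact: mul0r.
Qed.

Lemma schw_continuous z : uhp z -> j1 c z != 0 -> schw c @ z --> schw c z.
Proof.
by move=> hz jz; have [l /is_derive_continuous] := derivable_schw hc hz jz.
Qed.

Variable E : seq C.
Hypothesis hE : elliptic_representatives N E.
Local Notation QE := (elliptic_poly j E).

Lemma elliptic_poly_j_neq0 z : uhp z -> j1 c z != 0 -> QE.[j z] != 0.
Proof.
move=> hz jz; have [_ _ h _] := critical_value_elliptic sfN hc jE jinv hE.
rewrite /elliptic_poly hornerZ mulf_neq0 ?pnatr_eq0// horner_prod.
rewrite prodf_seq_neq0; apply/allP => e eE /=.
rewrite horner_exp expf_neq0// !hornerE subr_eq0.
by apply: contra_neq jz => /(h z e hz eE).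
Qed.

(** Away from critical points this is continuity. At a critical point, j z = j e for some e in E,
    and the factor of [QE] at e compensates the pole. *)
Lemma cvg_schw_elliptic z : uhp z ->
  exists l : C, (fun w => schw c w * QE.[j w]) @ z^' --> l.
Proof.
move=> hz; have F := dnbhs_filter z; have cj := cvg_dnbhs (j_continuous hc jE hz).
have [jz|jz] := eqVneq (j1 c z) 0; last first.
  by eexists; exact: (ccvgM F (cvg_dnbhs (schw_continuous hz jz)) (ccvg_horner F QE cj)).
have [_ h _ _] := critical_value_elliptic sfN hc jE jinv hE.
have [e eE je] := h z hz jz.
have [_ [m [l [_ lim]]]] := j_local hc jE hz.
pose q : {poly C} := 2 *: \prod_(x <- rem e E) ('X - (j x)%:P) ^+ 2.
eexists; apply: (ccvg_near F _ (ccvgM F lim (ccvg_horner F q cj))).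
near=> w; rewrite /elliptic_poly (big_rem e eE) /= /q !hornerZ hornerM.
have -> : (('X - (j e)%:P) ^+ 2).[j w] = (j w - j z) ^+ 2 by rewrite horner_exp !hornerE je.
move: (schw c w) ((j w - j z) ^+ 2) (_.[_]) => x y t.
by rewrite -mulrA; congr (_ * _); rewrite mulrCA.
Unshelve. all: by end_near. Qed.

(* In lowest terms QE * A / B = A1 / B1, and a root of B1 is a value of j, near
   which the left-hand side stays bounded. *)
Lemma hauptmodul_schw_poly :
  (exists A B : {poly C}, B != 0 /\ forall z, uhp z ->
     \forall w \near z^', schw c w = A.[j w] / B.[j w]) ->
  exists p : {poly C}, forall z, uhp z ->
    \forall w \near z^', schw c w * QE.[j w] = p.[j w].
Proof.
move=> [A [B [B0 hAB]]]; set D := gcdp (QE * A) B.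
set A1 := QE * A %/ D; set B1 := B %/ D.
have AE : QE * A = A1 * D by rewrite divpK// dvdp_gcdl.
have BE : B = B1 * D by rewrite divpK// dvdp_gcdr.
have co : coprimep A1 B1 by apply: coprimep_div_gcd; rewrite B0 orbT.
have key z : uhp z -> \forall w \near z^', schw c w * QE.[j w] * B1.[j w] = A1.[j w].
  move=> hz; apply: filterS2 (hAB z hz) (near_horner_j_neq0 hz B0) => w -> Bw.
  have := Bw; rewrite BE hornerM mulf_eq0 negb_or => /andP[b1 d1].
  have := congr1 (fun p => p.[j w]) AE; rewrite /= !hornerM.
  move: (A.[_]) (QE.[_]) (A1.[_]) (B1.[_]) (D.[_]) b1 d1 => a x a1 b d b0 d0 e.
  rewrite -[a / _ * x]mulrAC [a * x]mulrC e invfM.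
  by rewrite [b^-1 * _]mulrC mulrA mulfK// divfK.
have B1c : size B1 = 1%N.
  apply/eqP/negPn/negP => /closed_rootP[y By].
  have [z hz jz] := j_surjective sfN hc jE jinv y.
  have PF : ProperFilter z^' by typeclasses eauto.
  have F : Filter z^' := PF.
  have cj := cvg_dnbhs (j_continuous hc jE hz).
  have [l lim] := cvg_schw_elliptic hz.
  have h1 := ccvg_near F (key z hz) (ccvgM F lim (ccvg_horner F B1 cj)).
  have e := ccvg_unique PF h1 (ccvg_horner F A1 cj).
  have b0 : B1.[j z] = 0 by rewrite jz; exact/eqP.
  have a0 : root A1 (j z) by rewrite /root -e b0 mulr0.
  by have := coprimep_root co a0; rewrite b0 eqxx.
have /eqP/size_poly1P[b b0 bE] := B1c.
exists (b^-1 *: A1) => z hz; apply: filterS (key z hz) => w.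
have -> : (b^-1 *: A1).[j w] = b^-1 * A1.[j w] := hornerZ _ _ _.
by rewrite bE hornerC => <-; move: (schw c w * _) => x; rewrite mulrC mulfK.
Qed.

Variable p : {poly C}.
Hypothesis hp : forall z, uhp z -> \forall w \near z^', schw c w * QE.[j w] = p.[j w].

Lemma schw_elliptic_poly z : uhp z -> j1 c z != 0 -> schw c z * QE.[j z] = p.[j z].
Proof.
move=> hz jz; have PF : ProperFilter z^' by typeclasses eauto.
have F : Filter z^' := PF.
have cj := cvg_dnbhs (j_continuous hc jE hz).
have h := ccvg_near F (hp hz) (ccvgM F (cvg_dnbhs (schw_continuous hz jz)) (ccvg_horner F QE cj)).
exact: (ccvg_unique PF h (ccvg_horner F p cj)).
Qed.

Lemma size_elliptic_poly : size QE = (2 * size E).+1 /\ lead_coef QE = 2.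
Proof.
have m : \prod_(e <- E) ('X - (j e)%:P) ^+ 2 \is monic.
  by apply: monic_prod => e _; rewrite monic_exp// monicXsubC.
split; last by rewrite lead_coefZ (monicP m) mulr1.
rewrite size_scale ?pnatr_eq0// /elliptic_poly prodrXl.
have := size_exp (\prod_(e <- E) ('X - (j e)%:P)) 2; rewrite size_prod_XsubC /= mulnC.
by move=> <-; rewrite prednK// size_poly_gt0 -prodrXl monic_neq0.
Qed.

(** At the cusp schw j^2 tends to -1/2 and QE(j) j^(-2|E|) to 2, so [degree_infty] applies with m =
    2|E| and l = -1. *)
Lemma schw_degree : (2 * size E)%N = (size p).+1 /\ lead_coef p = -1.
Proof.
(* The cusp is approached along positive real q, each of which is a nome by [nome_real]. *)
pose i (r : R) : C := r%:C.
have ci : i @ (0 : R)^'+ --> (0 : C)^'.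
  move=> A /near_dnmP[e e0 he].
  have n1 : \forall r \near (0 : R)^'+, 0 < r := nbhs_right_gt 0.
  have n2 : \forall r \near (0 : R)^'+, r < e := nbhs_right_lt e0.
  apply: filterS2 n1 n2 => r r0 re; apply: he.
    by rewrite -nm_gt0 nm_real normr_gt0 gt_eqF.
  by rewrite subr0 nm_real gtr0_norm.
have PF : ProperFilter (0 : R)^'+ by typeclasses eauto.
have FF : Filter (0 : R)^'+ := PF.
pose u r := laurent c (i r).
have lc := cvg_comp _ _ ci (laurent_cusp hc).
have [f fl fE] := schw_cusp hc.
have lf := cvg_comp _ _ ci fl.
have c0 : i @ (0 : R)^'+ --> (0 : C).
  apply: cvg_trans ci _; exact: cvg_within.
have n1 : \forall r \near (0 : R)^'+, i r != 0.
  by apply: (ci [set q | q != 0]); apply/near_dnmP; exists 1.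
have l1 : (1 : C) != 0 by exact: oner_neq0.
have n2 : \forall r \near (0 : R)^'+, i r * u r != 0 := ccvg_neq0 FF l1 lc.
have u0 : \forall r \near (0 : R)^'+, u r != 0.
  by apply: filterS n2 => r; rewrite mulf_eq0 negb_or => /andP[].
have uoo : (fun r => (u r)^-1) @ (0 : R)^'+ --> (0 : C).
  have h := ccvgM FF c0 (ccvgV FF l1 lc); rewrite mul0r in h.
  apply: (ccvg_near FF _ h); apply: filterS n1 => r ir /=.
  by rewrite invfM mulrA mulfV// mul1r.
have su : (fun r => schw_q c (i r) * u r ^+ 2) @ (0 : R)^'+ --> (- (1 / 2) : C).
  have h := ccvgM FF lf (ccvgX FF 2 lc); rewrite expr1n mulr1 in h.
  apply: (ccvg_near FF _ h).
  have n3 : \forall r \near (0 : R)^'+, schw_q c (i r) = i r ^+ 2 * f (i r) := ci _ fE.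
  apply: filterS n3 => r /= ->.
  by rewrite exprMn; move: (i r ^+ 2) (f _) (_ ^+ 2) => x y t; rewrite mulrCA mulrA.
have [sQ lQ] := size_elliptic_poly.
have hQ := @horner_infty R R (0 : R)^'+ PF u u0 uoo QE (2 * size E).
rewrite sQ in hQ; have {}hQ := hQ (leqnn _).
have lQ' : QE`_(2 * size E) = 2 by move: lQ; rewrite /lead_coef sQ.
rewrite lQ' in hQ.
apply: (@degree_infty R R (0 : R)^'+ PF u u0 uoo); first by rewrite oppr_eq0.
have h := ccvgM FF su hQ.
have e : - (1 / 2) * 2 = -1 :> C by field.
rewrite e in h.
have n4 : \forall r \near (0 : R)^'+, r < 1 := nbhs_right_lt ltr01.
have n5 : \forall r \near (0 : R)^'+, 0 < r := nbhs_right_gt 0.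
(* The identity between [schw] and [p] is available only where j' is nonzero, which holds for r
   below exp (- 2 pi Y). *)
have [Y Y0 hY] := j1_cusp hc.
have n6 : \forall r \near (0 : R)^'+, r < expR (- (2 * pi * Y)).
  by apply: nbhs_right_lt; exact: expR_gt0.
apply: (ccvg_near FF _ h); apply: filterS2 n4 (filterI n5 n6) => r r1 [r0 rY].
have [|z hz zr] := @nome_real R r; first by rewrite r0.
have jz : j1 c z != 0.
  apply: hY; move: rY; rewrite -[r]gtr0_norm// -nm_real -zr nm_nome ltr_expR ltrN2.
  by rewrite ltr_pM2l// mulr_gt0// pi_gt0.
have jr : j z = u r := etrans (jE hz) (congr1 (laurent c) zr).
have hs : schw_q c (nome z) * QE.[j z] = p.[j z] := schw_elliptic_poly hz jz.
rewrite jr zr -/(i r) in hs.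
rewrite -hs; move: (schw_q c (i r)) (u r ^+ 2) (QE.[u r]) (u r ^- (2 * size E)) => x y t v.
by rewrite -!mulrA mulrCA.
Qed.

End RationalSchwarzian.

Section SchwarzianEquation.
Variables (R : realType) (N : nat).
Local Notation C := (Cplx R).
Variable j : C -> C.
Hypothesis sfN : squarefree N.
Hypothesis hj : normalized_hauptmodul N j.

(** The left side equals 1/m^2 - 1. *)
Lemma one_class_limit (m : nat) : (0 < m)%N ->
  (1 - m%:R ^+ 2) / (2 * m%:R ^+ 2) * 2 != -1 :> C.
Proof.
move=> m0; have mn : m%:R != 0 :> C by rewrite pnatr_eq0 -lt0n.
move: (m%:R : C) mn => x x0.
have -> : (1 - x ^+ 2) / (2 * x ^+ 2) * 2 = (x ^+ 2)^-1 - 1 by field.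
by rewrite -subr_eq0 opprK subrK invr_eq0 expf_eq0 (negbTE x0).
Qed.

Lemma schwarzian_equation_elliptic (E : seq C) : elliptic_representatives N E ->
  exists (n : nat) (P : {poly C}),
    [/\ (1 <= n)%N, size P = n.+1, size (elliptic_poly j E) = n.+3
      & schwarzian_equation j P (elliptic_poly j E)] /\
    lead_coef P = 1 /\ (n <= 2 * (size E - 1))%N.
Proof.
move=> hE; have [c hc jE] := hauptmodul_expansion hj.
have [_ jinv _ rat] := hj.
have hAB := rat _ (modular_function_schw sfN hc jE jinv).
have [p hp] := hauptmodul_schw_poly sfN hc jE jinv hE hAB.
have [sp lp] := schw_degree hc jE hp.
have [sQ _] := size_elliptic_poly j E.
have k1 : (1 < size E)%N.
  (* An empty [E] contradicts 2|E| = size p + 1; a single class makes p the constant -1, to be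
     compared with the limit at that elliptic point. *)
  case: E hE hp sp {sQ} => [//|e [|//]] hE hp /= [/esym/eqP/size_poly1P[k k0 pE]].
  have [h _ _ _] := critical_value_elliptic sfN hc jE jinv hE.
  have [he _] := h e (mem_head _ _).
  have PF : ProperFilter e^' by typeclasses eauto.
  have FF : Filter e^' := PF.
  have [_ [m [l [[m0 _ _] lim]]]] := j_local hc jE he.
  case/eqP: (one_class_limit m0).
  apply: (ccvg_unique PF (ccvgM FF lim (ccvg_cst FF 2))).
  apply: (ccvg_near FF _ (ccvg_cst FF (-1))).
  apply: filterS (hp e he) => w; rewrite -lp pE lead_coefC hornerC => <-.
  have -> : (elliptic_poly j [:: e]).[j w] = 2 * (j w - j e) ^+ 2.
    by rewrite /elliptic_poly big_seq1 hornerZ horner_exp hornerXsubC.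
  by rewrite -mulrA; congr (_ * _); rewrite mulrC.
(* The degree bound is attained: n is exactly 2(|E| - 1). *)
exists (2 * (size E - 1))%N, (- p); split; last first.
  by split; [rewrite lead_coefN lp opprK|].
split; [lia|by apply: succn_inj; rewrite size_polyN -sp; lia|by rewrite sQ; lia|].
move=> z hz dz.
have d1 : derive1 j z = j1 c z := derive1_val (is_derive_j hc jE hz).
have jz : j1 c z != 0 by rewrite -d1.
have Qz := elliptic_poly_j_neq0 sfN hc jE jinv hE hz jz.
split; first exact: Qz.
rewrite (schwarzianE hc jE hz dz) hornerN -(schw_elliptic_poly hc jE hp hz jz).
by rewrite mulNr opprK mulfK.
Qed.

End SchwarzianEquation.

Theorem theorem6 (R : realType) (N : nat) (j : Cplx R -> Cplx R)
    (N_squarefree : squarefree N)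
    (genus_zero : has_genus R N 0)
    (j_hauptmodul : normalized_hauptmodul N j) :
  (exists (n : nat) (P Q : {poly (Cplx R)}),
      [/\ (1 <= n)%N, size P = n.+1, size Q = n.+3
        & schwarzian_equation j P Q]) /\
  (exists E : seq (Cplx R), elliptic_representatives N E) /\
  (forall E : seq (Cplx R), elliptic_representatives N E ->
     exists (n : nat) (P : {poly (Cplx R)}),
       [/\ (1 <= n)%N, size P = n.+1, size (elliptic_poly j E) = n.+3
         & schwarzian_equation j P (elliptic_poly j E)] /\
       lead_coef P = 1 /\ (n <= 2 * (size E - 1))%N).
Proof.
have [c hc jE] := hauptmodul_expansion j_hauptmodul; have [_ jinv _ _] := j_hauptmodul.
have [E hE] := elliptic_representatives_exist N_squarefree hc jE jinv.
split; [|split].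
- have [n [P [h _]]] := schwarzian_equation_elliptic N_squarefree j_hauptmodul hE.
  by exists n, P, (elliptic_poly j E).
- by exists E.
- by move=> E' hE'; exact: (schwarzian_equation_elliptic N_squarefree j_hauptmodul hE').
Qed.
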